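(* Let $\mathcal{B}=\{B_s\}_{s\in G}$ be a saturated Fell bundle over a discrete group $G$. Then: (i) if $\varphi$ is a positive linear functional on $C^*(\mathcal{B})$, then $\varphi\in P(\mathcal{B})$; (ii) every element of $B(\mathcal{B})$ is a finite linear combination of elements of $P(\mathcal{B})$; (iii) there is an isometric isomorphism from $B(\mathcal{B})$ onto the dual space $C^*(\mathcal{B})^*$; (iv) for every $\varphi\in B(\mathcal{B})$ there exist a representation $\pi\in\Sigma_c(\mathcal{B})$ and vectors $\xi,\eta\in H_\pi$ such that $\varphi=\pi_{\xi,\eta}$ and $\|\varphi\|=\|\xi\|\,\|\eta\|$; (v) for every $\varphi\in B(\mathcal{B})$, $\|\varphi\|=\inf\{\|\xi\|\,\|\eta\| : \varphi=\pi_{\xi,\eta}\}$, the infimum being over all $\pi\in\Sigma_c(\mathcal{B})$ and $\xi,\eta\in H_\pi$ with $\varphi=\pi_{\xi,\eta}$.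
   Context: A Fell bundle over a discrete group $G$ (unit $e$) is a collection $\mathcal{B}=\{B_s\}_{s\in G}$ of closed subspaces of a $C^*$-algebra, indexed by $G$, with $B_sB_t\subseteq B_{st}$ and $B_s^*=B_{s^{-1}}$ for $s,t\in G$. The disjoint union of the fibers (the total space) is also denoted $\mathcal{B}$. The bundle is saturated if the linear span of products $bc$ ($b\in B_s$, $c\in B_t$) is dense in $B_{st}$ for all $s,t\in G$. A section is a map $f$ on $G$ with $f_s=f(s)\in B_s$. The space $c_c(\mathcal{B})$ of finitely supported sections is a $*$-algebra with $(y\star z)_s=\sum_{t}y_tz_{t^{-1}s}$ and $(y^* )_s=(y_{s^{-1}})^*$; $\ell^1(\mathcal{B})$ is the space of sections with $\|f\|_1=\sum_s\|f_s\|<\infty$, with the same operations. For $b\in B_s$, $j_s(b)$ is the section equal to $b$ at $s$ and $0$ elsewhere. $C^*(\mathcal{B})$ (the cross sectional $C^*$-algebra) is the $C^*$-algebra obtained from $c_c(\mathcal{B})$ by taking the supremum of all $C^*$-seminorms, quotienting by the elements of seminorm zero and completing. A representation $\pi$ of $\mathcal{B}$ on a Hilbert space $H_\pi$ is a map $\pi:\mathcal{B}\to\mathcal{L}(H_\pi)$ (bounded operators) whose restrictions $\pi_s:B_s\to\mathcal{L}(H_\pi)$ are linear, with $\pi_s(b)\pi_t(c)=\pi_{st}(bc)$ and $\pi_s(b)^*=\pi_{s^{-1}}(b^* )$ for $b\in B_s$, $c\in B_t$, and $b\mapsto\pi_s(b)\xi$ norm continuous for all $s,\xi$. $\Sigma_c(\mathcal{B})$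 denotes the collection of (unitary equivalence classes of) representations. For $\xi,\eta\in H_\pi$, $\pi_{\xi,\eta}$ is the family $(\pi_{\xi,\eta,s})_{s\in G}$ of functionals $\pi_{\xi,\eta,s}:B_s\to\mathbb{C}$, $\pi_{\xi,\eta,s}(b)=\langle\pi_s(b)\xi,\eta\rangle$. For $f\in\ell^1(\mathcal{B})$ put $\tilde\pi(f)=\sum_s\pi_s(f_s)$ and $\|f\|_*=\sup\{\|\tilde\pi(f)\|:\pi\in\Sigma_c(\mathcal{B})\}$. The Fourier-Stieltjes space is $B(\mathcal{B})=\{\pi_{\xi,\eta}:\pi\in\Sigma_c(\mathcal{B}),\ \xi,\eta\in H_\pi\}$ with norm $\|u\|=\|u\|_{B(\mathcal{B})}=\sup\{|\sum_su_s(f_s)|:f\in\ell^1(\mathcal{B}),\|f\|_*\le1\}$. An element $\varphi\in B(\mathcal{B})$ is positive definite if $\varphi=\pi_{\xi,\xi}$ for some $\pi\in\Sigma_c(\mathcal{B})$, $\xi\in H_\pi$; $P(\mathcal{B})$ is the set of positive definite elements. A functional $\varphi$ on $C^*(\mathcal{B})$ is identified with the family $(\varphi_s)_{s\in G}$, $\varphi_s(b)=\varphi(j_s(b))$ for $b\in B_s$; this is the meaning of ''$\varphi\in P(\mathcal{B})$'' in (i). *)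

(* Defs.v *)
From HB Require Import structures.
From mathcomp Require Import all_boot all_order all_algebra.
From mathcomp Require Import sesquilinear.
From mathcomp Require Import complex.
From mathcomp Require Import all_classical all_reals all_analysis.
From mathcomp.analysis.showcase Require summability.

Set Implicit Arguments.
Unset Strict Implicit.
Unset Printing Implicit Defensive.
Import Order.TTheory GRing.Theory Num.Theory.
Import numFieldNormedType.Exports.

Local Open Scope classical_set_scope.
Local Open Scope ring_scope.
Local Open Scope complex_scope.

(* The norm of a normed module over [R[i]] takes its (real) values in [R[i]];
   [rnorm] is the same norm with values in [R]. *)
Definition rnorm (R : realType) (V : normedModType R[i]) (v : V) : R :=
  complex.Re `|v|.

Definition opnorm (R : realType) (V W : normedModType R[i]) (f : V -> W) : R :=
  sup [set rnorm (f v) | v in [set v | rnorm v <= 1]].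

Definition lspan (K : pzRingType) (V : lmodType K) (S : set V) : set V :=
  [set x | exists (n : nat) (k : 'I_n -> K) (v : 'I_n -> V),
     (forall i, S (v i)) /\ x = \sum_(i < n) k i *: v i].

(* The inner product is linear in its first argument. *)
HB.mixin Record CompleteNormedModule_isHilbert (R : realType) H
    of CompleteNormedModule R[i] H := {
  inner : {dot H for (@Num.conj R[i])};
  inner_norm : forall x : H, inner x x = `|x| ^+ 2
}.

#[short(type="hilbertType")]
HB.structure Definition Hilbert (R : realType) :=
  {H of CompleteNormedModule R[i] H & CompleteNormedModule_isHilbert R H}.

(* C*-algebras are not assumed to be unital, hence are not ring types. *)
HB.mixin Record CompleteNormedModule_isCStarAlgebra (R : realType) A
    of CompleteNormedModule R[i] A := {
  cmul : A -> A -> A;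
  cstar : A -> A;
  cmulA : associative cmul;
  cmul_linearl : forall b : A, linear (cmul ^~ b);
  cmul_linearr : forall a : A, linear (cmul a);
  cstarK : involutive cstar;
  cstar_antilinear : forall (k : R[i]) (a b : A),
    cstar (k *: a + b) = k^* *: cstar a + cstar b;
  cstarM : forall a b : A, cstar (cmul a b) = cmul (cstar b) (cstar a);
  cnormM : forall a b : A, `|cmul a b| <= `|a| * `|b|;
  cnorm_cstar : forall a : A, `|cmul (cstar a) a| = `|a| ^+ 2
}.

#[short(type="cstarType")]
HB.structure Definition CStarAlgebra (R : realType) :=
  {A of CompleteNormedModule R[i] A & CompleteNormedModule_isCStarAlgebra R A}.

Record fellBundle (R : realType) (G : groupType) (A : cstarType R) := FellBundle {
  fib :> G -> set A;
  fib0 : forall s, fib s 0;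
  fib_linear : forall s (k : R[i]) (a b : A),
    fib s a -> fib s b -> fib s (k *: a + b);
  fib_closed : forall s, closed (fib s);
  fib_mul : forall s t (a b : A),
    fib s a -> fib t b -> fib (s * t)%g (cmul a b);
  fib_star : forall s, cstar @` fib s = fib (s^-1)%g
}.

Definition saturated (R : realType) (G : groupType) (A : cstarType R)
    (B : fellBundle G A) :=
  forall s t, B (s * t)%g `<=`
    closure (lspan [set cmul b c | b in B s & c in B t]).

Section Fibers.
Context (R : realType) (G : groupType) (A : cstarType R) (B : fellBundle G A).

Definition fiber (s : G) : Type := {a : A | a \in B s}.

HB.instance Definition _ s :=
  [isSub of fiber s for @sval A (fun a => a \in B s)].
HB.instance Definition _ s := [Choice of fiber s by <:].

Lemma fiber_submod_closed s : subsemimod_closed (fun a => a \in B s).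
Proof.
split; first split; first exact/mem_set/fib0.
- move=> a b /set_mem Ba /set_mem Bb; apply/mem_set.
  by rewrite -[a]scale1r; exact: fib_linear.
- move=> k a /set_mem Ba; apply/mem_set.
  by rewrite -[k *: a]addr0; apply: fib_linear => //; exact: fib0.
Qed.

HB.instance Definition _ s :=
  GRing.SubChoice_isSubLmodule.Build R[i] A _ (fiber s) (fiber_submod_closed s).

HB.instance Definition _ s :=
  Topological.copy (fiber s) (initial_topology (\val : fiber s -> A)).

Lemma fmul_subproof s t (b : fiber s) (c : fiber t) :
  cmul (\val b) (\val c) \in B (s * t)%g.
Proof. by apply/mem_set/fib_mul; apply/set_mem/valP. Qed.

Definition fmul s t (b : fiber s) (c : fiber t) : fiber (s * t)%g :=
  Sub (cmul (\val b) (\val c)) (fmul_subproof b c).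

Lemma fstar_subproof s (b : fiber s) : cstar (\val b) \in B s^-1%g.
Proof.
by apply/mem_set; rewrite -fib_star; exists (\val b) => //; apply/set_mem/valP.
Qed.

Definition fstar s (b : fiber s) : fiber s^-1%g :=
  Sub (cstar (\val b)) (fstar_subproof b).

Definition section := forall s, fiber s.

Definition cc : set section := [set f | finite_set [set s | f s != 0]].

Definition dirac_section s (b : fiber s) : section :=
  dfwith (fun t => 0 : fiber t) s b.

Lemma convolution_subproof s t (b : fiber t) (c : fiber (t^-1 * s)%g) :
  cmul (\val b) (\val c) \in B s.
Proof. by have := fmul_subproof b c; rewrite mulVKg. Qed.

(* The finitary sum [\sum_(t \in _)] over [G] is the sum of the nonzero terms; it
   is the intended one whenever [y] is finitely supported. *)
Definition convolution (y z : section) : section := fun s =>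
  \sum_(t \in [set: G])
    (Sub (cmul (\val (y t)) (\val (z (t^-1 * s)%g)))
       (convolution_subproof (y t) (z (t^-1 * s)%g)) : fiber s).

Lemma section_star_subproof s (b : fiber s^-1%g) : cstar (\val b) \in B s.
Proof. by have := fstar_subproof b; rewrite invgK. Qed.

Definition section_star (y : section) : section := fun s =>
  Sub (cstar (\val (y s^-1%g))) (section_star_subproof (y s^-1%g)).

Definition l1 : set section :=
  [set f | (\esum_(s in [set: G]) (rnorm (\val (f s)))%:E < +oo)%E].

(* The quantifiers range over [cc], so that the values of [p] on other sections
   are irrelevant; [convolution] is only meaningful there as well. *)
Definition cstar_seminorm (p : section -> R) :=
  [/\ forall f, cc f -> 0 <= p f,
      forall f g, cc f -> cc g -> p (fun s => f s + g s) <= p f + p g,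
      forall (k : R[i]) f, cc f -> p (fun s => k *: f s) = rnorm (k : R[i]^o) * p f,
      forall f g, cc f -> cc g -> p (convolution f g) <= p f * p g &
      forall f, cc f -> p (convolution (section_star f) f) = p f ^+ 2].

(* [D] is C*(B), with [iota] the canonical map from [cc]: the Hausdorff
   completion of [cc] for the supremum of all C*-seminorms is characterised, up
   to isomorphism, by the density of the image of [iota] and the formula for its
   norm. The supremum is taken in [\bar R], so it is not a default value. *)
Definition is_cross_sectional_algebra (D : cstarType R) (iota : section -> D) :=
  [/\ forall (k : R[i]) f g, cc f -> cc g ->
        iota (fun s => k *: f s + g s) = k *: iota f + iota g,
      forall f g, cc f -> cc g ->
        iota (convolution f g) = cmul (iota f) (iota g),
      forall f, cc f -> iota (section_star f) = cstar (iota f),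
      closure (iota @` cc) = [set: D] &
      forall f, cc f ->
        (rnorm (iota f))%:E = ereal_sup [set (p f)%:E | p in cstar_seminorm]].

(* The adjoint relation is written out as [<rep b xi, eta> = <xi, rep b^* eta>]. *)
Record representation (H : hilbertType R) := Representation {
  rep :> forall s, fiber s -> H -> H;
  rep_bounded : forall s (b : fiber s), linear (rep b) /\ continuous (rep b);
  rep_linear : forall s xi, linear (fun b : fiber s => rep b xi);
  rep_mul : forall s t (b : fiber s) (c : fiber t) xi,
    rep b (rep c xi) = rep (fmul b c) xi;
  rep_star : forall s (b : fiber s) xi eta,
    inner (rep b xi) eta = inner xi (rep (fstar b) eta);
  rep_continuous : forall s xi, continuous (fun b : fiber s => rep b xi)
}.

Definition functional_family := forall s, fiber s -> R[i].

Definition coefficient (H : hilbertType R) (pi : representation H) (xi eta : H)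
  : functional_family := fun s b => inner (pi s b xi) eta.

(* The sum over [G] is unconditional (limit along finite subsets) and is taken
   pointwise in [H]; for [f] in [l1] it also converges in operator norm. *)
Definition integrated (H : hilbertType R) (pi : representation H) (f : section)
  : H -> H := fun xi => summability.sum (fun s => pi s (f s) xi).

Definition star_norm (f : section) : R :=
  sup [set r | exists (H : hilbertType R) (pi : representation H),
                 r = opnorm (integrated pi f)].

Definition FS_space : set functional_family :=
  [set u | exists (H : hilbertType R) (pi : representation H) (xi eta : H),
             u = coefficient pi xi eta].

Definition FS_norm (u : functional_family) : R :=
  sup [set rnorm (summability.sum (fun s => u s (f s) : R[i]^o)) |
         f in [set f | l1 f /\ star_norm f <= 1]].

Definition positive_definite : set functional_family :=
  [set u | exists (H : hilbertType R) (pi : representation H) (xi : H),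
             u = coefficient pi xi xi].

End Fibers.

Definition positive_functional (R : realType) (D : cstarType R)
    (phi : D -> R[i]) :=
  scalar phi /\ forall d, 0 <= phi (cmul (cstar d) d).

Definition continuous_dual (R : realType) (V : normedModType R[i])
    : set (V -> R[i]^o) :=
  [set phi : V -> R[i]^o | linear phi /\ continuous phi].

(* Main.v *)
(* Everything follows from one fact: a family u with |u(f)| <= M |f|_* for all
   finitely supported f is a coefficient of vectors xi, eta with
   |xi| |eta| <= M. The Hahn-Banach theorem, applied to the sublinear functional
   h |-> sup Re <pi(h) xi, xi> (over all representations pi and unit vectors xi)
   together with a cone of lower bounds, gives a positive functional F of norm
   at most 1 with |u(f)|^2 <= M^2 F(f^* f). In the GNS space of F the cyclic
   vector xi has norm at most 1, and u is f |-> <pi(f) xi, eta> for some eta with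
   |eta| <= M; no polar decomposition in the bidual is needed.

   The norm |.|_* is that of C*(B): f |-> |pi(f)| is a C*-seminorm for every pi,
   and conversely the GNS representation of a positive functional phi on C*(B)
   with phi(y^* y) <= |y|^2 and phi(d^* d) = |d|^2 restricts to a representation
   of B in which d keeps its norm. *)
From HB Require Import structures.
Require Import Defs.
From mathcomp Require Import all_boot all_order all_algebra.
From mathcomp Require Import sesquilinear complex.
From mathcomp Require Import all_classical all_reals all_analysis.
From mathcomp Require Import ring lra finmap.
From mathcomp.analysis.showcase Require summability.

Set Implicit Arguments.
Unset Strict Implicit.
Unset Printing Implicit Defensive.
Import Order.TTheory GRing.Theory Num.Theory.
Import numFieldNormedType.Exports.

Local Open Scope classical_set_scope.
Local Open Scope complex_scope.
Local Open Scope ring_scope.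

(** * Complex moduli, norms and sequences *)

(** Statements (ii), (iv) and (v) mention no model of the cross sectional algebra, so the functional
    F is built on finitely supported sections, and identities between products of sections are read
    off in representations. The wanted inequality between u and F is quadratic in the section,
    whereas Hahn-Banach accepts only linear conditions on F. The cone linearises it: each section x
    contributes one lower bound for F, at [M^2 x^* x]. The bundle need not have a unit section at
    which F could be normalised; the bounds F(h) >= -m, for every h that is >= -m in all
    representations, take the place of F(1) <= 1, and applied to completed squares they give
    |F(v)|^2 <= F(v^* v). Since the GNS space consists of antilinear functionals, these two
    inequalities say directly that the conjugates of F and of u are vectors of it, of norm at most 1
    and M. Only the comparison of norms and statement (i) draw on C*-theory: positivity of a^* a,
    monotonicity of the norm and boundedness of positive functionals. An iterated square root
    replaces spectra and functional calculus there. *)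

Lemma addr_idem (V : zmodType) (a : V) : a = a + a -> a = 0.
Proof. by move=> aa; apply: (addrI a); rewrite -aa addr0. Qed.

Section ComplexModulus.
Variable R : realType.
Implicit Types (z w : R[i]) (x : R).

Definition cabs z : R := complex.Re `|z|.

Lemma cabsE z : `|z| = (cabs z)%:C.
Proof. by rewrite /cabs RRe_real// normr_real. Qed.

Lemma cabs_ge0 z : 0 <= cabs z.
Proof. by rewrite -ler0c -cabsE. Qed.

Lemma cabsD z w : cabs (z + w) <= cabs z + cabs w.
Proof. by rewrite -lecR rmorphD/= -!cabsE ler_normD. Qed.

Lemma cabsM z w : cabs (z * w) = cabs z * cabs w.
Proof. by apply: complexI; rewrite rmorphM/= -!cabsE normrM. Qed.

Lemma cabsB z w : cabs (z - w) = cabs (w - z).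
Proof. by rewrite /cabs distrC. Qed.

Lemma cabsJ z : cabs z^* = cabs z.
Proof. by rewrite /cabs normcJ. Qed.

Lemma cabs0 : cabs 0 = 0.
Proof. by rewrite /cabs normr0. Qed.

Lemma cabs1 : cabs 1 = 1.
Proof. by rewrite /cabs normr1. Qed.

Lemma cabs_eq0 z : cabs z = 0 -> z = 0.
Proof. by move=> z0; apply/eqP; rewrite -normr_eq0 cabsE z0. Qed.

Lemma cabs_real x : cabs x%:C = `|x|.
Proof. by rewrite /cabs normc_def /= expr0n addr0 sqrtr_sqr. Qed.

Lemma cabs_i : cabs 'i%C = 1.
Proof. by rewrite /cabs normc_def/= expr0n/= add0r expr1n sqrtr1. Qed.

Lemma sqr_cabs z : cabs z ^+ 2 = complex.Re z ^+ 2 + complex.Im z ^+ 2.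
Proof. by apply: complexI; rewrite add_Re2_Im2 cabsE rmorphXn. Qed.

Lemma sqr_cabsC z : (cabs z ^+ 2)%:C = z * z^*.
Proof. by rewrite rmorphXn/= -cabsE sqr_normc. Qed.

Lemma normr_Re_le z : `|complex.Re z| <= cabs z.
Proof. by rewrite -lecR -cabsE normc_ge_Re. Qed.

Lemma Re_le z : complex.Re z <= cabs z.
Proof. exact: le_trans (ler_norm _) (normr_Re_le z). Qed.

Lemma normr_Im_le z : `|complex.Im z| <= cabs z.
Proof.
rewrite -(@ler_pXn2r _ 2) ?nnegrE ?cabs_ge0// sqr_cabs real_normK ?num_real//.
by rewrite lerDr sqr_ge0.
Qed.

Lemma ReM_real x z : complex.Re (x%:C * z) = x * complex.Re z.
Proof. by case: z => a b /=; ring. Qed.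

Lemma ReD z w : complex.Re (z + w) = complex.Re z + complex.Re w.
Proof. by case: z w => [? ?] [? ?]. Qed.

Lemma ImD z w : complex.Im (z + w) = complex.Im z + complex.Im w.
Proof. by case: z w => [? ?] [? ?]. Qed.

Lemma ReN z : complex.Re (- z) = - complex.Re z.
Proof. by case: z. Qed.

Lemma ImN z : complex.Im (- z) = - complex.Im z.
Proof. by case: z. Qed.

Lemma conjC_real x : (x%:C)^* = x%:C.
Proof. exact: conjc_real. Qed.

Lemma ReJ z : complex.Re z^* = complex.Re z.
Proof. by case: z. Qed.

Lemma cge0_Re z : 0 <= z -> 0 <= complex.Re z.
Proof. by case: z => a b; rewrite lecE/= => /andP[]. Qed.

Lemma cge0_real z : 0 <= z -> z = (complex.Re z)%:C.
Proof. by case: z => a b; rewrite lecE/= => /andP[/eqP-> _]. Qed.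

Lemma complex_eqP z w :
  complex.Re z = complex.Re w -> complex.Im z = complex.Im w -> z = w.
Proof. by case: z w => [? ?] [? ?] /= -> ->. Qed.

Lemma cabs_phase z : exists w, cabs w = 1 /\ w * z = (cabs z)%:C.
Proof.
have [->|z0] := eqVneq z 0.
  by exists 1; rewrite mulr0 cabs0 cabs1.
have c0 : cabs z != 0 by apply: contra_neq z0; exact: cabs_eq0.
have cc0 : (cabs z)%:C != 0 by apply: contra_neq c0 => /complexI.
exists (z^* / (cabs z)%:C); split; last first.
  by rewrite mulrAC -[X in X / _]mulrC -sqr_cabsC rmorphXn/= expr2 mulfK.
have e : cabs (z^* / (cabs z)%:C) * cabs z = cabs z.
  rewrite -[X in _ * X](ger0_norm (cabs_ge0 z)) -cabs_real -cabsM mulfVK//.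
  exact: cabsJ.
by rewrite -[LHS](mulfK c0) e divff.
Qed.

End ComplexModulus.

Section RealNorm.
Variables (R : realType) (V : normedModType R[i]).
Implicit Types v w : V.

Lemma rnormE v : `|v| = (rnorm v)%:C.
Proof. by rewrite /rnorm RRe_real// normr_real. Qed.

Lemma rnorm_ge0 v : 0 <= rnorm v.
Proof. by rewrite -ler0c -rnormE. Qed.

Lemma rnormD v w : rnorm (v + w) <= rnorm v + rnorm w.
Proof. by rewrite -lecR rmorphD/= -!rnormE ler_normD. Qed.

Lemma rnormN v : rnorm (- v) = rnorm v.
Proof. by rewrite /rnorm normrN. Qed.

Lemma rnormB v w : rnorm (v - w) = rnorm (w - v).
Proof. by rewrite /rnorm distrC. Qed.

Lemma rnorm0 : rnorm (0 : V) = 0.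
Proof. by rewrite /rnorm normr0. Qed.

Lemma rnormZ (k : R[i]) v : rnorm (k *: v) = cabs k * rnorm v.
Proof. by apply: complexI; rewrite rmorphM/= -rnormE normrZ cabsE rnormE. Qed.

Lemma rnormZr (x : R) v : rnorm (x%:C *: v) = `|x| * rnorm v.
Proof. by rewrite rnormZ cabs_real. Qed.

Lemma rnorm_eq0 v : rnorm v = 0 -> v = 0.
Proof. by move=> v0; apply/eqP; rewrite -normr_eq0 rnormE v0. Qed.

Lemma rnorm_triangle u v w : rnorm (v - w) <= rnorm (v - u) + rnorm (u - w).
Proof. by rewrite -(subrKA u); exact: rnormD. Qed.

End RealNorm.

(** * Convergence and completeness through sequences with real tolerances *)

Section Sequences.
Variable R : realType.

Lemma half_gt0 (e : R) : 0 < e -> 0 < e / 2.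
Proof. by move=> e0; rewrite divr_gt0. Qed.

Lemma ge_small (x y : R) : (forall e, 0 < e -> x <= y + e) -> x <= y.
Proof.
move=> xy; rewrite leNgt; apply/negP => yx.
by have := xy ((x - y) / 2); rewrite divr_gt0 ?subr_gt0// => /(_ isT); lra.
Qed.

Definition invS (n : nat) : R := n.+1%:R^-1.

Lemma invS_gt0 n : 0 < invS n.
Proof. by rewrite invr_gt0. Qed.

Lemma small_invS (e : R) : 0 < e -> exists N, forall n, (N <= n)%N -> invS n < e.
Proof.
move=> e0; have [N _ h] := near_infty_natSinv_lt (PosNum e0).
by exists N => n; exact: h.
Qed.

Section Normed.
Variable V : normedModType R[i].
Implicit Types u : nat -> V.

(** Norms are read through [rnorm], and tolerances are real and bounds non-strict, so that estimates
    become arithmetic over [R]. [seq_complete] translates back to filters where an instance of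
    completeness is built. *)
Definition cauchy_seq u := forall e : R, 0 < e ->
  exists N, forall n m, (N <= n)%N -> (N <= m)%N -> rnorm (u n - u m) <= e.

Definition tends u (l : V) := forall e : R, 0 < e ->
  exists N, forall n, (N <= n)%N -> rnorm (u n - l) <= e.

Lemma tends_unique u l l' : tends u l -> tends u l' -> l = l'.
Proof.
move=> ul ul'; apply/eqP; rewrite -subr_eq0; apply/eqP/rnorm_eq0/le_anti.
rewrite rnorm_ge0 andbT; apply: ge_small => e e0; rewrite add0r.
have e2 := half_gt0 e0.
have [N1 h1] := ul _ e2; have [N2 h2] := ul' _ e2.
have := h1 (maxn N1 N2) (leq_maxl _ _); have := h2 (maxn N1 N2) (leq_maxr _ _).
rewrite [X in _ -> X <= _ -> _]rnormB.
have := rnorm_triangle (u (maxn N1 N2)) l l'; lra.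
Qed.

Lemma tendsD u u' l l' : tends u l -> tends u' l' -> tends (fun n => u n + u' n) (l + l').
Proof.
move=> ul ul' e e0.
have e2 := half_gt0 e0.
have [N1 h1] := ul _ e2; have [N2 h2] := ul' _ e2.
exists (maxn N1 N2) => n; rewrite geq_max => /andP[/h1 n1 /h2 n2].
have := rnormD (u n - l) (u' n - l'); rewrite opprD addrACA; lra.
Qed.

Lemma tends_cst l : tends (fun=> l) l.
Proof. by move=> e e0; exists 0%N => n _; rewrite subrr rnorm0 ltW. Qed.

Lemma tends_shift u l : tends u l -> tends (fun n => u n.+1) l.
Proof. by move=> ul e /ul[N h]; exists N => n Nn; apply: h; exact: leqW. Qed.

Lemma tends_lip (W : normedModType R[i]) (f : V -> W) (M : R) u l :
  (forall x y, rnorm (f x - f y) <= M * rnorm (x - y)) ->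
  tends u l -> forall e : R, 0 < e ->
  exists N, forall n, (N <= n)%N -> rnorm (f (u n) - f l) <= e.
Proof.
move=> fM ul e e0.
have M1 : 0 < `|M| + 1 by rewrite ltr_wpDl.
have [N h] := ul (e / (`|M| + 1)) (divr_gt0 e0 M1).
exists N => n /h; rewrite ler_pdivlMr// => le.
apply: le_trans (fM _ _) (le_trans _ le).
rewrite mulrC ler_wpM2l ?rnorm_ge0//.
by rewrite (le_trans (ler_norm _))// lerDl.
Qed.

Lemma tends_norm_le u l (M : R) : tends u l ->
  (forall n, rnorm (u n) <= M) -> rnorm l <= M.
Proof.
move=> ul uM; apply: ge_small => e /ul[N /(_ N (leqnn _))] h.
have := rnormD (l - u N) (u N); rewrite subrK rnormB; have := uM N; lra.
Qed.

Lemma cvg_tends u l : u @ \oo --> l -> tends u l.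
Proof.
move=> /cvgrPdist_le ul e e0.
have /ul[N _ h] : 0 < e%:C by rewrite ltcR.
by exists N => n Nn; rewrite rnormB -lecR -rnormE; exact: h.
Qed.

(** A Cauchy filter contains a ball of radius 1/(n+1) for every n. Any two such balls meet, so the
    chosen centres form a Cauchy sequence, and its limit is a limit of the filter. *)
Lemma seq_complete :
  (forall u, cauchy_seq u -> exists l, tends u l) ->
  forall F : set_system V, ProperFilter F -> cauchy F -> cvg F.
Proof.
move=> Vc F FF Fc.
have pick n : exists x, F (ball x (invS n)%:C).
  have /cauchyP/(_ (invS n)%:C) := Fc; apply.
  by rewrite ltcR invS_gt0.
have [x Fx] := choice pick.
have bE y (d : R) z : ball y d%:C z -> rnorm (y - z) < d.
  by rewrite -ball_normE/= rnormE ltcR.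
have [|l xl] := Vc x.
  move=> e e0; have [N h] := @small_invS (e / 2) (half_gt0 e0).
  exists N => n m /h hn /h hm.
  have [y [/bE y1 /bE y2]] := filter_ex (filterI (Fx n) (Fx m)).
  have := rnorm_triangle y (x n) (x m); rewrite (rnormB y); lra.
apply/cvg_ex; exists l; apply/cvgrPdist_le => e e0.
have eE : e = (complex.Re e)%:C by apply: cge0_real; exact: ltW.
have e'0 : 0 < complex.Re e by move: e0; rewrite {1}eE ltcR.
have [N1 h1] := xl (complex.Re e / 2) (half_gt0 e'0).
have [N2 h2] := @small_invS (complex.Re e / 2) (half_gt0 e'0).
set n := maxn N1 N2.
apply: filterS (Fx n) => z /bE xz.
rewrite rnormE eE lecR.
have := h1 n (leq_maxl _ _); have := h2 n (leq_maxr _ _).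
have := rnorm_triangle (x n) l z; rewrite (rnormB l (x n)); lra.
Qed.

End Normed.

Lemma cauchy_tends (V : completeNormedModType R[i]) (u : nat -> V) :
  cauchy_seq u -> exists l, tends u l.
Proof.
move=> uc; suff /cvg_ex[l ul] : cvg (u @ \oo) by exists l; exact: cvg_tends.
apply: cauchy_cvg; apply/cauchyP => e e0.
have eE : e = (complex.Re e)%:C by apply: cge0_real; exact: ltW.
have e'0 : 0 < complex.Re e by move: e0; rewrite {1}eE ltcR.
have [N h] := uc (complex.Re e / 2) (half_gt0 e'0).
exists (u N); exists N => // n Nn /=.
rewrite -ball_normE/= eE rnormE ltcR.
by have := h N n (leqnn _) Nn; lra.
Qed.

Lemma real_cauchy_tends (u : nat -> R) :
  (forall e, 0 < e -> exists N, forall n m, (N <= n)%N -> (N <= m)%N -> `|u n - u m| <= e) ->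
  exists l, forall e, 0 < e -> exists N, forall n, (N <= n)%N -> `|u n - l| <= e.
Proof.
move=> uc; suff /cvg_ex[l /cvgrPdist_le ul] : cvg (u @ \oo).
  by exists l => e /ul[N _ h]; exists N => n Nn; rewrite distrC; exact: h.
apply: cauchy_cvg; apply/cauchyP => e e0.
have [N h] := uc (e / 2) (half_gt0 e0).
exists (u N); exists N => // n Nn /=.
rewrite -ball_normE/=.
by have := h N n (leqnn _) Nn; lra.
Qed.

Lemma complex_cauchy_tends (u : nat -> R[i]^o) : cauchy_seq u -> exists l, tends u l.
Proof.
move=> uc.
have [|a ha] := @real_cauchy_tends (fun n => complex.Re (u n)).
  move=> e /uc[N h]; exists N => n m Nn Nm.
  rewrite -ReN -ReD; apply: le_trans (normr_Re_le _) (h _ _ Nn Nm).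
have [|b hb] := @real_cauchy_tends (fun n => complex.Im (u n)).
  move=> e /uc[N h]; exists N => n m Nn Nm.
  rewrite -ImN -ImD; apply: le_trans (normr_Im_le _) (h _ _ Nn Nm).
exists (a +i* b) => e e0.
have e2 := half_gt0 e0.
have [N1 h1] := ha _ e2; have [N2 h2] := hb _ e2.
exists (maxn N1 N2) => n; rewrite geq_max => /andP[/h1 n1 /h2 n2].
rewrite -[rnorm _]/(cabs _) [u n - _]complexE.
apply: le_trans (cabsD _ _) _; rewrite cabsM cabs_i !cabs_real mul1r.
rewrite ReD ImD ReN ImN /=; lra.
Qed.

(** * Extension of Lipschitz functions by density *)

Section Extension.
Variables (W : normedModType R[i]) (X : Type) (j : X -> W).
Hypothesis jdense : forall w (e : R), 0 < e -> exists x, rnorm (w - j x) <= e.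

(** The value at [w] is described by an error estimate instead of a limit. By density the estimate
    determines it ([lipschitz_extension_unique]), so an identity of extended maps can be proved by
    exhibiting such an estimate. *)
Lemma lipschitz_extension (g : X -> R[i]) (M : R) : 0 <= M ->
  (forall x y, cabs (g x - g y) <= M * rnorm (j x - j y)) ->
  forall w, exists z, forall x, cabs (z - g x) <= M * rnorm (w - j x).
Proof.
move=> M0 gM w.
have [x xw] := choice (fun n => @jdense w (invS n) (invS_gt0 n)).
have M1 : 0 < M + 1 by rewrite ltr_wpDl.
have gle y n : cabs (g (x n) - g y) <= M * (rnorm (w - j y) + invS n).
  apply: le_trans (gM _ _) _; rewrite ler_wpM2l//.
  have := rnorm_triangle w (j (x n)) (j y); rewrite [rnorm (j _ - w)]rnormB.
  by have := xw n; lra.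
have [|z hz] := @complex_cauchy_tends (fun n => g (x n)).
  move=> e e0; have e2 : 0 < e / 2 / (M + 1) by rewrite !divr_gt0.
  have [N h] := small_invS e2; exists N => n m /h hn /h hm.
  apply: le_trans (gle _ _) _.
  have : rnorm (w - j (x m)) + invS n <= e / (M + 1).
    have -> : e / (M + 1) = e / 2 / (M + 1) + e / 2 / (M + 1) by field; lra.
    by have := xw m; lra.
  rewrite ler_pdivlMr// mulrC => le; apply: le_trans le.
  by have := invS_gt0 n; have := rnorm_ge0 (w - j (x m)); nra.
exists z => y; apply: ge_small => e e0.
have e2 : 0 < e / 2 by rewrite divr_gt0.
have [N h] := hz _ e2; have [N' h'] := @small_invS (e / 2 / (M + 1)) (divr_gt0 e2 M1).
set n := maxn N N'.
have {}h := h n (leq_maxl _ _); have {}h' := h' n (leq_maxr _ _).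
have := gle y n; move: h'; rewrite ltr_pdivlMr// => h'.
have : cabs (z - g y) <= cabs (z - g (x n)) + cabs (g (x n) - g y).
  by rewrite -[z - g y](subrKA (g (x n))); exact: cabsD.
rewrite (cabsB z (g (x n))); move: h; rewrite -[rnorm _]/(cabs _).
have := invS_gt0 n.
rewrite mulrDr; nra.
Qed.

Lemma lipschitz_extension_unique (g : X -> R[i]) (M M' : R) w z z' :
  0 <= M -> 0 <= M' ->
  (forall x, cabs (z - g x) <= M * rnorm (w - j x)) ->
  (forall x, cabs (z' - g x) <= M' * rnorm (w - j x)) -> z = z'.
Proof.
move=> M0 M'0 hz hz'; apply/eqP; rewrite -subr_eq0; apply/eqP/cabs_eq0/le_anti.
rewrite cabs_ge0 andbT; apply: ge_small => e e0; rewrite add0r.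
have M1 : 0 < M + M' + 1 by lra.
have [x] := jdense w (divr_gt0 e0 M1); rewrite ler_pdivlMr// => le.
have : cabs (z - z') <= cabs (z - g x) + cabs (g x - z').
  by rewrite -[z - z'](subrKA (g x)); exact: cabsD.
rewrite (cabsB (g x)); have := hz x; have := hz' x; have := rnorm_ge0 (w - j x).
nra.
Qed.

End Extension.
End Sequences.

(** * Linear combinations in modules *)

(* A reflexive normaliser for equations between linear combinations: [lmod]
   reduces an equation in a module to the equality of the coefficients of each
   atom. *)
Section LinearCombinations.
Variables (K : pzRingType) (V : lmodType K).

Inductive lexpr :=
  | LVar of nat | LZero | LAdd of lexpr & lexpr | LOpp of lexpr
  | LScale of K & lexpr.

Fixpoint leval (env : seq V) (t : lexpr) : V :=
  match t with
  | LVar n => nth 0 env n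
  | LZero => 0
  | LAdd t u => leval env t + leval env u
  | LOpp t => - leval env t
  | LScale k t => k *: leval env t
  end.

(** [Nat.eqb] stands in for [==] so that [cbn] can evaluate the coefficients in [lmod]. *)
Fixpoint lcoef (t : lexpr) (n : nat) : K :=
  match t with
  | LVar m => if Nat.eqb m n then 1 else 0
  | LZero => 0
  | LAdd t u => lcoef t n + lcoef u n
  | LOpp t => - lcoef t n
  | LScale k t => k * lcoef t n
  end.

Fixpoint lcoef_eq (t u : lexpr) (n : nat) : Prop :=
  if n is n'.+1 then lcoef t n' = lcoef u n' /\ lcoef_eq t u n' else True.

Lemma leval_coef env t : leval env t = \sum_(i < size env) lcoef t i *: nth 0 env i.
Proof.
elim: t => [n||t IHt u IHu|t IHt|k t IHt] /=.
- have [nl|nl] := ltnP n (size env); last first.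
    rewrite nth_default// big1// => i _.
    have [ni|_] := PeanoNat.Nat.eqb_spec n i; last by rewrite scale0r.
    by move: nl; rewrite ni leqNgt ltn_ord.
  rewrite (bigD1 (Ordinal nl))//= PeanoNat.Nat.eqb_refl scale1r big1 ?addr0// => i ni.
  have [E|_] := PeanoNat.Nat.eqb_spec n i; last by rewrite scale0r.
  by case/eqP: ni; apply: val_inj.
- by rewrite big1// => i _; rewrite scale0r.
- by rewrite IHt IHu -big_split; apply: eq_bigr => i _; rewrite scalerDl.
- by rewrite IHt -sumrN; apply: eq_bigr => i _; rewrite scaleNr.
- by rewrite IHt scaler_sumr; apply: eq_bigr => i _; rewrite scalerA.
Qed.

Lemma lexpr_eq env t u : lcoef_eq t u (size env) -> leval env t = leval env u.
Proof.
rewrite !leval_coef => tu; apply: eq_bigr => -[i /=].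
elim: (size env) tu => // n IH [nE tu]; rewrite ltnS leq_eqVlt => /orP[/eqP->|/(IH tu)//].
by rewrite nE.
Qed.

End LinearCombinations.

Ltac lm_index x env :=
  match env with
  | x :: _ => constr:(O)
  | _ :: ?env' => let n := lm_index x env' in constr:(S n)
  end.

Ltac lm_atoms t env :=
  match t with
  | (?a + ?b)%R => let env1 := lm_atoms a env in lm_atoms b env1
  | (- ?a)%R => lm_atoms a env
  | (?k *: ?a)%R => lm_atoms a env
  | (0)%R => env
  | _ => match env with
         | _ => let n := lm_index t env in env
         | _ => constr:(t :: env)
         end
  end.

Ltac lm_reify K t env :=
  match t with
  | (?a + ?b)%R => let u := lm_reify K a env in let v := lm_reify K b env in
                 constr:(@LAdd K u v)
  | (- ?a)%R => let u := lm_reify K a env in constr:(@LOpp K u)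
  | (?k *: ?a)%R => let u := lm_reify K a env in constr:(@LScale K k u)
  | (0)%R => constr:(@LZero K)
  | _ => let n := lm_index t env in constr:(@LVar K n)
  end.

Ltac lmod V :=
  lazymatch type of V with
  | GRing.Lmodule.type ?K =>
    lazymatch goal with
    | |- ?a = ?b =>
      let env0 := lm_atoms a (@nil (GRing.Lmodule.sort V)) in
      let env := lm_atoms b env0 in
      let t := lm_reify K a env in
      let u := lm_reify K b env in
      change (@leval K V env t = @leval K V env u);
      apply: lexpr_eq; cbn [lcoef_eq lcoef size Nat.eqb]; (do ? split)
    end
  end.

(** * Hilbert spaces of positive semidefinite forms *)

Section PsdForms.
Variables (R : realType) (V : lmodType R[i]).

Record psdform := Psdform {
  pform :> V -> V -> R[i];
  pformP : forall y k x x', pform (k *: x + x') y = k * pform x y + pform x' y;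
  pformJ : forall x y, pform y x = (pform x y)^*;
  pform_ge0 : forall x, 0 <= pform x x }.

Variable p : psdform.

Definition psq x : R := complex.Re (p x x).
Definition psn x : R := Num.sqrt (psq x).

Lemma psqE x : p x x = (psq x)%:C.
Proof. exact/cge0_real/pform_ge0. Qed.

Lemma psq_ge0 x : 0 <= psq x.
Proof. exact/cge0_Re/pform_ge0. Qed.

Lemma psn_ge0 x : 0 <= psn x.
Proof. exact: sqrtr_ge0. Qed.

Lemma sqr_psn x : psn x ^+ 2 = psq x.
Proof. by rewrite sqr_sqrtr// psq_ge0. Qed.

Lemma pform0l y : p 0 y = 0.
Proof.
have := pformP p y 1 0 0; rewrite scaler0 addr0 mul1r.
exact: addr_idem.
Qed.

Lemma pformZl k x y : p (k *: x) y = k * p x y.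
Proof. by rewrite -[k *: x]addr0 pformP pform0l addr0. Qed.

Lemma pformDl x x' y : p (x + x') y = p x y + p x' y.
Proof. by rewrite -{1}[x]scale1r pformP mul1r. Qed.

Lemma pformBl x x' y : p (x - x') y = p x y - p x' y.
Proof. by rewrite pformDl -scaleN1r pformZl mulN1r. Qed.

Lemma pformPr y k x x' : p y (k *: x + x') = k^* * p y x + p y x'.
Proof. by rewrite pformJ pformP rmorphD rmorphM/= -!pformJ. Qed.

Lemma pformDr y x x' : p y (x + x') = p y x + p y x'.
Proof. by rewrite -{1}[x]scale1r pformPr rmorph1 mul1r. Qed.

Lemma pform0r y : p y 0 = 0.
Proof. by rewrite pformJ pform0l rmorph0. Qed.

Lemma pformZr k x y : p x (k *: y) = k^* * p x y.
Proof. by rewrite -[k *: y]addr0 pformPr pform0r addr0. Qed.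

Lemma psqZ k x : psq (k *: x) = cabs k ^+ 2 * psq x.
Proof. by rewrite /psq pformZl pformZr mulrA -sqr_cabsC ReM_real. Qed.

Lemma psnZ k x : psn (k *: x) = cabs k * psn x.
Proof. by rewrite /psn psqZ sqrtrM ?sqr_ge0// sqrtr_sqr ger0_norm ?cabs_ge0. Qed.

Lemma psqDZ (t : R) x y :
  psq (x + t%:C *: y) = psq x + 2 * t * complex.Re (p x y) + t ^+ 2 * psq y.
Proof.
rewrite /psq pformDl !pformDr !pformZl !pformZr !ReD conjC_real !ReM_real.
by rewrite (pformJ p x y) ReJ; ring.
Qed.

(** The inequality between the coefficients is the sign of the discriminant. The case [b = 0] occurs
    because the forms are only semidefinite; there a polynomial of degree one that is bounded below
    must be constant. *)
Lemma quadratic_disc (a b c : R) : 0 <= b ->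
  (forall t, 0 <= a + 2 * t * c + t ^+ 2 * b) -> c ^+ 2 <= a * b.
Proof.
move=> b_ge0 H; have [b0|b0] := eqVneq b 0.
  have [->|c0] := eqVneq c 0; first by rewrite b0; lra.
  (* At this point the polynomial takes the value -1. *)
  have := H (- (a + 1) / (2 * c)); rewrite b0.
  have -> : 2 * (- (a + 1) / (2 * c)) * c = - (a + 1) by field.
  lra.
have b1 : 0 < b by rewrite lt_neqAle eq_sym b0.
have := H (- c / b).
have -> : a + 2 * (- c / b) * c + (- c / b) ^+ 2 * b = (a * b - c ^+ 2) / b by field.
by rewrite ler_pdivlMr// mul0r subr_ge0.
Qed.

Lemma cauchy_schwarz_psq x y : cabs (p x y) ^+ 2 <= psq x * psq y.
Proof.
have [w [w1 wp]] := cabs_phase (p x y).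
have -> : psq x = psq (w *: x) by rewrite psqZ w1 expr1n mul1r.
have -> : cabs (p x y) = complex.Re (p (w *: x) y) by rewrite pformZl wp.
apply: quadratic_disc; first exact: psq_ge0.
by move=> t; rewrite -psqDZ psq_ge0.
Qed.

Lemma cauchy_schwarz x y : cabs (p x y) <= psn x * psn y.
Proof.
rewrite -(@ler_pXn2r _ 2) ?nnegrE ?cabs_ge0 ?mulr_ge0 ?psn_ge0//.
by rewrite exprMn !sqr_psn cauchy_schwarz_psq.
Qed.

End PsdForms.

(* The Hilbert space of a positive semidefinite form on [V] is realised as its
   own antidual: the antilinear functionals on [V] bounded by a multiple of the
   seminorm of the form. No completion or quotient has to be taken. *)
Section Rkhs.
Variables (R : realType) (V : lmodType R[i]) (p : psdform V).

Definition rkbound (u : V -> R[i]) (M : R) :=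
  0 <= M /\ forall x, cabs (u x) <= M * psn p x.

Definition rkset : set (V -> R[i]^o) :=
  [set u | (forall k x y, u (k *: x + y) = k^* * u x + u y) /\
           exists M, rkbound u M].

Definition rkhs : Type := {u : V -> R[i]^o | u \in rkset}.

HB.instance Definition _ := [isSub of rkhs for @sval _ (fun u => u \in rkset)].
HB.instance Definition _ := [Choice of rkhs by <:].

Lemma rkbound0 : rkbound (fun=> 0) 0.
Proof. by split=> // x; rewrite cabs0 mul0r. Qed.

Lemma rkboundD u v M N : rkbound u M -> rkbound v N ->
  rkbound (fun x => u x + v x) (M + N).
Proof.
move=> [M0 uM] [N0 vN]; split=> [|x]; first by rewrite addr_ge0.
by rewrite mulrDl; apply: le_trans (cabsD _ _) (lerD _ _).
Qed.

Lemma rkboundZ k u M : rkbound u M -> rkbound (fun x => k * u x) (cabs k * M).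
Proof.
move=> [M0 uM]; split=> [|x]; first by rewrite mulr_ge0// cabs_ge0.
by rewrite cabsM -mulrA ler_wpM2l// cabs_ge0.
Qed.

Lemma rkset_submod_closed : subsemimod_closed (fun u => u \in rkset).
Proof.
split; first split.
- apply/mem_set; split=> [k x y|]; first by rewrite /= mulr0 addr0.
  by exists 0; exact: rkbound0.
- move=> u v /set_mem[ul [M uM]] /set_mem[vl [N vN]]; apply/mem_set; split.
    move=> k x y; rewrite -![(u + v) _]/(u _ + v _) ul vl; ring.
  by exists (M + N); exact: rkboundD.
- move=> k u /set_mem[ul [M uM]]; apply/mem_set; split.
    move=> l x y; rewrite -![(k *: u) _]/(k * u _) ul; ring.
  by exists (cabs k * M); exact: rkboundZ.
Qed.

HB.instance Definition _ :=
  GRing.SubChoice_isSubLmodule.Build R[i] (V -> R[i]^o) _ rkhs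
    rkset_submod_closed.

Definition rkv (u : rkhs) : V -> R[i] := \val u.

Lemma rkvP (u : rkhs) k x y : rkv u (k *: x + y) = k^* * rkv u x + rkv u y.
Proof. by have /set_mem[h _] := valP u; exact: h. Qed.

Lemma rkvD u v x : rkv (u + v) x = rkv u x + rkv v x. Proof. by []. Qed.
Lemma rkvZ k u x : rkv (k *: u) x = k * rkv u x. Proof. by []. Qed.

Lemma rkv_inj u v : rkv u = rkv v -> u = v.
Proof. by move=> uv; exact/val_inj. Qed.

Lemma rkv0r (u : rkhs) : rkv u 0 = 0.
Proof.
have := rkvP u 1 0 0; rewrite scaler0 addr0 rmorph1 mul1r.
exact: addr_idem.
Qed.

Lemma rkvZr (u : rkhs) k x : rkv u (k *: x) = k^* * rkv u x.
Proof. by rewrite -[k *: x]addr0 rkvP rkv0r addr0. Qed.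

Lemma rkvDr (u : rkhs) x y : rkv u (x + y) = rkv u x + rkv u y.
Proof. by rewrite -{1}[x]scale1r rkvP rmorph1 mul1r. Qed.

Lemma rkvBr (u : rkhs) x y : rkv u (x - y) = rkv u x - rkv u y.
Proof. by rewrite rkvDr -scaleN1r rkvZr rmorphN1 mulN1r. Qed.

Definition rkn (u : rkhs) : R := inf [set M | rkbound (rkv u) M].

Lemma rkn_has_inf (u : rkhs) : has_inf [set M | rkbound (rkv u) M].
Proof.
split; last by exists 0 => M [].
by have /set_mem[_ [M uM]] := valP u; exists M.
Qed.

Lemma rkn_ge0 u : 0 <= rkn u.
Proof. by apply: lb_le_inf (rkn_has_inf u).1 _ => M []. Qed.

Lemma rkn_le u M : rkbound (rkv u) M -> rkn u <= M.
Proof. by move=> uM; apply: ge_inf => //; exact: (rkn_has_inf u).2. Qed.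

Lemma rknP u x : cabs (rkv u x) <= rkn u * psn p x.
Proof.
have [x0|x0] := eqVneq (psn p x) 0.
  have [M [_ /(_ x)]] := (rkn_has_inf u).1; by rewrite x0 !mulr0.
have x1 : 0 < psn p x by rewrite lt_neqAle eq_sym x0 psn_ge0.
rewrite -ler_pdivrMr//; apply: lb_le_inf (rkn_has_inf u).1 _ => M [_ uM].
by rewrite ler_pdivrMr.
Qed.

Lemma rknbound u : rkbound (rkv u) (rkn u).
Proof. by split; [exact: rkn_ge0|exact: rknP]. Qed.

Lemma rknD u v : rkn (u + v) <= rkn u + rkn v.
Proof. exact/rkn_le/(rkboundD (rknbound u) (rknbound v)). Qed.

Lemma rknZ_le k u : rkn (k *: u) <= cabs k * rkn u.
Proof. exact/rkn_le/(rkboundZ k (rknbound u)). Qed.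

Lemma rknZ k u : rkn (k *: u) = cabs k * rkn u.
Proof.
apply/le_anti; rewrite rknZ_le/=.
have [->|k0] := eqVneq k 0; first by rewrite cabs0 mul0r rkn_ge0.
rewrite -{1}[u]scale1r -(mulVf k0) -scalerA.
apply: le_trans (ler_wpM2l (cabs_ge0 k) (rknZ_le _ _)) _.
by rewrite mulrA -cabsM divff// cabs1 mul1r.
Qed.

Lemma rkn0_eq0 u : rkn u = 0 -> u = 0.
Proof.
move=> u0; apply: rkv_inj; apply/funext => x; apply: cabs_eq0.
by apply/le_anti; rewrite cabs_ge0 andbT; have := rknP u x; rewrite u0 mul0r.
Qed.

Lemma rknormD u v : (rkn (u + v))%:C <= (rkn u)%:C + (rkn v)%:C.
Proof. by rewrite -rmorphD lecR rknD. Qed.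

Lemma rknormZ k u : (rkn (k *: u))%:C = `|k| * (rkn u)%:C.
Proof. by rewrite cabsE -rmorphM rknZ. Qed.

Lemma rknorm0_eq0 u : (rkn u)%:C = 0 -> u = 0.
Proof. by move=> /complexI/rkn0_eq0. Qed.

HB.instance Definition _ := Lmodule_isNormed.Build R[i] rkhs
  rknormD rknormZ rknorm0_eq0.

Lemma rnorm_rkhs u : rnorm u = rkn u.
Proof. by []. Qed.

Lemma rkvB u v x : rkv (u - v) x = rkv u x - rkv v x. Proof. by []. Qed.

(** Evaluation at each [x] is Lipschitz for the norm, so the sequence converges pointwise. The
    Cauchy bound, uniform in [x] relative to [psn p x], passes to the limit and gives both
    membership and convergence in norm. *)
Lemma rkhs_complete_seq (u : nat -> rkhs) : cauchy_seq u -> exists l, tends u l.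
Proof.
move=> uc.
have cauchy_val x : cauchy_seq (fun n => rkv (u n) x : R[i]^o).
  move=> e e0.
  have e1 : 0 < e / (psn p x + 1) by rewrite divr_gt0// ltr_wpDl ?psn_ge0.
  have [N h] := uc _ e1; exists N => n m Nn Nm.
  rewrite -rkvB; apply: le_trans (rknP _ _) _.
  have := h n m Nn Nm; rewrite rnorm_rkhs ler_pdivlMr ?ltr_wpDl ?psn_ge0//.
  by have := rkn_ge0 (u n - u m); nra.
have [f fu] := choice (fun x => complex_cauchy_tends (cauchy_val x)).
have fl k x y : f (k *: x + y) = k^* * f x + f y.
  apply: (tends_unique (fu _)).
  have -> : (fun n => rkv (u n) (k *: x + y) : R[i]^o) =
            fun n => k^* * rkv (u n) x + rkv (u n) y.
    by apply/funext => n; rewrite rkvP.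
  apply: tendsD (fu y) => e e0.
  have [N h] := tends_lip (f := fun z : R[i]^o => k^* * z : R[i]^o) (M := cabs k)
    (fun a b => ltac:(rewrite -mulrBr -![rnorm _]/(cabs _) cabsM cabsJ; exact: lexx))
    (fu x) e0.
  by exists N.
have lim_le e : 0 < e -> exists N, forall n, (N <= n)%N ->
    forall x, cabs (rkv (u n) x - f x) <= e * psn p x.
  move=> /uc[N h]; exists N => n Nn x; apply: ge_small => d d0.
  have [N' h'] := fu x _ d0; set m := maxn N N'.
  have := h' m (leq_maxr _ _); rewrite -[rnorm _]/(cabs _).
  have := h n m Nn (leq_maxl _ _); rewrite rnorm_rkhs.
  have := rknP (u n - u m) x; rewrite rkvB.
  have := cabsD (rkv (u n) x - rkv (u m) x) (rkv (u m) x - f x); rewrite subrKA.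
  by have := psn_ge0 p x; nra.
have fset : f \in rkset.
  apply/mem_set; split=> //; have [N h] := lim_le 1 ltr01.
  exists (rkn (u N) + 1); split=> [|x]; first by rewrite addr_ge0// rkn_ge0.
  have := h N (leqnn _) x; have := rknP (u N) x; rewrite mulrDl mul1r.
  have := cabsD (f x - rkv (u N) x) (rkv (u N) x); rewrite subrK cabsB.
  lra.
exists (Sub f fset : rkhs) => e e0; have [N h] := lim_le _ e0; exists N => n Nn.
rewrite rnorm_rkhs; apply: rkn_le; split=> [|x]; first exact: ltW.
by rewrite rkvB; exact: h.
Qed.

HB.instance Definition _ := Uniform_isComplete.Build rkhs
  (seq_complete rkhs_complete_seq).

Lemma rkhat_subproof x : (fun y => p x y : R[i]^o) \in rkset.
Proof.
apply/mem_set; split=> [k y z|]; first exact: pformPr.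
by exists (psn p x); split=> [|y]; [exact: psn_ge0|exact: cauchy_schwarz].
Qed.

(** The class of [x] in the Hilbert space of [p]. Vectors of seminorm zero go to 0, so the quotient
    by the kernel of the form is implicit. *)
Definition rkhat x : rkhs := Sub (fun y => p x y : R[i]^o) (rkhat_subproof x).

Lemma rkhatE x y : rkv (rkhat x) y = p x y. Proof. by []. Qed.

Lemma rkhatB x y : rkhat (x - y) = rkhat x - rkhat y.
Proof. by apply: rkv_inj; apply/funext => z; rewrite rkvB !rkhatE pformBl. Qed.

Lemma rkn_hat x : rkn (rkhat x) = psn p x.
Proof.
apply/le_anti/andP; split.
  by apply: rkn_le; split=> [|y]; [exact: psn_ge0|exact: cauchy_schwarz].
have := rknP (rkhat x) x; rewrite rkhatE psqE cabs_real ger0_norm ?psq_ge0//.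
rewrite -sqr_psn expr2; have [->|x0] := eqVneq (psn p x) 0.
  by move=> _; exact: rkn_ge0.
by rewrite ler_pM2r// lt_neqAle eq_sym x0 psn_ge0.
Qed.

(* Riesz representation, up to [e]: a nearly norming vector of [u], rescaled,
   nearly represents [u]. *)
Lemma rkhat_dense (u : rkhs) (e : R) : 0 < e -> exists x, rnorm (u - rkhat x) <= e.
Proof.
move=> e0; set m := rkn u; have [m0|m0] := eqVneq m 0.
  exists 0; suff -> : u - rkhat 0 = 0 by rewrite rnorm0 ltW.
  apply: rkv_inj; apply/funext => z; rewrite rkvB rkhatE pform0l subr0.
  by rewrite (rkn0_eq0 m0).
have m1 : 0 < m by rewrite lt_neqAle eq_sym m0 rkn_ge0.
(* [t] is the size of the perturbation of the norming vector [v] below, and [d] the permitted defect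
   of [u v] from [m]. They are chosen so that m t <= e and d (1 + t) + m t^2 / 2 <= e t. *)
pose t := e / (m + 1).
have t0 : 0 < t by rewrite divr_gt0// ltr_wpDl// ltW.
pose d := e * t / (2 * (1 + t)).
have d0 : 0 < d by apply: divr_gt0; apply: mulr_gt0 => //; apply: addr_gt0.
have tE : m * t <= e.
  have -> : e = t * (m + 1) by rewrite /t; field; lra.
  nra.
have dE : d * (1 + t) = e * t / 2 by rewrite /d; field; lra.
have [v [v1 [c [uv cm]]]] :
    exists v, psn p v = 1 /\ exists c, rkv u v = c%:C /\ m - d <= c.
  have [y] : exists y, ~ (cabs (rkv u y) <= Num.max 0 (m - d) * psn p y).
    apply/existsNP => h; have : m <= Num.max 0 (m - d).
      by apply: rkn_le; split=> //; rewrite le_max lexx.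
    by rewrite le_max; lra.
  move=> /negP; rewrite -ltNge => hy.
  have y0 : psn p y != 0.
    apply: contraTneq hy => y0; rewrite y0 mulr0 -leNgt.
    by have := rknP u y; rewrite y0 mulr0.
  have y1 : 0 < psn p y by rewrite lt_neqAle eq_sym y0 psn_ge0.
  have [w [w1 wu]] := cabs_phase (rkv u y).
  exists ((w^* * ((psn p y)^-1)%:C) *: y); split.
    by rewrite psnZ cabsM cabsJ w1 mul1r cabs_real gtr0_norm ?invr_gt0// mulVf.
  exists (cabs (rkv u y) / psn p y); split.
    by rewrite rkvZr rmorphM/= conjCK conjC_real mulrAC wu -rmorphM.
  rewrite ler_pdivlMr//; apply: le_trans (ltW hy).
  by rewrite ler_wpM2r ?psn_ge0// le_max lexx orbT.
have c0m : c <= m.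
  by have := rknP u v; rewrite uv v1 mulr1 cabs_real => /(le_trans (ler_norm _)).
exists (c%:C *: v); rewrite rnorm_rkhs; apply: rkn_le; split=> [|y]; first exact: ltW.
have [y0|y0] := eqVneq (psn p y) 0.
  by have := rknP (u - rkhat (c%:C *: v)) y; rewrite y0 !mulr0.
have y1 : 0 < psn p y by rewrite lt_neqAle eq_sym y0 psn_ge0.
set s := psn p y in y1 *.
have [w [w1 wa]] := cabs_phase (rkv (u - rkhat (c%:C *: v)) y).
set a := cabs _ in wa *.
have {wa} : rkv (u - rkhat (c%:C *: v)) (w^* *: y) = a%:C by rewrite rkvZr conjCK.
rewrite rkvB rkhatE pformZl => wa.
have ys : psn p (w^* *: y) = s by rewrite psnZ cabsJ w1 mul1r.
move: (w^* *: y) wa ys => z wa ys.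
pose b := complex.Re (p v z).
have ua : complex.Re (rkv u z) = a + c * b.
  by rewrite -(subrK (c%:C * p v z) (rkv u z)) wa ReD ReM_real.
have bs : `|b| <= s.
  by apply: le_trans (normr_Re_le _) _; have := cauchy_schwarz p v z; rewrite v1 mul1r ys.
(* The norming vector [v] is perturbed by [r z], of seminorm [t]. There [u] is at most [m] times the
   seminorm S, and S <= (1 + S^2)/2 avoids a square root; the result is an inequality linear in [a],
   which keeps [a] below [e s]. *)
pose r := t / s; have r0 : 0 < r by rewrite divr_gt0.
have rs : r * s = t by rewrite /r; field.
have : c + r * (a + c * b) <= m * ((2 + 2 * r * b + t ^+ 2) / 2).
  have -> : c + r * (a + c * b) = complex.Re (rkv u (v + r%:C *: z)).
    by rewrite rkvDr rkvZr conjC_real ReD ReM_real uv ua.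
  apply: le_trans (Re_le _) _; apply: le_trans (rknP u _) _.
  rewrite ler_wpM2l ?rkn_ge0//.
  have : psn p (v + r%:C *: z) ^+ 2 = 1 + 2 * r * b + t ^+ 2.
    by rewrite sqr_psn psqDZ -!sqr_psn v1 ys -rs; ring.
  by have := sqr_ge0 (psn p (v + r%:C *: z) - 1); lra.
have rb : r * `|b| <= t by rewrite -rs ler_wpM2l// ltW.
have rbd : - t <= r * b <= t.
  by rewrite -ler_norml normrM (gtr0_norm r0).
move=> main; rewrite -(ler_pM2l r0).
have -> : r * (e * s) = e * t by rewrite mulrCA rs.
have mt : m * t * t <= e * t by rewrite ler_wpM2r// ltW.
have : (m - c) * (r * b) <= d * t.
  case/andP: rbd => _ rbt.
  apply: (@le_trans _ _ ((m - c) * t)); first by rewrite ler_wpM2l// subr_ge0.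
  by rewrite ler_wpM2r; lra.
nra.
Qed.

Lemma rkhat_lip (u : rkhs) x y :
  cabs (rkv u x - rkv u y) <= rnorm u * rnorm (rkhat x - rkhat y).
Proof. by rewrite -rkvBr -rkhatB !rnorm_rkhs rkn_hat; exact: rknP. Qed.

(** Vectors are functionals on [V], so the inner product of [u] with [rkhat x] has to be [u x]. At a
    general [w] it is the unique number obeying the error estimate for all approximants [rkhat x];
    the default 0 is never taken for lack of such a number ([rkinnerP]). *)
Definition rkinner (u w : rkhs) : R[i] :=
  xget 0 [set z | forall x, cabs (z - rkv u x) <= rnorm u * rnorm (w - rkhat x)].

Lemma rkinnerP (u w : rkhs) x :
  cabs (rkinner u w - rkv u x) <= rnorm u * rnorm (w - rkhat x).
Proof.
have [z zP] := lipschitz_extension rkhat_dense (rnorm_ge0 u) (rkhat_lip u) w.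
rewrite /rkinner; case: xgetP => [y -> //|/(_ z)]; exact.
Qed.

Lemma rkinner_unique (u w : rkhs) z M : 0 <= M ->
  (forall x, cabs (z - rkv u x) <= M * rnorm (w - rkhat x)) -> rkinner u w = z.
Proof.
move=> M0; exact: (lipschitz_extension_unique rkhat_dense (rnorm_ge0 u) M0 (rkinnerP u w)).
Qed.

Lemma rkinner_hat u x : rkinner u (rkhat x) = rkv u x.
Proof.
apply/eqP; rewrite -subr_eq0; apply/eqP/cabs_eq0/le_anti; rewrite cabs_ge0 andbT.
by have := rkinnerP u (rkhat x) x; rewrite subrr rnorm0 mulr0.
Qed.

Lemma rkinner_linearl w k u v : rkinner (k *: u + v) w = k * rkinner u w + rkinner v w.
Proof.
apply: (@rkinner_unique _ _ _ (cabs k * rnorm u + rnorm v)).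
  by rewrite addr_ge0 ?mulr_ge0 ?rnorm_ge0 ?cabs_ge0.
move=> x; rewrite rkvD rkvZ opprD addrACA -mulrBr.
apply: le_trans (cabsD _ _) _; rewrite cabsM mulrDl -mulrA.
by apply: lerD; [apply: ler_wpM2l; rewrite ?cabs_ge0//|]; exact: rkinnerP.
Qed.

Lemma rkinner_le u w : cabs (rkinner u w) <= rnorm u * rnorm w.
Proof.
have := rkinnerP u w 0; rewrite rkv0r subr0.
suff -> : rkhat 0 = 0 by rewrite subr0.
by apply: rkv_inj; apply/funext => z; rewrite rkhatE pform0l.
Qed.

Lemma rkinnerBl u v w : rkinner (u - v) w = rkinner u w - rkinner v w.
Proof. by rewrite addrC -scaleN1r rkinner_linearl mulN1r addrC. Qed.

Lemma rkinner_hatl x w : rkinner (rkhat x) w = (rkv w x)^*.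
Proof.
apply: (@rkinner_unique _ _ _ (rnorm (rkhat x))); first exact: rnorm_ge0.
move=> y; rewrite rkhatE pformJ -rmorphB cabsJ -rkhatE -rkvB mulrC.
by apply: le_trans (rknP _ _) _; rewrite rnorm_rkhs rnorm_rkhs rkn_hat.
Qed.

(** Both sides equal [w x] when [u] is [rkhat x], and such vectors are dense. *)
Lemma rkinnerJ u w : rkinner w u = (rkinner u w)^*.
Proof.
apply/eqP; rewrite -subr_eq0; apply/eqP/cabs_eq0/le_anti; rewrite cabs_ge0 andbT.
apply: ge_small => e e0; rewrite add0r.
have w1 : 0 < 2 * (rnorm w + 1) by have := rnorm_ge0 w; lra.
have [x] := rkhat_dense u (divr_gt0 e0 w1); rewrite ler_pdivlMr// => ux.
have h1 := rkinnerP w u x.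
have h2 := rkinner_le (u - rkhat x) w.
rewrite rkinnerBl rkinner_hatl -cabsJ rmorphB /= conjCK in h2.
have := cabsD (rkinner w u - rkv w x) (rkv w x - (rkinner u w)^*).
rewrite subrKA (cabsB (rkv w x)) /=.
have := rnorm_ge0 (u - rkhat x); have := rnorm_ge0 w; nra.
Qed.

Lemma rkinner_norm u : rkinner u u = `|u| ^+ 2.
Proof.
rewrite rnormE -rmorphXn.
apply/eqP; rewrite -subr_eq0; apply/eqP/cabs_eq0/le_anti; rewrite cabs_ge0 andbT.
apply: ge_small => e e0; rewrite add0r.
(* Replacing [u] by some [rkhat x] at distance [d <= 1] costs d |u| in the second argument, d (|u| +
   d) in the first and d (2 |u| + d) in the squared norm, altogether at most [d * M]. *)
pose M := 4 * (rnorm u + 1).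
have M0 : 0 < M by have := rnorm_ge0 u; rewrite /M; lra.
pose d := Num.min 1 (e / M).
have d0 : 0 < d by rewrite lt_min ltr01 divr_gt0.
have [d1 de] : d <= 1 /\ d * M <= e.
  split; first by rewrite ge_min lexx.
  by rewrite -ler_pdivlMr// ge_min lexx orbT.
have [x ux] := rkhat_dense u d0.
have h1 := rkinnerP u u x.
have h2 := rkinner_le (u - rkhat x) (rkhat x).
rewrite rkinnerBl !rkinner_hat rkhatE psqE in h2.
have := cabsD (rkinner u u - rkv u x) (rkv u x - (psq p x)%:C); rewrite subrKA => h3.
have h4 : cabs ((psq p x)%:C - (rnorm u ^+ 2)%:C) <= d * (2 * rnorm u + d).
  rewrite -rmorphB cabs_real -sqr_psn -rkn_hat -rnorm_rkhs subr_sqr normrM.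
  have := rnorm_ge0 u; have := rnorm_ge0 (rkhat x).
  have := rnormD (u - rkhat x) (rkhat x); rewrite subrK.
  have := rnormD (rkhat x - u) u; rewrite subrK (rnormB (rkhat x)).
  move=> k1 k2 k3 k4; apply: ler_pM; rewrite ?normr_ge0//.
    by rewrite ler_norml; lra.
  by rewrite ger0_norm; lra.
have := cabsD (rkinner u u - (psq p x)%:C) ((psq p x)%:C - (rnorm u ^+ 2)%:C).
rewrite subrKA.
have k3 : rnorm (rkhat x) <= rnorm u + d.
  have := rnormD (rkhat x - u) u; rewrite subrK (rnormB (rkhat x)); lra.
have := rnorm_ge0 u; have := rnorm_ge0 (u - rkhat x).
rewrite /M in de; nra.
Qed.

Lemma rkinner_bilinear : bilinear_for *%R (Num.conj \; *%R) rkinner.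
Proof.
split=> [w k u v|w k u v]; first exact: rkinner_linearl.
by rewrite /= !(rkinnerJ _ w) rkinner_linearl rmorphD rmorphM.
Qed.

HB.instance Definition _ :=
  bilinear_isBilinear.Build R[i] rkhs rkhs R[i] *%R (Num.conj \; *%R)
    rkinner rkinner_bilinear.

Lemma rkinner_hermitian u v : rkinner u v = (-1) ^+ false * Num.conj (rkinner v u).
Proof. by rewrite mul1r rkinnerJ. Qed.

HB.instance Definition _ :=
  isHermitianSesquilinear.Build R[i] rkhs false Num.conj rkinner rkinner_hermitian.

Lemma rkinner_gt0 u : u != 0 -> 0 < rkinner u u.
Proof. by move=> u0; rewrite rkinner_norm exprn_gt0// normr_gt0. Qed.

HB.instance Definition _ := isDotProduct.Build R[i] rkhs rkinner rkinner_gt0.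

HB.instance Definition _ :=
  CompleteNormedModule_isHilbert.Build R rkhs rkinner_norm.

End Rkhs.

(** * The Hahn-Banach theorem with a cone of lower bounds *)

Section HahnBanach.
Variables (R : realType) (V : lmodType R[i]).

Definition sublinear (p : V -> R) :=
  (forall x y, p (x + y) <= p x + p y) /\
  (forall (t : R) x, 0 <= t -> p (t%:C *: x) = t * p x).

Definition real_linear (f : V -> R) :=
  (forall x y, f (x + y) = f x + f y) /\
  (forall (t : R) x, f (t%:C *: x) = t * f x).

Lemma sublinear0 p : sublinear p -> p 0 = 0.
Proof. by move=> [_ h]; have := h 0 0 (lexx _); rewrite scaler0 mul0r. Qed.

Lemma real_linearN f x : real_linear f -> f (- x) = - f x.
Proof.
move=> [_ h]; have := h (-1) x.
by rewrite rmorphN rmorph1 scaleN1r mulN1r.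
Qed.

Section Domination.
Variable p : V -> R.
Hypothesis p_sub : sublinear p.

(** A partial functional is kept as its graph, so that the upper bound of a chain in Zorn's lemma is
    a plain union. Domination by [p] forces the graph to be single-valued ([graph_functional]). *)
Let graph (A : set (V * R)) :=
  [/\ forall z w, A z -> A w -> A (z.1 + w.1, z.2 + w.2),
      forall (t : R) z, A z -> A (t%:C *: z.1, t * z.2) &
      forall z, A z -> z.2 <= p z.1].

Let graph_functional A x r r' : graph A -> A (x, r) -> A (x, r') -> r <= r'.
Proof.
move=> [AD AZ Ap] Ar Ar'.
have /(AD _ _ Ar)/Ap : A ((-1)%:C *: x, -1 * r') by exact: (AZ (-1) (x, r')).
rewrite /= rmorphN rmorph1 scaleN1r subrr (sublinear0 p_sub) mulN1r.
by rewrite subr_le0.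
Qed.

(** The value at [x0] must lie above all [r - p (y - x0)] and below all [p (y + x0) - r], for (y, r)
    in the graph. Subadditivity separates these two sets, and [c] is the supremum of the first. *)
Let graph_extend A x0 : graph A -> A (0, 0) -> exists c, graph
  [set z | exists y r t, A (y, r) /\ z = (y + t%:C *: x0, r + t * c)].
Proof.
move=> [AD AZ Ap] A0; have [pD pZ] := p_sub.
pose S := [set z.2 - p (z.1 - x0) | z in A].
have ubS z : A z -> forall w, A w -> w.2 - p (w.1 - x0) <= p (z.1 + x0) - z.2.
  move=> Az w Aw; have := Ap _ (AD _ _ Az Aw); rewrite /=.
  have := pD (z.1 + x0) (w.1 - x0); rewrite addrACA subrr addr0; lra.
have supS : has_sup S.
  split; first by exists (0 - p (0 - x0)), (0, 0).
  exists (p (0 + x0) - 0) => _ [w Aw <-].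
  exact: (ubS (0, 0)).
exists (sup S); split=> [_ _ [y [r [t [Ay ->]]]] [y' [r' [t' [Ay' ->]]]]||].
- exists (y + y'), (r + r'), (t + t'); split; first exact: (AD (y, r) (y', r')).
  by rewrite /= rmorphD scalerDl mulrDl !addrA; congr pair; rewrite -!addrA;
    congr (_ + _); rewrite addrCA.
- move=> s _ [y [r [t [Ay ->]]]]; exists (s%:C *: y), (s * r), (s * t).
  split; first exact: (AZ s (y, r)).
  by rewrite /= scalerDr scalerA -rmorphM mulrDr mulrA.
move=> _ [y [r [t [Ay ->]]]] /=.
have [t0|t0|->] := ltgtP t 0; last first.
- by rewrite scale0r mul0r !addr0; exact: (Ap _ Ay).
- have /ubS h : A (t^-1%:C *: y, t^-1 * r) by exact: (AZ _ (y, r)).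
  have : sup S <= p (t^-1%:C *: y + x0) - t^-1 * r.
    by apply: ge_sup supS.1 _ => _ [w Aw <-]; exact: h.
  rewrite -(ler_pM2l t0) mulrBr -(pZ _ _ (ltW t0)) scalerDr scalerA -rmorphM mulrA.
  by rewrite divff ?gt_eqF// scale1r mul1r; lra.
- pose s := - t; have s0 : 0 < s by rewrite oppr_gt0.
  have h : A (s^-1%:C *: y, s^-1 * r) by exact: (AZ _ (y, r)).
  have : s^-1 * r - p (s^-1%:C *: y - x0) <= sup S.
    by apply: (ub_le_sup supS.2); exists (s^-1%:C *: y, s^-1 * r).
  rewrite -(ler_pM2l s0) mulrBr -(pZ _ _ (ltW s0)) scalerBr scalerA -rmorphM mulrA.
  rewrite divff ?gt_eqF// scale1r mul1r /s rmorphN scaleNr opprK mulNr; lra.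
Qed.

Theorem hahn_banach : exists f, real_linear f /\ forall x, f x <= p x.
Proof.
have [A [gA Amax]] : exists A, graph A /\ forall B, A `<` B -> ~ graph B.
  apply: Zorn_bigcup => F Fg Ft; split.
  - move=> z w [B FB Bz] [C FC Cw].
    have [BC|CB] := Ft _ _ FB FC.
      by exists C => //; have [CD _ _] := Fg _ FC; apply: CD => //; exact: BC.
    by exists B => //; have [BD _ _] := Fg _ FB; apply: BD => //; exact: CB.
  - by move=> t z [B FB Bz]; exists B => //; have [_ BZ _] := Fg _ FB; exact: BZ.
  - by move=> z [B FB Bz]; have [_ _ Bp] := Fg _ FB; exact: Bp.
(* The empty relation satisfies [graph]; it is not maximal, since the graph of the zero functional
   on the zero space is larger. *)
have A0 : A (0, 0).
  apply: contrapT => nA0.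
  have A_empty z : ~ A z.
    by move=> Az; apply: nA0; have [_ /(_ 0 z Az)] := gA; rewrite scale0r mul0r.
  apply: (Amax [set (0, 0)]); first by split=> [z /A_empty//|/(_ (0, 0) erefl)].
  split=> [_ _ -> ->|t _ ->|_ ->] /=; first by rewrite !addr0.
    by rewrite scaler0 mulr0.
  by rewrite (sublinear0 p_sub).
have Atot x : exists r, A (x, r).
  apply: contrapT => nx; have [c gB] := graph_extend x gA A0.
  apply: Amax gB; split=> [[y r] Ay|].
    by exists y, r, 0; rewrite scale0r mul0r !addr0.
  move=> /(_ (x, c)) h; apply: nx; exists c; apply: h.
  by exists 0, 0, 1; rewrite scale1r mul1r !add0r.
have [f fA] := choice Atot.
have fE x r : A (x, r) -> f x = r.
  by move=> Ar; apply/le_anti; rewrite !(graph_functional gA (x := x)).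
have [AD AZ Ap] := gA.
exists f; split; last by move=> x; exact: (Ap (x, f x)).
split=> [x y|t x]; apply: fE; first exact: (AD (x, _) (y, _)).
exact: (AZ t (x, _)).
Qed.

End Domination.

(** The cone is absorbed into the sublinear functional [q h], the infimum of [p (h + z.1) - z.2]
    over [z] in [K]. The point (0, 0) gives q <= p, and a linear f <= q satisfies the lower bounds
    because f (- z.1) <= q (- z.1) <= - z.2. *)
Theorem hahn_banach_cone (p : V -> R) (K : set (V * R)) :
  sublinear p -> K (0, 0) ->
  (forall z w, K z -> K w -> K (z.1 + w.1, z.2 + w.2)) ->
  (forall (t : R) z, 0 <= t -> K z -> K (t%:C *: z.1, t * z.2)) ->
  (forall z, K z -> z.2 <= p z.1) ->
  exists f, [/\ real_linear f, forall x, f x <= p x & forall z, K z -> z.2 <= f z.1].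
Proof.
move=> p_sub K0 KD KZ Kp; have [pD pZ] := p_sub.
pose S h := [set p (h + z.1) - z.2 | z in K].
have infS h : has_inf (S h).
  split; first by exists (p (h + 0) - 0), (0, 0).
  exists (- p (- h)) => _ [z Kz <-].
  have := pD (h + z.1) (- h); rewrite addrAC subrr add0r; have := Kp z Kz; lra.
pose q h := inf (S h).
have q_le h z : K z -> q h <= p (h + z.1) - z.2.
  by move=> Kz; apply: (ge_inf (infS h).2); exists z.
have q_ge h m : (forall z, K z -> m <= p (h + z.1) - z.2) -> m <= q h.
  by move=> hm; apply: lb_le_inf (infS h).1 _ => _ [z /hm ? <-].
have q0 : q 0 = 0.
  apply/le_anti/andP; split.
    by have := q_le 0 _ K0; rewrite /= addr0 (sublinear0 p_sub) subr0.
  by apply: (q_ge) => z /Kp; rewrite add0r subr_ge0.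
have qZ_le (t : R) h : 0 < t -> q (t%:C *: h) <= t * q h.
  move=> t0; rewrite -ler_pdivrMl//; apply: (q_ge) => z Kz.
  rewrite ler_pdivrMl//; apply: le_trans (q_le _ _ (KZ t z (ltW t0) Kz)) _.
  by rewrite /= -scalerDr (pZ _ _ (ltW t0)) mulrBr.
have [|f [flin fq]] := @hahn_banach q.
  split=> [x y|t x].
    rewrite -lerBlDr; apply: (q_ge) => z Kz; rewrite lerBlDl -lerBlDr.
    apply: (q_ge) => w Kw; rewrite lerBlDr.
    apply: le_trans (q_le _ _ (KD _ _ Kz Kw)) _ => /=.
    have := pD (x + z.1) (y + w.1); rewrite addrACA; lra.
  rewrite le_eqVlt => /predU1P[<-|t0]; first by rewrite scale0r mul0r.
  apply/le_anti; rewrite qZ_le//= -ler_pdivlMl//.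
  have {1}-> : x = t^-1%:C *: (t%:C *: x).
    by rewrite scalerA -rmorphM mulVf ?lt0r_neq0// rmorph1 scale1r.
  by apply: qZ_le; rewrite invr_gt0.
exists f; split=> // [x|z Kz].
  by apply: le_trans (fq x) _; have := q_le x _ K0; rewrite /= addr0 subr0.
have := le_trans (fq (- z.1)) (q_le _ _ Kz).
by rewrite (real_linearN _ flin) addNr (sublinear0 p_sub); lra.
Qed.

End HahnBanach.

(** * Square roots in C*-algebras *)

Local Notation "x ** y" := (cmul x y) (at level 40, left associativity).

Section CStarBasics.
Variables (R : realType) (A : cstarType R).
Implicit Types a b c x y z : A.

Lemma cmulDl a b c : (a + b) ** c = a ** c + b ** c.
Proof. by have := cmul_linearl c 1 a b; rewrite !scale1r. Qed.

Lemma cmulDr a b c : a ** (b + c) = a ** b + a ** c.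
Proof. by have := cmul_linearr a 1 b c; rewrite !scale1r. Qed.

Lemma cmul0l b : 0 ** b = 0.
Proof. by apply: addr_idem; rewrite -cmulDl addr0. Qed.

Lemma cmul0r b : b ** 0 = 0.
Proof. by apply: addr_idem; rewrite -cmulDr addr0. Qed.

Lemma cmulZl k a b : (k *: a) ** b = k *: (a ** b).
Proof. by have := cmul_linearl b k a 0; rewrite cmul0l !addr0. Qed.

Lemma cmulZr k a b : a ** (k *: b) = k *: (a ** b).
Proof. by have := cmul_linearr a k b 0; rewrite cmul0r !addr0. Qed.

Lemma cmulNl a b : (- a) ** b = - (a ** b).
Proof. by rewrite -scaleN1r cmulZl scaleN1r. Qed.

Lemma cmulNr a b : a ** (- b) = - (a ** b).
Proof. by rewrite -[- b]scaleN1r cmulZr scaleN1r. Qed.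

Lemma cmulBl a b c : (a - b) ** c = a ** c - b ** c.
Proof. by rewrite cmulDl cmulNl. Qed.

Lemma cmulBr a b c : a ** (b - c) = a ** b - a ** c.
Proof. by rewrite cmulDr cmulNr. Qed.

Lemma cstarD a b : cstar (a + b) = cstar a + cstar b.
Proof. by have := cstar_antilinear 1 a b; rewrite rmorph1 !scale1r. Qed.

Lemma cstar0 : cstar (0 : A) = 0.
Proof. by apply: addr_idem; rewrite -cstarD addr0. Qed.

Lemma cstarZ k a : cstar (k *: a) = k^* *: cstar a.
Proof. by have := cstar_antilinear k a 0; rewrite cstar0 !addr0. Qed.

Lemma cstarZr (t : R) a : cstar (t%:C *: a) = t%:C *: cstar a.
Proof. by rewrite cstarZ conjC_real. Qed.

Lemma cstarN a : cstar (- a) = - cstar a.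
Proof. by rewrite -scaleN1r cstarZ rmorphN1 scaleN1r. Qed.

Lemma cstarB a b : cstar (a - b) = cstar a - cstar b.
Proof. by rewrite cstarD cstarN. Qed.

Lemma rnormM a b : rnorm (a ** b) <= rnorm a * rnorm b.
Proof. by rewrite -lecR rmorphM/= -!rnormE cnormM. Qed.

Lemma rnorm_starM a : rnorm (cstar a ** a) = rnorm a ^+ 2.
Proof. by apply: complexI; rewrite rmorphXn/= -!rnormE cnorm_cstar. Qed.

Lemma rnorm_star_le a : rnorm a <= rnorm (cstar a).
Proof.
have [a0|a0] := eqVneq (rnorm a) 0; first by rewrite a0 rnorm_ge0.
have a1 : 0 < rnorm a by rewrite lt_neqAle eq_sym a0 rnorm_ge0.
by rewrite -(ler_pM2r a1) -expr2 -rnorm_starM rnormM.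
Qed.

Lemma rnorm_star a : rnorm (cstar a) = rnorm a.
Proof.
by apply/le_anti; rewrite rnorm_star_le andbT -{2}[a]cstarK rnorm_star_le.
Qed.

Definition selfadj a := cstar a = a.

Lemma rnorm_sqr a : selfadj a -> rnorm (a ** a) = rnorm a ^+ 2.
Proof. by move=> sa; rewrite -rnorm_starM sa. Qed.

Lemma sqr_eq0 a : selfadj a -> a ** a = 0 -> a = 0.
Proof.
move=> sa aa; apply: rnorm_eq0; apply/eqP.
by rewrite -sqrf_eq0 -rnorm_sqr// aa rnorm0.
Qed.

Lemma selfadj0 : selfadj 0. Proof. exact: cstar0. Qed.

Lemma selfadjD a b : selfadj a -> selfadj b -> selfadj (a + b).
Proof. by move=> sa sb; rewrite /selfadj cstarD sa sb. Qed.

Lemma selfadjN a : selfadj a -> selfadj (- a).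
Proof. by move=> sa; rewrite /selfadj cstarN sa. Qed.

Lemma selfadjB a b : selfadj a -> selfadj b -> selfadj (a - b).
Proof. by move=> sa sb; apply/selfadjD/selfadjN. Qed.

Lemma selfadjZ (t : R) a : selfadj a -> selfadj (t%:C *: a).
Proof. by move=> sa; rewrite /selfadj cstarZr sa. Qed.

Lemma selfadj_starM a : selfadj (cstar a ** a).
Proof. by rewrite /selfadj cstarM cstarK. Qed.

Lemma selfadj_sqr a : selfadj a -> selfadj (a ** a).
Proof. by move=> sa; rewrite /selfadj cstarM sa. Qed.

Definition ccomm a b := a ** b = b ** a.

Lemma ccommC a b : ccomm a b -> ccomm b a. Proof. by []. Qed.

Lemma ccommD a b c : ccomm a c -> ccomm b c -> ccomm (a + b) c.
Proof. by rewrite /ccomm cmulDl cmulDr => -> ->. Qed.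

Lemma ccommN a c : ccomm a c -> ccomm (- a) c.
Proof. by rewrite /ccomm cmulNl cmulNr => ->. Qed.

Lemma ccommB a b c : ccomm a c -> ccomm b c -> ccomm (a - b) c.
Proof. by move=> ac bc; apply/ccommD/ccommN. Qed.

Lemma ccommZ k a c : ccomm a c -> ccomm (k *: a) c.
Proof. by rewrite /ccomm cmulZl cmulZr => ->. Qed.

Lemma ccommM a b c : ccomm a c -> ccomm b c -> ccomm (a ** b) c.
Proof. by rewrite /ccomm => ac bc; rewrite -cmulA bc cmulA ac cmulA. Qed.

Lemma ccomm0 c : ccomm 0 c.
Proof. by rewrite /ccomm cmul0l cmul0r. Qed.

Lemma selfadjM a b : selfadj a -> selfadj b -> ccomm a b -> selfadj (a ** b).
Proof. by move=> sa sb ab; rewrite /selfadj cstarM sa sb. Qed.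

Lemma real_part_norm (u : A) (m : R) : rnorm u <= m ->
  rnorm ((2^-1)%:C *: (u + cstar u)) <= m.
Proof.
move=> um; rewrite rnormZr gtr0_norm ?invr_gt0//.
by have := rnormD u (cstar u); rewrite rnorm_star; lra.
Qed.

Lemma tends_selfadj (u : nat -> A) l : tends u l -> (forall n, selfadj (u n)) ->
  selfadj l.
Proof.
move=> ul us; apply: (tends_unique (u := u)) => // e /ul[N h].
by exists N => n /h; rewrite -{2}(us n) -cstarB rnorm_star.
Qed.

Lemma tends_ccomm (u : nat -> A) l z : tends u l -> (forall n, ccomm (u n) z) ->
  ccomm l z.
Proof.
move=> ul uz; apply: (tends_unique (u := fun n => u n ** z)) => e e0.
  have [N h] := tends_lip (f := cmul ^~ z) (M := rnorm z)
    (fun x y => ltac:(by rewrite -cmulBl mulrC rnormM)) ul e0.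
  by exists N.
have [N h] := tends_lip (f := cmul z) (M := rnorm z)
  (fun x y => ltac:(by rewrite -cmulBr rnormM)) ul e0.
by exists N => n /h; rewrite uz.
Qed.

(** * Square roots by iteration inside a closed class [P] of elements *)

Section SquareRoot.
Variables (k : A) (P : A -> Prop).
Hypotheses (k1 : rnorm k <= 1) (P0 : P 0) (Pk : P k).
Hypothesis PD : forall x y, P x -> P y -> P (x + y).
Hypothesis PZ : forall (t : R) x, P x -> P (t%:C *: x).
Hypothesis PM : forall x, P x -> P (x ** x).
Hypothesis Plim : forall u l, tends u l -> (forall n, P (u n)) -> P l.

Let x_ n := iter n (fun x => (2^-1)%:C *: (k + x ** x)) (0 : A).
Let r_ n := iter n (fun r : R => (1 + r ^+ 2) / 2) (0 : R).

Let r_ge0 n : 0 <= r_ n.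
Proof. by case: n => //= n; rewrite divr_ge0// addr_ge0// sqr_ge0. Qed.

Let r_le1 n : r_ n <= 1.
Proof. by elim: n => //= n IH; have := r_ge0 n; rewrite /= -/(r_ n); nra. Qed.

Let r_leS n : r_ n <= r_ n.+1.
Proof. by rewrite /= -/(r_ n); have := r_le1 n; nra. Qed.

Let r_homo n m : (n <= m)%N -> r_ n <= r_ m.
Proof.
move=> /subnK <-; elim: (m - n)%N => // d IH.
by apply: le_trans IH _; rewrite addSn r_leS.
Qed.

Let x_le n : rnorm (x_ n) <= r_ n.
Proof.
elim: n => [|n IH]; first by rewrite rnorm0.
rewrite /= -/(x_ n) -/(r_ n) rnormZr gtr0_norm ?invr_gt0//.
have := rnormD k (x_ n ** x_ n); have := rnormM (x_ n) (x_ n).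
have : rnorm (x_ n) * rnorm (x_ n) <= r_ n * r_ n by apply: ler_pM; rewrite ?rnorm_ge0.
by rewrite -!expr2; move: (r_ n) (x_ n) k1 => r x; lra.
Qed.

(** The identity x^2 - y^2 = x (x - y) + (x - y) y needs no commutativity. Bounded term by term, it
    becomes the same identity for the real iteration. *)
Let x_step n : rnorm (x_ n.+1 - x_ n) <= r_ n.+1 - r_ n.
Proof.
elim: n => [|n IH].
  have := x_le 1; have -> : r_ 0 = 0 by []; have -> : x_ 0 = 0 by [].
  by rewrite !subr0.
have -> : x_ n.+2 - x_ n.+1 = (2^-1)%:C *:
    (x_ n.+1 ** (x_ n.+1 - x_ n) + (x_ n.+1 - x_ n) ** x_ n).
  rewrite cmulBr cmulBl subrKA -[x_ n.+2]/(_ *: (k + x_ n.+1 ** x_ n.+1)).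
  rewrite -[X in _ - X]/((2^-1)%:C *: (k + x_ n ** x_ n)) -scalerBr.
  by rewrite opprD addrACA subrr add0r.
rewrite rnormZr gtr0_norm ?invr_gt0//.
have -> : r_ n.+2 - r_ n.+1 = 2^-1 * ((r_ n.+1 + r_ n) * (r_ n.+1 - r_ n)).
  rewrite -[r_ n.+2]/((1 + r_ n.+1 ^+ 2) / 2).
  by rewrite -[X in _ - X]/((1 + r_ n ^+ 2) / 2); field.
rewrite ler_pM2l ?invr_gt0// mulrDl; apply: le_trans (rnormD _ _) _.
apply: lerD.
  by apply: le_trans (rnormM _ _) (ler_pM _ _ (x_le _) IH); rewrite rnorm_ge0.
apply: le_trans (rnormM _ _) _; rewrite mulrC.
by apply: ler_pM IH; rewrite ?rnorm_ge0 ?x_le.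
Qed.

Let x_cauchy_le n m : (n <= m)%N -> rnorm (x_ m - x_ n) <= r_ m - r_ n.
Proof.
move=> /subnK <-; elim: (m - n)%N => [|d IH]; first by rewrite !subrr rnorm0.
rewrite addSn; have := rnorm_triangle (x_ (d + n)) (x_ (d + n).+1) (x_ n).
by have := x_step (d + n); lra.
Qed.

(* [x = 1 - sqrt (1 - k)], obtained by iterating [x |-> (k + x^2) / 2]; the
   iteration is majorised by the same iteration on reals with [k = 1], so that
   no strict inequality on the norm of [k] is needed. *)
Lemma sqrt_iteration : exists x, [/\ rnorm x <= 1, P x & x + x = k + x ** x].
Proof.
have [x xl] : exists x, tends x_ x.
  apply: cauchy_tends => e e0.
  have : cvg (r_ @ \oo).
    apply: nondecreasing_is_cvgn; first by move=> n m; exact: r_homo.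
    by exists 1 => _ [n _ <-]; exact: r_le1.
  move=> /cvg_ex[l /cvgrPdist_le/(_ _ (half_gt0 e0))[N _ h]].
  exists N => n m Nn Nm; have := h n Nn; have := h m Nm.
  rewrite /= !ler_norml => /andP[h1 h2] /andP[h3 h4].
  have [nm|mn] := leqP n m.
    by rewrite rnormB; have := x_cauchy_le nm; lra.
  by have := x_cauchy_le (ltnW mn); lra.
have x1 : rnorm x <= 1.
  by apply: tends_norm_le xl _ => n; apply: le_trans (x_le n) (r_le1 n).
exists x; split=> //.
  apply: Plim xl _; elim=> [|n IH]; first exact: P0.
  by apply: PZ; apply: PD => //; exact: PM.
apply: (tends_unique (u := fun n => x_ n.+1 + x_ n.+1)).
  by apply: tendsD; exact: tends_shift.
have -> : (fun n => x_ n.+1 + x_ n.+1) = (fun n => k + x_ n ** x_ n).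
  apply/funext => n; rewrite /= -scalerDl -rmorphD.
  have -> : 2^-1 + 2^-1 = 1 :> R by field.
  by rewrite rmorph1 scale1r.
apply: tendsD; first exact: tends_cst.
move=> e e0; have [N h] := xl _ (half_gt0 e0); exists N => n /h hn.
rewrite -(subrKA (x_ n ** x)) -cmulBr -cmulBl.
apply: le_trans (rnormD _ _) _.
have := rnormM (x_ n) (x_ n - x); have := rnormM (x_ n - x) x.
have := le_trans (x_le n) (r_le1 n); have := rnorm_ge0 (x_ n - x).
nra.
Qed.

End SquareRoot.

(** Self-adjointness and commutation with everything that commutes with [k] are closed conditions
    preserved by the iteration. The second lets the square roots of commuting elements be multiplied
    as in a commutative algebra. *)
Lemma csqrt_exists k : rnorm k <= 1 -> selfadj k ->
  exists x, [/\ rnorm x <= 1, selfadj x, x + x = k + x ** x &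
                forall z, ccomm k z -> ccomm x z].
Proof.
move=> k1 sk.
pose P x := selfadj x /\ forall z, ccomm k z -> ccomm x z.
have P0 : P 0 by split=> [|z _]; [exact: selfadj0|exact: ccomm0].
have Pk : P k by [].
have PD x y : P x -> P y -> P (x + y).
  move=> [sx xz] [sy yz]; split=> [|z kz]; first exact: selfadjD.
  by apply: ccommD; [exact: xz|exact: yz].
have PZ (t : R) x : P x -> P (t%:C *: x).
  move=> [sx xz]; split=> [|z kz]; first exact: selfadjZ.
  by apply: ccommZ; exact: xz.
have PM x : P x -> P (x ** x).
  move=> [sx xz]; split=> [|z kz]; first exact: selfadj_sqr.
  by apply: ccommM; exact: xz.
have Plim u l : tends u l -> (forall n, P (u n)) -> P l.
  move=> ul uP; split=> [|z kz].
    by apply: tends_selfadj ul _ => n; have [] := uP n.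
  by apply: tends_ccomm ul _ => n; have [_] := uP n; apply.
by have [x [x1 [sx xz] xx]] := sqrt_iteration k1 P0 Pk PD PZ PM Plim; exists x.
Qed.

End CStarBasics.

(** * Order theory of unital C*-algebras *)

Section UnitalOrder.
Variables (R : realType) (U : cstarType R) (e : U).
Hypotheses (e_l : forall x, e ** x = x) (e_r : forall x, x ** e = x).
Implicit Types a b c d h m n p q u v w x y z : U.

Local Ltac lin := lmod (U : lmodType R[i]).

Lemma unit_selfadj : selfadj e.
Proof.
have /(congr1 cstar) := e_l (cstar e).
by rewrite cstarM !cstarK e_l.
Qed.

Lemma rnorm_unit : rnorm e <= 1.
Proof.
have := rnorm_sqr unit_selfadj; rewrite e_l.
by have := rnorm_ge0 e; rewrite expr2; nra.
Qed.

Lemma ccomm_unit x : ccomm e x.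
Proof. by rewrite /ccomm e_l e_r. Qed.

(** Positivity is being the square of a self-adjoint element, which avoids spectra. With this
    choice, stability under sums ([posD]) and positivity of [cstar w ** w] ([pos_starM]) are
    theorems. *)
Definition pos h := exists c, selfadj c /\ h = c ** c.

Lemma pos_selfadj h : pos h -> selfadj h.
Proof. by move=> [c [sc ->]]; exact: selfadj_sqr. Qed.

Lemma pos_sqr c : selfadj c -> pos (c ** c).
Proof. by exists c. Qed.

Lemma sqrt_scale (t : R) c : 0 <= t ->
  (Num.sqrt t)%:C *: c ** ((Num.sqrt t)%:C *: c) = t%:C *: (c ** c).
Proof. by move=> t0; rewrite cmulZl cmulZr scalerA -rmorphM -expr2 sqr_sqrtr. Qed.

Lemma posZ (t : R) h : 0 <= t -> pos h -> pos (t%:C *: h).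
Proof.
move=> t0 [c [sc ->]]; exists ((Num.sqrt t)%:C *: c).
by rewrite sqrt_scale//; split=> //; exact: selfadjZ.
Qed.

Lemma cstar_i d : selfadj d -> cstar ('i%C *: d) = (- 'i%C) *: d.
Proof.
move=> sd; rewrite cstarZ sd; congr (_ *: _).
by apply: complex_eqP; rewrite /= ?oppr0.
Qed.

Lemma half_double x : (2^-1)%:C *: (x + x) = x.
Proof. by lin; rewrite fmorphV rmorph_nat; field. Qed.

(** As [c] and [d] commute, u = c + i d satisfies u^* u = c^2 + d^2 = t e, so its norm is at most
    the square root of [t]; and [c] is its real part. *)
Lemma sum_squares_norm (t : R) c d : 0 <= t -> selfadj c -> selfadj d ->
  ccomm c d -> c ** c + d ** d = t%:C *: e -> rnorm c ^+ 2 <= t.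
Proof.
move=> t0 sc sd cd cdt; pose u := c + 'i%C *: d.
have su : cstar u = c - 'i%C *: d by rewrite cstarD cstar_i// sc scaleNr.
have uu : cstar u ** u = t%:C *: e.
  rewrite su /u -cdt cmulBl !cmulDr !cmulZl !cmulZr cd scalerA -expr2 sqr_i.
  by lin; ring.
have u2 : rnorm u <= Num.sqrt t.
  rewrite -(@ler_pXn2r _ 2) ?nnegrE ?rnorm_ge0 ?sqrtr_ge0// sqr_sqrtr//.
  rewrite -rnorm_starM uu rnormZr ger0_norm//.
  by have := rnorm_unit; have := rnorm_ge0 e; nra.
have cE : c = (2^-1)%:C *: (u + cstar u).
  by rewrite -[LHS]half_double su /u; congr (_ *: _); lin; ring.
rewrite -[t]sqr_sqrtr// ler_pXn2r ?nnegrE ?rnorm_ge0 ?sqrtr_ge0//.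
by rewrite cE; exact: real_part_norm.
Qed.

(** For k = e - h / t the iteration yields [x] with (e - x)^2 = e - k = h / t, and the root is a
    multiple of [e - x]. *)
Lemma sqrt_of_norm (t : R) h : 0 < t -> selfadj h -> rnorm (t%:C *: e - h) <= t ->
  exists c, [/\ selfadj c, h = c ** c,
    rnorm ((Num.sqrt t)%:C *: e - c) <= Num.sqrt t &
    forall z, ccomm h z -> ccomm c z].
Proof.
move=> t0 sh ht.
have tK : t^-1%:C *: (t%:C *: h) = h.
  by rewrite scalerA -rmorphM mulVf ?gt_eqF// scale1r.
have [||x [x1 sx xx xz]] := @csqrt_exists _ _ (e - t^-1%:C *: h).
- have -> : e - t^-1%:C *: h = t^-1%:C *: (t%:C *: e - h).
    by rewrite scalerBr scalerA -rmorphM mulVf ?gt_eqF// scale1r.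
  by rewrite rnormZr gtr0_norm ?invr_gt0// ler_pdivrMl// mulr1.
- by apply: selfadjB; [exact: unit_selfadj|exact: selfadjZ].
exists ((Num.sqrt t)%:C *: (e - x)); split.
- by apply/selfadjZ/selfadjB => //; exact: unit_selfadj.
- rewrite sqrt_scale ?ltW// cmulBl !cmulBr !e_l !e_r.
  have -> : e - x - (x - x ** x) = e - (x + x) + x ** x by lin; ring.
  rewrite xx.
  have -> : e - (e - t^-1%:C *: h + x ** x) + x ** x = t^-1%:C *: h by lin; ring.
  by rewrite scalerA -rmorphM divff ?gt_eqF// scale1r.
- have -> : (Num.sqrt t)%:C *: e - (Num.sqrt t)%:C *: (e - x) = (Num.sqrt t)%:C *: x.
    by lin; ring.
  rewrite rnormZr ger0_norm ?sqrtr_ge0//.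
  by have := sqrtr_ge0 t; nra.
- move=> z hz; apply/ccommZ/ccommB; first exact: ccomm_unit.
  by apply: xz; apply: ccommB; [exact: ccomm_unit|exact: ccommZ].
Qed.

Lemma pos_of_norm (t : R) h : 0 < t -> selfadj h -> rnorm (t%:C *: e - h) <= t -> pos h.
Proof. by move=> t0 sh /(sqrt_of_norm t0 sh)[c [sc hc _ _]]; exists c. Qed.

Lemma pos_unit_sub (t : R) h : 0 < t -> selfadj h -> rnorm h <= t -> pos (t%:C *: e - h).
Proof.
move=> t0 sh ht; apply: (pos_of_norm t0).
  by apply: selfadjB => //; apply/selfadjZ/unit_selfadj.
by have -> : t%:C *: e - (t%:C *: e - h) = h by lin; ring.
Qed.

(** If h = c^2, then t e - h is within [t] of t e, hence is a square d^2 with [d] commuting with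
    [c], and c^2 + d^2 = t e bounds [d]. With [pos_of_norm] this turns positivity into a norm
    condition, whence its stability under sums and limits. *)
Lemma pos_norm (t : R) h : 0 < t -> pos h -> rnorm h <= t -> rnorm (t%:C *: e - h) <= t.
Proof.
move=> t0 [c [sc ->]] ct.
have [||d [sd dE _ dz]] := @sqrt_of_norm t (t%:C *: e - c ** c) t0.
- by apply: selfadjB; [apply/selfadjZ/unit_selfadj|exact: selfadj_sqr].
- by have -> : t%:C *: e - (t%:C *: e - c ** c) = c ** c by lin; ring.
rewrite dE rnorm_sqr//; apply: (@sum_squares_norm t d c) => //; first exact: ltW.
- apply: dz; apply: ccommB; first by apply: ccommZ; exact: ccomm_unit.
  exact: ccommM.
- by rewrite -dE subrK.
Qed.

Lemma posD p q : pos p -> pos q -> pos (p + q).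
Proof.
move=> pp pq; have p1 : 0 < rnorm p + 1 by rewrite ltr_wpDl ?rnorm_ge0.
have q1 : 0 < rnorm q + 1 by rewrite ltr_wpDl ?rnorm_ge0.
apply: (@pos_of_norm (rnorm p + 1 + (rnorm q + 1))); first exact: addr_gt0.
  by apply: selfadjD; exact: pos_selfadj.
have -> : (rnorm p + 1 + (rnorm q + 1))%:C *: e - (p + q) =
   ((rnorm p + 1)%:C *: e - p) + ((rnorm q + 1)%:C *: e - q).
  by rewrite rmorphD; lin; ring.
by apply: le_trans (rnormD _ _) (lerD _ _); apply: pos_norm => //; rewrite lerDl.
Qed.

Lemma pos_lim (u : nat -> U) h : tends u h -> (forall i, pos (u i)) -> pos h.
Proof.
move=> uh up; have h1 : 0 < rnorm h + 1 by rewrite ltr_wpDl ?rnorm_ge0.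
apply: (@pos_of_norm _ _ h1).
  by apply: tends_selfadj uh _ => i; exact: pos_selfadj.
apply: ge_small => d d0; pose d' := Num.min d 1.
have d'0 : 0 < d' by rewrite lt_min d0 ltr01.
have [N /(_ N (leqnn _)) uN] := uh _ d'0.
have [dd d1] : d' <= d /\ d' <= 1 by rewrite !ge_min !lexx orbT.
have uN1 : rnorm (u N) <= rnorm h + 1.
  by have := rnormD (u N - h) h; rewrite subrK; lra.
have := pos_norm h1 (up N) uN1.
have := rnorm_triangle (u N) ((rnorm h + 1)%:C *: e) h.
lra.
Qed.

Lemma pos_sqrt h : pos h ->
  exists c, [/\ pos c, h = c ** c & forall z, ccomm h z -> ccomm c z].
Proof.
move=> hp; have h1 : 0 < rnorm h + 1 by rewrite ltr_wpDl ?rnorm_ge0.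
have [|c [sc hc cn cz]] := @sqrt_of_norm _ h h1 (pos_selfadj hp).
  by apply: pos_norm => //; rewrite lerDl.
by exists c; split=> //; apply: pos_of_norm cn; rewrite ?sqrtr_gt0.
Qed.

Lemma pos_le_unit_norm (t : R) p : 0 <= t -> pos p -> pos (t%:C *: e - p) -> rnorm p <= t.
Proof.
move=> t0 [c [sc ->]] /pos_sqrt[d [dp dE dz]]; rewrite rnorm_sqr//.
apply: (@sum_squares_norm t c d) => //; first exact: pos_selfadj.
  apply/ccommC/dz/ccommB; first by apply: ccommZ; exact: ccomm_unit.
  exact: ccommM.
by rewrite -dE addrC subrK.
Qed.

Lemma pos_le_norm p q : pos p -> pos (q - p) -> rnorm p <= rnorm q.
Proof.
move=> pp pqp; have pq : pos q by rewrite -(subrK p q); exact: posD.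
apply: ge_small => d d0; have t0 : 0 < rnorm q + d by rewrite ltr_wpDl ?rnorm_ge0.
apply: pos_le_unit_norm => //; first exact: ltW.
have -> : (rnorm q + d)%:C *: e - p = ((rnorm q + d)%:C *: e - q) + (q - p) by lin; ring.
apply: posD => //; apply: pos_unit_sub => //; first exact: pos_selfadj.
by rewrite lerDl ltW.
Qed.

Lemma pos_sum0 p q : pos p -> pos q -> p + q = 0 -> p = 0.
Proof.
move=> pp pq pq0; apply: rnorm_eq0; apply/le_anti; rewrite rnorm_ge0 andbT.
by rewrite -(rnorm0 U); apply: pos_le_norm => //; rewrite -pq0 addrC addKr.
Qed.

Lemma abs_exists h : selfadj h ->
  exists m, [/\ pos m, m ** m = h ** h & forall z, ccomm h z -> ccomm m z].
Proof.
move=> sh; have [m [mp mm mz]] := pos_sqrt (pos_sqr sh).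
by exists m; split=> // z hz; apply: mz; exact: ccommM.
Qed.

Lemma sqrM_comm c d : ccomm c d -> c ** d ** (c ** d) = c ** c ** (d ** d).
Proof.
by move=> cd; rewrite !cmulA; congr (_ ** _); rewrite -!cmulA; congr (_ ** _).
Qed.

Lemma posM p q : pos p -> pos q -> ccomm p q -> pos (p ** q).
Proof.
move=> /pos_sqrt[c [cp -> cz]] /pos_sqrt[d [dp -> dz]] cd.
have cd1 : ccomm c d by apply/ccommC/dz/ccommC/cz.
exists (c ** d); split; last by rewrite sqrM_comm.
by apply: selfadjM => //; exact: pos_selfadj.
Qed.

(* With [n = |h| - h] and [l = |n|], the difference [d = l - n] satisfies
   [d^2 = 2 l d] and [(2 |h| l + l^2) d = 0], whence [l d = 0] by positivity. *)
Lemma abs_sub_pos h m : selfadj h -> pos m -> m ** m = h ** h ->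
  (forall z, ccomm h z -> ccomm m z) -> pos (m - h).
Proof.
move=> sh mp mm mz; have sm := pos_selfadj mp.
have mh : ccomm m h by apply: mz.
have [n nE] : exists n, n = m - h by eexists.
have sn : selfadj n by rewrite nE; exact: selfadjB.
have nm : ccomm n m by rewrite nE; apply: ccommB => //; exact: ccommC.
have hn : h ** n = - (m ** n).
  by rewrite nE !cmulBr mm mh; lin; ring.
have nn : n ** n = m ** n + m ** n.
  by rewrite {1}nE cmulBl hn opprK.
have [l [lp ll lz]] := abs_exists sn; have sl := pos_selfadj lp.
have ln : ccomm l n by apply: lz.
have lm : ccomm l m by apply: lz.
have [d dE] : exists d, d = l - n by eexists.
have sd : selfadj d by rewrite dE; exact: selfadjB.
have dm : ccomm d m by rewrite dE; apply: ccommB.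
have dl : ccomm d l by rewrite dE; apply: ccommB => //; exact: ccommC.
have nd : n ** d = - (l ** d).
  by rewrite dE !cmulBr ll ln; lin; ring.
have dd : d ** d = l ** d + l ** d.
  by rewrite {1}dE cmulBl nd opprK.
have key : l ** l ** d + (m ** l ** d + m ** l ** d) = 0.
  by rewrite ll nn cmulDl -!cmulA nd cmulNr !cmulA; lin; ring.
have ld : l ** d = 0.
  apply: sqr_eq0; first by apply: selfadjM => //; exact: ccommC.
  rewrite sqrM_comm//.
  have pdd : pos (d ** d) by exact: pos_sqr.
  have p2 : pos (m ** l ** (d ** d)).
    apply: posM => //; first by apply: posM => //; exact: ccommC.
    by apply: ccommM; apply/ccommC/ccommM.
  apply: (@pos_sum0 _ (m ** l ** (d ** d) + m ** l ** (d ** d))).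
  - apply: posM => //; first exact: pos_sqr.
    by apply: ccommM; apply/ccommC/ccommM.
  - exact: posD.
  by move: (congr1 (cmul ^~ d) key); rewrite cmul0l !cmulDl !cmulA.
have d0 : d = 0 by apply: sqr_eq0 => //; rewrite dd ld addr0.
by rewrite -nE; have -> : n = l by apply/eqP; rewrite eq_sym -subr_eq0 -dE d0.
Qed.

(** For v = h + i k with self-adjoint parts, v v^* + v^* v = 2 (h^2 + k^2). Hence positivity of -
    v^* v implies that of v v^*. *)
Lemma Mstar_parts v : exists h k, [/\ selfadj h, selfadj k &
  v ** cstar v = - (cstar v ** v) + (h ** h + h ** h + (k ** k + k ** k))].
Proof.
have [s sE] : exists s, s = cstar v by eexists.
have [g gE] : exists g, g = (2^-1)%:C *: (s - v) by eexists.
have [h hE] : exists h, h = (2^-1)%:C *: (s + v) by eexists.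
have sg : cstar g = - g by rewrite gE cstarZr cstarB sE cstarK -scalerN opprB.
exists h, ('i%C *: g); split.
- by rewrite /selfadj hE cstarZr cstarD sE cstarK addrC.
- rewrite /selfadj cstarZ sg scalerN -scaleNr; congr (_ *: _).
  by apply: complex_eqP; rewrite /= ?opprK ?oppr0.
rewrite -sE cmulZl cmulZr scalerA -expr2 sqr_i scaleN1r.
rewrite gE hE !cmulZl !cmulZr !(cmulBl, cmulBr, cmulDl, cmulDr).
by lin; rewrite fmorphV rmorph_nat; field.
Qed.

(* Kelley and Vaught. If [w^* w] were not its absolute value [m], then for
   [v = w (m - w^* w)] both [- v^* v] and [v v^*] would be positive; with
   [T = |v|^2], the element [v^* (T - v v^* )^2 v] has norm at most [T^3], but it
   is [- (T^2 Y + 2 T Y^2 + Y^3)] for [Y = - v^* v], of norm at least [2 T^3]. *)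
Lemma pos_starM w : pos (cstar w ** w).
Proof.
have [a aE] : exists a, a = cstar w ** w by eexists.
rewrite -aE; have sa : selfadj a by rewrite aE; exact: selfadj_starM.
have [m [mp mm mz]] := abs_exists sa; have sm := pos_selfadj mp.
have ma : ccomm m a by apply: mz.
have [n nE] : exists n, n = m - a by eexists.
have sn : selfadj n by rewrite nE; exact: selfadjB.
have nm : ccomm n m by rewrite nE; apply: ccommB => //; exact: ccommC.
have na : ccomm n a by rewrite nE; apply: ccommB.
have an : a ** n = - (m ** n).
  by rewrite nE !cmulBr mm ma; lin; ring.
have nn : n ** n = m ** n + m ** n.
  by rewrite {1}nE cmulBl an opprK.
(* The root [c] of [m] displays m n^2 as the square of y = c n; at the end, y = 0 yields m n = c y =
   0. *)
have [c [cp mc cz]] := pos_sqrt mp; have sc := pos_selfadj cp.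
have cn : ccomm c n by apply: cz; exact: ccommC.
have [y yE] : exists y, y = c ** n by eexists.
have sy : selfadj y by rewrite yE; exact: selfadjM.
have yy : y ** y = m ** (n ** n) by rewrite yE sqrM_comm// -mc.
have [Y YE] : exists Y, Y = y ** y by eexists.
have sY : selfadj Y by rewrite YE; exact: selfadj_sqr.
have [v vE] : exists v, v = w ** n by eexists.
have vv : cstar v ** v = - Y.
  rewrite vE YE cstarM sn cmulA -[n ** cstar w ** w]cmulA -aE yy na.
  by rewrite an cmulNl cmulA.
have vvp : pos (v ** cstar v).
  have [h [k [sh sk ->]]] := Mstar_parts v.
  rewrite vv opprK YE; apply: posD; first exact: pos_sqr.
  by apply: posD; apply: posD; exact: pos_sqr.
have v0 : v = 0.
  apply: rnorm_eq0; apply/eqP; rewrite -sqrf_eq0; apply/eqP.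
  have [T TE] : exists T, T = rnorm v ^+ 2 by eexists.
  rewrite -TE; apply/le_anti; rewrite andbC TE sqr_ge0 -TE leNgt; apply/negP => T0.
  have vvT : rnorm (v ** cstar v) = T.
    by rewrite -{1}[v]cstarK rnorm_starM rnorm_star.
  have YT : rnorm Y = T by rewrite -rnormN -vv rnorm_starM.
  have := pos_norm T0 vvp; rewrite vvT => /(_ (lexx _)).
  have [X XE] : exists X, X = T%:C *: e - v ** cstar v by eexists.
  rewrite -XE => XT.
  have Xv : X ** v = T%:C *: v + v ** Y.
    by rewrite XE cmulBl cmulZl e_l -cmulA vv cmulNr opprK.
  have XvXv : cstar (X ** v) ** (X ** v) =
      - (T%:C *: (T%:C *: Y) + (T%:C *: (Y ** Y) + T%:C *: (Y ** Y)) + Y ** Y ** Y).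
    rewrite Xv cstarD cstarZr cstarM sY cmulDl !cmulDr !cmulZl !cmulZr.
    rewrite !cmulA vv -[Y ** cstar v ** v]cmulA vv !cmulNl !cmulNr cmulNl.
    by lin; ring.
  have : rnorm (T%:C *: (T%:C *: Y) + (T%:C *: (Y ** Y) + T%:C *: (Y ** Y)) +
                Y ** Y ** Y) <= T ^+ 3.
    have -> : T ^+ 3 = (T * rnorm v) ^+ 2 by rewrite exprMn -TE; ring.
    rewrite -rnormN -XvXv rnorm_starM.
    rewrite ler_pXn2r ?nnegrE ?mulr_ge0 ?rnorm_ge0 ?(ltW T0)//.
    by apply: le_trans (rnormM _ _) _; rewrite ler_wpM2r ?rnorm_ge0.
  have /le_trans h : rnorm (T%:C *: (Y ** Y) + T%:C *: (Y ** Y)) <=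
    rnorm (T%:C *: (T%:C *: Y) + (T%:C *: (Y ** Y) + T%:C *: (Y ** Y)) + Y ** Y ** Y).
    have pYY : pos (Y ** Y) by exact: pos_sqr.
    have pY : pos Y by rewrite YE; exact: pos_sqr.
    apply: pos_le_norm; first by apply: posD; apply: posZ => //; exact: ltW.
    have -> (a1 a2 a3 : U) : a1 + a2 + a3 - a2 = a1 + a3 by lin; ring.
    apply: posD; first by do 2!(apply: posZ; first exact: ltW).
    by apply: posM => //; apply: ccommM.
  move=> /h; rewrite -scalerDl -rmorphD rnormZr rnorm_sqr// YT.
  rewrite gtr0_norm ?addr_gt0// => h'.
  have T3 : 0 < T ^+ 3 by rewrite exprn_gt0.
  by move: h' T3; rewrite !exprS expr0; lra.
have Y0 : Y = 0 by rewrite -[Y]opprK -vv v0 cmul0r oppr0.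
have y0 : y = 0 by apply: sqr_eq0 => //; rewrite -YE.
have mn0 : m ** n = 0 by rewrite mc -cmulA -yE y0 cmul0r.
have n0 : n = 0 by apply: sqr_eq0 => //; rewrite nn mn0 addr0.
by have -> : a = m by apply/eqP; rewrite eq_sym -subr_eq0 -nE n0.
Qed.

(* The positive part [p] of [h] and its negative part; if [h <= t] then [p <= t]
   because [t p - p^2 = (t - h) p]. *)
Lemma pos_parts h : selfadj h -> exists p q, [/\ pos p, pos q, h = p - q, p ** q = 0 &
  forall t : R, 0 <= t -> pos (t%:C *: e - h) -> rnorm p <= t].
Proof.
move=> sh; have [m [mp mm mz]] := abs_exists sh.
have mh : ccomm m h by apply: mz.
have mNz z : ccomm (- h) z -> ccomm m z.
  by move=> hz; apply: mz; rewrite -[h]opprK; exact: ccommN.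
have pp : pos (m + h).
  rewrite -[h]opprK; apply: abs_sub_pos => //; first exact: selfadjN.
  by rewrite cmulNl cmulNr opprK.
have [p pE] : exists p, p = (2^-1)%:C *: (m + h) by eexists.
have p_pos : pos p by rewrite pE; apply: posZ.
exists p, ((2^-1)%:C *: (m - h)); split => //.
- by apply: posZ => //; exact: abs_sub_pos.
- by rewrite pE; lin; rewrite fmorphV rmorph_nat; field.
- rewrite pE cmulZl cmulZr cmulDl !cmulBr mm mh.
  have -> : h ** h - h ** m + (h ** m - h ** h) = 0 by lin; ring.
  by rewrite !scaler0.
move=> t t0 th; have ppE : p ** p = h ** p.
  rewrite pE !cmulZl !cmulZr !cmulDl !cmulDr mm mh.
  by lin; rewrite fmorphV rmorph_nat; field.
have hp : ccomm h p.
  apply: ccommC; rewrite pE; apply: ccommZ; exact: ccommD.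
have := @pos_le_norm (p ** p) (t%:C *: p).
have -> : t%:C *: p - p ** p = (t%:C *: e - h) ** p.
  by rewrite ppE cmulBl cmulZl e_l.
rewrite rnorm_sqr ?rnormZr ?ger0_norm//; last exact: pos_selfadj.
move=> /(_ (pos_sqr (pos_selfadj p_pos)) (posM th p_pos _)) h1.
have : rnorm p ^+ 2 <= t * rnorm p.
  by apply: h1; apply: ccommB => //; apply: ccommZ; exact: ccomm_unit.
have [->//|p0] := eqVneq (rnorm p) 0.
by rewrite expr2 ler_pM2r// lt_neqAle eq_sym p0 rnorm_ge0.
Qed.

End UnitalOrder.

(** * The unitization *)

(* The unitization [A + C] with the maximum of the operator norm of left
   multiplication on [A] and of the modulus of the scalar part; the latter is
   needed for a norm because [A] may already have a unit. *)
Section Unitization.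
Variables (R : realType) (A : cstarType R).

Definition unitization : Type := (A * R[i]^o)%type.

HB.instance Definition _ := GRing.Lmodule.on unitization.

Implicit Types (x y w : unitization) (z : A).

Local Ltac lin := lmod (A : lmodType R[i]).

Definition uact x z : A := x.1 ** z + x.2 *: z.

Definition ubound x (M : R) :=
  [/\ 0 <= M, forall z, rnorm (uact x z) <= M * rnorm z & cabs x.2 <= M].

Definition unorm x : R := inf [set M | ubound x M].

Lemma uactD x y z : uact (x + y) z = uact x z + uact y z.
Proof. by rewrite /uact /= cmulDl scalerDl; lin; ring. Qed.

Lemma uactZ k x z : uact (k *: x) z = k *: uact x z.
Proof. by rewrite /uact /= cmulZl -scalerA scalerDr. Qed.

Lemma ubound_sum x : ubound x (rnorm x.1 + cabs x.2).
Proof.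
split=> [|z|]; first by rewrite addr_ge0 ?rnorm_ge0 ?cabs_ge0.
  apply: le_trans (rnormD _ _) _.
  by rewrite mulrDl lerD ?rnormM// rnormZ.
by rewrite lerDr rnorm_ge0.
Qed.

Lemma unorm_has_inf x : has_inf [set M | ubound x M].
Proof.
split; first by exists (rnorm x.1 + cabs x.2); exact: ubound_sum.
by exists 0 => M [].
Qed.

Lemma unorm_le x M : ubound x M -> unorm x <= M.
Proof. by move=> xM; apply: (ge_inf (unorm_has_inf x).2). Qed.

Lemma unormP x : ubound x (unorm x).
Proof.
have [xn xb] := unorm_has_inf x.
split=> [|z|]; first by apply: lb_le_inf => // M [].
  have [z0|z0] := eqVneq (rnorm z) 0.
    have [M [_ /(_ z) + _]] := xn; by rewrite z0 !mulr0.
  have z1 : 0 < rnorm z by rewrite lt_neqAle eq_sym z0 rnorm_ge0.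
  rewrite -ler_pdivrMr//; apply: lb_le_inf => // M [_ xM _].
  by rewrite ler_pdivrMr.
by apply: lb_le_inf => // M [].
Qed.

Lemma unorm_ge0 x : 0 <= unorm x.
Proof. by have [] := unormP x. Qed.

Lemma uact_le x z : rnorm (uact x z) <= unorm x * rnorm z.
Proof. by have [] := unormP x. Qed.

Lemma uscalar_le x : cabs x.2 <= unorm x.
Proof. by have [] := unormP x. Qed.

Lemma unormD x y : unorm (x + y) <= unorm x + unorm y.
Proof.
apply: unorm_le; split=> [|z|]; first by rewrite addr_ge0// unorm_ge0.
  by rewrite uactD mulrDl; apply: le_trans (rnormD _ _) (lerD _ _); exact: uact_le.
by apply: le_trans (cabsD _ _) (lerD _ _); exact: uscalar_le.
Qed.

Lemma unormZ_le k x : unorm (k *: x) <= cabs k * unorm x.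
Proof.
apply: unorm_le; split=> [|z|]; first by rewrite mulr_ge0 ?cabs_ge0 ?unorm_ge0.
  by rewrite uactZ rnormZ -mulrA ler_wpM2l ?cabs_ge0// uact_le.
by rewrite cabsM ler_wpM2l ?cabs_ge0// uscalar_le.
Qed.

Lemma unormZ k x : unorm (k *: x) = cabs k * unorm x.
Proof.
apply/le_anti; rewrite unormZ_le/=.
have [->|k0] := eqVneq k 0; first by rewrite cabs0 mul0r unorm_ge0.
rewrite -{1}[x]scale1r -(mulVf k0) -scalerA.
apply: le_trans (ler_wpM2l (cabs_ge0 k) (unormZ_le _ _)) _.
by rewrite mulrA -cabsM divff// cabs1 mul1r.
Qed.

(** Testing the action of [x] on the adjoint of [x.1] produces [rnorm x.1 ^+ 2], by the C*-identity.
    The bound serves for definiteness of the norm and for completeness. *)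
Lemma rnorm_fst_le x : rnorm x.1 <= unorm x + cabs x.2.
Proof.
have [x0|x0] := eqVneq (rnorm x.1) 0.
  by rewrite x0 addr_ge0 ?unorm_ge0 ?cabs_ge0.
have x1 : 0 < rnorm x.1 by rewrite lt_neqAle eq_sym x0 rnorm_ge0.
rewrite -(ler_pM2r x1) -expr2.
have <- : rnorm (x.1 ** cstar x.1) = rnorm x.1 ^+ 2.
  by rewrite -{1}[x.1]cstarK rnorm_starM rnorm_star.
have := uact_le x (cstar x.1).
have := rnormD (uact x (cstar x.1)) (- (x.2 *: cstar x.1)).
by rewrite /uact addrK rnormN rnormZ rnorm_star mulrDl; lra.
Qed.

Lemma unorm_eq0 x : unorm x = 0 -> x = 0.
Proof.
move=> x0; have := uscalar_le x; have := rnorm_fst_le x; rewrite x0 add0r.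
move=> h1 h2; have l0 : cabs x.2 = 0 by apply/le_anti; rewrite h2 cabs_ge0.
rewrite l0 in h1; have a0 : rnorm x.1 = 0 by apply/le_anti; rewrite h1 rnorm_ge0.
by rewrite [x]surjective_pairing (cabs_eq0 l0) (rnorm_eq0 a0).
Qed.

Lemma unormCD x y : (unorm (x + y))%:C <= (unorm x)%:C + (unorm y)%:C.
Proof. by rewrite -rmorphD lecR unormD. Qed.

Lemma unormCZ k x : (unorm (k *: x))%:C = `|k| * (unorm x)%:C.
Proof. by rewrite cabsE -rmorphM unormZ. Qed.

Lemma unormC_eq0 x : (unorm x)%:C = 0 -> x = 0.
Proof. by move=> /complexI/unorm_eq0. Qed.

HB.instance Definition _ := Lmodule_isNormed.Build R[i] unitization
  unormCD unormCZ unormC_eq0.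

Lemma rnorm_unitization x : rnorm x = unorm x. Proof. by []. Qed.

Lemma unitization_complete_seq (u : nat -> unitization) :
  cauchy_seq u -> exists l, tends u l.
Proof.
move=> uc.
have [|l hl] := @complex_cauchy_tends R (fun n => (u n).2).
  move=> e /uc[N h]; exists N => n m Nn Nm; apply: le_trans (h n m Nn Nm).
  exact: (uscalar_le (u n - u m)).
have [|a ha] := @cauchy_tends R A (fun n => (u n).1).
  move=> e e0; have [N h] := uc _ (half_gt0 e0); exists N => n m Nn Nm.
  have := h n m Nn Nm; rewrite rnorm_unitization.
  have := rnorm_fst_le (u n - u m); have := uscalar_le (u n - u m).
  rewrite -[(u n - u m).1]/((u n).1 - (u m).1); lra.
exists (a, l) => e e0.
have [N1 h1] := ha _ (half_gt0 e0); have [N2 h2] := hl _ (half_gt0 e0).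
exists (maxn N1 N2) => n; rewrite geq_max => /andP[/h1 n1 /h2 n2].
apply: le_trans (unorm_le (ubound_sum _)) _.
rewrite -[rnorm _]/(cabs _) in n2.
rewrite -[(u n - (a, l)).1]/((u n).1 - a) -[(u n - (a, l)).2]/((u n).2 - l).
lra.
Qed.

HB.instance Definition _ := Uniform_isComplete.Build unitization
  (seq_complete unitization_complete_seq).

Definition umul x y : unitization :=
  (x.1 ** y.1 + x.2 *: y.1 + y.2 *: x.1, x.2 * y.2).

Definition ustar x : unitization := (cstar x.1, (x.2)^*).

Lemma uact_mul x y z : uact (umul x y) z = uact x (uact y z).
Proof.
rewrite /uact /umul /= !cmulDl !cmulDr !cmulZl !cmulZr !cmulA.
by lin; ring.
Qed.

Lemma uact_star x z z' : cstar (uact x z) ** z' = cstar z ** uact (ustar x) z'.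
Proof.
rewrite /uact cstarD cstarM cstarZ cmulDl cmulDr cmulZl cmulZr.
by rewrite cmulA.
Qed.

Lemma umulA : associative umul.
Proof.
move=> x y w; rewrite /umul /=; congr pair; last by rewrite mulrA.
rewrite !cmulDl !cmulDr !cmulZl !cmulZr !cmulA.
by lin; ring.
Qed.

Lemma umul_linearl w : linear (umul ^~ w).
Proof.
move=> k x y; rewrite /umul; congr pair => /=.
  rewrite -[k *: x.2]/(k * x.2) !cmulDl !cmulZl; lin; ring.
by rewrite -[k *: x.2]/(k * x.2) mulrDl -mulrA.
Qed.

Lemma umul_linearr w : linear (umul w).
Proof.
move=> k x y; rewrite /umul; congr pair => /=.
  rewrite -[k *: x.2]/(k * x.2) !cmulDr !cmulZr; lin; ring.
by rewrite -[k *: x.2]/(k * x.2) mulrDr mulrCA.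
Qed.

Lemma ustarK : involutive ustar.
Proof. by move=> [a l]; rewrite /ustar /= cstarK conjCK. Qed.

Lemma ustar_antilinear (k : R[i]) x y : ustar (k *: x + y) = k^* *: ustar x + ustar y.
Proof.
rewrite /ustar; congr pair; first exact: cstar_antilinear.
by rewrite /= rmorphD rmorphM.
Qed.

Lemma ustarM x y : ustar (umul x y) = umul (ustar y) (ustar x).
Proof.
rewrite /ustar /umul; congr pair => /=; last by rewrite rmorphM mulrC.
by rewrite !cstarD !cstarZ cstarM; lin; ring.
Qed.

Lemma unormM x y : unorm (umul x y) <= unorm x * unorm y.
Proof.
apply: unorm_le; split=> [|z|]; first by rewrite mulr_ge0 ?unorm_ge0.
  rewrite uact_mul -mulrA; apply: le_trans (uact_le _ _) _.
  by rewrite ler_wpM2l ?unorm_ge0 ?uact_le.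
by rewrite cabsM ler_pM ?cabs_ge0 ?uscalar_le.
Qed.

(** By the C*-identity in [A], |x z|^2 = |z^* (x^* x z)|, which is at most |x^* x| |z|^2; the scalar
    part is treated separately. *)
Lemma unorm_starM_ge x : unorm x ^+ 2 <= unorm (umul (ustar x) x).
Proof.
have T0 := unorm_ge0 (umul (ustar x) x).
suff : unorm x <= Num.sqrt (unorm (umul (ustar x) x)).
  move=> h; rewrite -[X in _ <= X]sqr_sqrtr//.
  by rewrite ler_pXn2r ?nnegrE ?unorm_ge0 ?sqrtr_ge0.
apply: unorm_le; split=> [|z|]; first exact: sqrtr_ge0.
  rewrite -(@ler_pXn2r _ 2) ?nnegrE ?mulr_ge0 ?rnorm_ge0 ?sqrtr_ge0//.
  rewrite exprMn sqr_sqrtr// -rnorm_starM uact_star -uact_mul.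
  apply: le_trans (rnormM _ _) _; rewrite rnorm_star expr2 mulrC mulrA.
  by rewrite ler_wpM2r ?rnorm_ge0// uact_le.
rewrite -(@ler_pXn2r _ 2) ?nnegrE ?cabs_ge0 ?sqrtr_ge0// sqr_sqrtr//.
have -> : cabs x.2 ^+ 2 = cabs (umul (ustar x) x).2.
  by rewrite /= cabsM cabsJ expr2.
exact: uscalar_le.
Qed.

Lemma unorm_star_le x : unorm x <= unorm (ustar x).
Proof.
have [x0|x0] := eqVneq (unorm x) 0; first by rewrite x0 unorm_ge0.
have x1 : 0 < unorm x by rewrite lt_neqAle eq_sym x0 unorm_ge0.
rewrite -(ler_pM2r x1) -expr2.
exact: le_trans (unorm_starM_ge x) (unormM _ _).
Qed.

Lemma unorm_starM x : unorm (umul (ustar x) x) = unorm x ^+ 2.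
Proof.
apply/le_anti; rewrite unorm_starM_ge andbT; apply: le_trans (unormM _ _) _.
rewrite expr2 ler_wpM2r ?unorm_ge0//.
by rewrite -{2}[x]ustarK unorm_star_le.
Qed.

Lemma unormCM x y : `|umul x y| <= `|x| * `|y|.
Proof. by rewrite !rnormE -rmorphM lecR unormM. Qed.

Lemma unormC_star x : `|umul (ustar x) x| = `|x| ^+ 2.
Proof. by rewrite !rnormE -rmorphXn; congr (_%:C); exact: unorm_starM. Qed.

HB.instance Definition _ := CompleteNormedModule_isCStarAlgebra.Build R unitization
  umulA umul_linearl umul_linearr ustarK ustar_antilinear ustarM unormCM unormC_star.

Definition uone : unitization := (0, 1).
Definition uinj (a : A) : unitization := (a, 0).

Lemma uone_l x : uone ** x = x.
Proof.
case: x => a l; rewrite -[LHS]/(umul _ _) /umul /= cmul0l mul1r scale1r scaler0.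
by rewrite add0r addr0.
Qed.

Lemma uone_r x : x ** uone = x.
Proof.
case: x => a l; rewrite -[LHS]/(umul _ _) /umul /= cmul0r mulr1 scale1r scaler0.
by rewrite !add0r.
Qed.

Lemma uinj_inj : injective uinj.
Proof. by move=> a b []. Qed.

Lemma uinjM a b : uinj (a ** b) = uinj a ** uinj b.
Proof.
rewrite -[RHS]/(umul _ _) /umul /= !scale0r !addr0 mul0r //.
Qed.

Lemma uinjD a b : uinj (a + b) = uinj a + uinj b.
Proof. by rewrite -[RHS]/((_, _)) /= addr0. Qed.

Lemma uinjB a b : uinj (a - b) = uinj a - uinj b.
Proof. by rewrite -[RHS]/((_, _)) /= subr0. Qed.

Lemma uinj_star a : uinj (cstar a) = cstar (uinj a).
Proof. by rewrite -[RHS]/(ustar _) /ustar /= rmorph0. Qed.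

Lemma unorm_inj a : rnorm (uinj a) = rnorm a.
Proof.
apply/le_anti/andP; split.
  by have := unorm_le (ubound_sum (uinj a)); rewrite cabs0 addr0.
by have := rnorm_fst_le (uinj a); rewrite cabs0 addr0.
Qed.

Lemma uinj_selfadj a : selfadj a -> selfadj (uinj a).
Proof. by move=> sa; rewrite /selfadj -uinj_star sa. Qed.

Lemma uinj_pos a : pos a -> pos (uinj a).
Proof.
by move=> [c [sc ->]]; rewrite uinjM; apply: pos_sqr; exact: uinj_selfadj.
Qed.

Lemma pos_uinj a : pos (uinj a) -> pos a.
Proof.
move=> [c [sc ac]]; have /eqP : c.2 * c.2 = 0.
  by have /(congr1 snd) := ac; rewrite /= => <-.
rewrite mulf_eq0 orbb => /eqP c0.
have cE : c = uinj c.1 by rewrite [LHS]surjective_pairing c0.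
exists c.1; split.
  by apply: uinj_inj; rewrite uinj_star -cE sc.
by apply: uinj_inj; rewrite uinjM -cE.
Qed.

End Unitization.

(** * Order in a C*-algebra without unit, by passage to the unitization *)

Section Order.
Variables (R : realType) (A : cstarType R).
Implicit Types a b c h p q v : A.

Let one_l := @uone_l R A.
Let one_r := @uone_r R A.

Lemma cposD p q : pos p -> pos q -> pos (p + q).
Proof.
move=> pp pq; apply: pos_uinj; rewrite uinjD.
exact: (posD one_l one_r (uinj_pos pp) (uinj_pos pq)).
Qed.

Lemma cpos_starM a : pos (cstar a ** a).
Proof.
by apply: pos_uinj; rewrite uinjM uinj_star; exact: (pos_starM one_l one_r).
Qed.

Lemma cpos_le_norm p q : pos p -> pos (q - p) -> rnorm p <= rnorm q.
Proof.
move=> /uinj_pos pp /uinj_pos pqp; rewrite -(unorm_inj p) -(unorm_inj q).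
by apply: (pos_le_norm one_l one_r) pp _; rewrite -uinjB.
Qed.

Lemma tends_uinj (u : nat -> A) l : tends u l -> tends (fun n => uinj (u n)) (uinj l).
Proof.
by move=> ul e /ul[N h]; exists N => n /h; rewrite -uinjB unorm_inj.
Qed.

Lemma cpos_lim (u : nat -> A) l : tends u l -> (forall n, pos (u n)) -> pos l.
Proof.
move=> /tends_uinj ul up; apply: pos_uinj.
by apply: (pos_lim one_l one_r) ul _ => n; exact: uinj_pos.
Qed.

(** The parts P and Q taken in the unitization have equal scalar parts, since [h] has none, and P Q
    = 0 makes the common scalar part vanish; so both lie in [A]. *)
Lemma cpos_parts h : selfadj h -> exists p q, [/\ pos p, pos q, h = p - q &
  forall t : R, 0 <= t -> pos (t%:C *: uone A - uinj h) -> rnorm p <= t].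
Proof.
move=> /uinj_selfadj/(pos_parts one_l one_r)[P [Q [Pp Pq hPQ PQ0 Pt]]].
have E2 : P.2 = Q.2.
  by have /(congr1 snd)/eqP := hPQ; rewrite /= eq_sym subr_eq0 => /eqP.
have P2 : P.2 = 0.
  have /(congr1 snd) : P ** Q = 0 by [].
  by rewrite /= -E2 => /eqP; rewrite mulf_eq0 orbb => /eqP.
have PE : P = uinj P.1 by rewrite [LHS]surjective_pairing P2.
have QE : Q = uinj Q.1 by rewrite [LHS]surjective_pairing -E2 P2.
exists P.1, Q.1; split.
- by apply: pos_uinj; rewrite -PE.
- by apply: pos_uinj; rewrite -QE.
- by apply: uinj_inj; rewrite uinjB -PE -QE.
- by move=> t t0 /(Pt t t0); rewrite PE unorm_inj.
Qed.

(** The element is w^* w for w = a + l 1. The negated sum is thereby bounded above by |l|^2 times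
    the adjoined unit, the form of bound that [cpos_parts] accepts. *)
Lemma pos_complete_square a (l : R[i]) :
  pos ((cabs l ^+ 2)%:C *: uone A -
       uinj (- (cstar a ** a + l^* *: a + l *: cstar a))).
Proof.
pose w : unitization A := (a, l).
have -> : (cabs l ^+ 2)%:C *: uone A - uinj (- (cstar a ** a + l^* *: a + l *: cstar a)) =
    cstar w ** w.
  rewrite -[RHS]/(umul (ustar _) _) -[LHS]/(_, _) /umul /ustar /=.
  rewrite scaler0 add0r opprK; congr pair.
  by rewrite oppr0 addr0 sqr_cabsC mulrC -[LHS]/(_ * 1) mulr1.
exact: (pos_starM one_l one_r).
Qed.

End Order.

(** * Positive functionals *)

Section Complexification.
Variables (R : realType) (V : lmodType R[i]).

(** The complex functional with real part [f]; the sign comes from Im z = - Re (i z). *)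
Definition complexify (f : V -> R) (a : V) : R[i] := f a +i* - f ('i%C *: a).

Lemma complexify_scalar f : real_linear f -> scalar (complexify f).
Proof.
move=> [fD fZ] k a b; rewrite /complexify; case: k => x y.
have kE (v : V) : (x +i* y) *: v = x%:C *: v + y%:C *: ('i%C *: v).
  by rewrite scalerA -scalerDl; congr (_ *: _); apply: complex_eqP => /=; ring.
have iE (v : V) : 'i%C *: ((x +i* y) *: v) = x%:C *: ('i%C *: v) + (- y)%:C *: v.
  rewrite !scalerA -scalerDl; congr (_ *: _); apply: complex_eqP => /=; ring.
rewrite scalerDr iE kE !fD !fZ.
by apply: complex_eqP => /=; ring.
Qed.

End Complexification.

Section Geometric.
Variables (R : realType) (V : normedModType R[i]).

Lemma half_pow_le n : (2^-1 : R) ^+ n <= invS R n.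
Proof.
rewrite exprVn /invS lef_pV2 ?posrE ?exprn_gt0// -natrX ler_nat.
exact: ltn_expl.
Qed.

Lemma geometric_cauchy (u : nat -> V) :
  (forall n, rnorm (u n.+1 - u n) <= (2^-1) ^+ n) -> cauchy_seq u.
Proof.
move=> u_step.
have u_le n m : (n <= m)%N -> rnorm (u m - u n) <= 2 * (2^-1) ^+ n - 2 * (2^-1) ^+ m.
  move=> /subnK <-; elim: (m - n)%N => [|d IH]; first by rewrite !subrr rnorm0.
  rewrite addSn; have := rnorm_triangle (u (d + n)%N) (u (d + n).+1) (u n).
  have := u_step (d + n)%N; rewrite exprS; move: ((2^-1) ^+ (d + n)) IH => x IH.
  lra.
move=> e e0; have [N h] := small_invS (half_gt0 e0); exists N => n m.
wlog nm : n m / (n <= m)%N.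
  by have [nm|/ltnW mn] := leqP n m => [|W Nn Nm]; [apply|rewrite rnormB; apply: W].
move=> Nn Nm; rewrite rnormB; apply: le_trans (u_le _ _ nm) _.
have := half_pow_le n; have := h n Nn; have : 0 <= (2^-1 : R) ^+ m by rewrite exprn_ge0.
lra.
Qed.

End Geometric.

Section PositiveFunctionals.
Variables (R : realType) (A : cstarType R) (phi : A -> R[i]).
Hypothesis phi_pos : positive_functional phi.

Local Ltac lin := lmod (A : lmodType R[i]).

Let phiP := phi_pos.1.

Lemma pfunD a b : phi (a + b) = phi a + phi b.
Proof. by have := phiP 1 a b; rewrite scale1r mul1r. Qed.

Lemma pfun0 : phi 0 = 0.
Proof. by apply: addr_idem; rewrite -pfunD addr0. Qed.

Lemma pfunZ k a : phi (k *: a) = k * phi a.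
Proof. by have := phiP k a 0; rewrite pfun0 !addr0. Qed.

Lemma pfunN a : phi (- a) = - phi a.
Proof. by rewrite -scaleN1r pfunZ mulN1r. Qed.

Lemma pfunB a b : phi (a - b) = phi a - phi b.
Proof. by rewrite pfunD pfunN. Qed.

Lemma pfun_pos_ge0 p : pos p -> 0 <= phi p.
Proof. by move=> [c [sc ->]]; rewrite -{1}sc; exact: phi_pos.2. Qed.

Lemma pfun_selfadj_Im h : selfadj h -> complex.Im (phi h) = 0.
Proof.
move=> /cpos_parts[p [q [/pfun_pos_ge0 pp /pfun_pos_ge0 pq -> _]]].
by rewrite pfunB (cge0_real pp) (cge0_real pq) /= oppr0 addr0.
Qed.

Lemma pfunJ a : phi (cstar a) = (phi a)^*.
Proof.
have [s sE] : exists s, s = cstar a by eexists.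
pose h := (2^-1)%:C *: (a + s); pose k := (2^-1)%:C *: ('i%C *: (s - a)).
have sh : selfadj h by rewrite /selfadj /h cstarZr cstarD sE cstarK addrC.
have sk : selfadj k.
  rewrite /selfadj /k cstarZr cstarZ cstarB sE cstarK; congr (_ *: _).
  have -> : ('i%C : R[i])^* = - 'i%C by apply: complex_eqP; rewrite /= ?oppr0.
  by lin; ring.
have ii : 'i%C * 'i%C = -1 :> R[i] by rewrite -expr2 sqr_i.
have aE : a = h + 'i%C *: k.
  rewrite /h /k !scalerA mulrAC ii mulN1r scaleNr.
  by lin; rewrite fmorphV rmorph_nat; field.
have sE' : cstar a = h - 'i%C *: k.
  rewrite -sE /h /k !scalerA mulrAC ii mulN1r scaleNr.
  by lin; rewrite fmorphV rmorph_nat; field.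
rewrite sE' [in RHS]aE pfunB pfunD !(pfunZ _ k).
have := pfun_selfadj_Im sh; have := pfun_selfadj_Im sk.
case: (phi h) (phi k) => [x y] [z w] /= -> ->.
by apply: complex_eqP => /=; ring.
Qed.

Lemma gns_formP y k x x' :
  phi (cstar y ** (k *: x + x')) = k * phi (cstar y ** x) + phi (cstar y ** x').
Proof. by rewrite cmulDr cmulZr pfunD pfunZ. Qed.

Lemma gns_formJ x y : phi (cstar x ** y) = (phi (cstar y ** x))^*.
Proof. by rewrite -pfunJ cstarM cstarK. Qed.

Definition gns_form : psdform A :=
  @Psdform R A (fun x y => phi (cstar y ** x)) gns_formP gns_formJ phi_pos.2.

Lemma pfun_pos_le (M : R) :
  (forall y, complex.Re (phi (cstar y ** y)) <= M * rnorm y ^+ 2) ->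
  forall p, pos p -> complex.Re (phi p) <= M * rnorm p.
Proof. by move=> phiM p [c [sc ->]]; rewrite rnorm_sqr// -{1}sc. Qed.

(* Positivity of [phi] on the unitization, with [M] in place of [phi 1]. *)
Lemma pfun_bound (M : R) : 0 <= M ->
  (forall y, complex.Re (phi (cstar y ** y)) <= M * rnorm y ^+ 2) ->
  forall v, cabs (phi v) ^+ 2 <= M * complex.Re (phi (cstar v ** v)).
Proof.
move=> M0 phiM v; rewrite mulrC.
apply: quadratic_disc => // t.
have [w [w1 wv]] := cabs_phase (phi v).
(* This phase makes both mixed terms of the square contribute the real number t |phi v|, so that a
   quadratic polynomial in [t] results. *)
pose l := (t%:C * w)^*.
have lv : l^* * phi v = (t * cabs (phi v))%:C by rewrite conjCK -mulrA wv rmorphM.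
have l2 : cabs l ^+ 2 = t ^+ 2.
  by rewrite cabsJ cabsM cabs_real w1 mulr1 real_normK ?num_real.
pose h := - (cstar v ** v + l^* *: v + l *: cstar v).
have sh : selfadj h.
  rewrite /selfadj cstarN !cstarD !cstarZ cstarM !cstarK conjCK.
  by rewrite /h; lin; ring.
(* Since h <= |l|^2 in the unitization, its positive part [p] has norm at most |l|^2; hence Re (phi
   h) <= Re (phi p) <= M t^2, and [phi] is evaluated only inside [A]. *)
have [p [q [pp /pfun_pos_ge0 pq hpq /(_ (cabs l ^+ 2))]]] := cpos_parts sh.
move=> /(_ (sqr_ge0 _) (pos_complete_square v l)) pl.
have : complex.Re (phi h) <= M * t ^+ 2.
  rewrite hpq pfunB ReD ReN -l2.
  have := pfun_pos_le phiM pp; have := cge0_Re pq; nra.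
rewrite /h pfunN ReN !pfunD !ReD !pfunZ pfunJ lv.
have -> : complex.Re (l * (phi v)^*) = t * cabs (phi v).
  by rewrite -ReJ rmorphM/= conjCK lv.
by rewrite /=; lra.
Qed.

(** Automatic continuity. Otherwise there are y_n in the unit ball with phi (y_n^* y_n) > n 2^n. The
    series of the 2^-n y_n^* y_n converges, and its sum dominates every partial sum because the
    positive cone is closed; so [phi] would exceed every n there. *)
Lemma pfun_locally_bounded : exists2 M : R, 0 <= M &
  forall y, rnorm y <= 1 -> complex.Re (phi (cstar y ** y)) <= M.
Proof.
apply: contrapT => unbounded.
have bad n : exists y, rnorm y <= 1 /\
    n%:R * 2 ^+ n < complex.Re (phi (cstar y ** y)).
  apply: contrapT => h; apply: unbounded; exists (n%:R * 2 ^+ n).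
    by rewrite mulr_ge0// exprn_ge0.
  move=> z z1; rewrite leNgt; apply/negP => zn; apply: h; exists z.
  by [].
have [y yP] := choice bad.
pose z n := ((2^-1) ^+ n)%:C *: (cstar (y n) ** y n).
have zpos n : pos (z n).
  have [c [sc cE]] := cpos_starM (y n).
  exists ((Num.sqrt ((2^-1) ^+ n))%:C *: c); rewrite sqrt_scale -?cE ?exprn_ge0//.
  by split => //; exact: selfadjZ.
pose s n := \sum_(i < n) z i.
have sS n : s n.+1 = s n + z n by rewrite /s big_ord_recr.
have [l sl] : exists l, tends s l.
  apply/cauchy_tends/geometric_cauchy => n.
  rewrite sS addrC addKr /z rnormZr ger0_norm ?exprn_ge0//.
  rewrite ler_piMr ?exprn_ge0// rnorm_starM.
  by rewrite exprn_ile1 ?rnorm_ge0//; have [] := yP n.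
have slpos n : pos (l - s n).
  apply: (@cpos_lim _ _ (fun m => s (m + n)%N - s n)).
    apply: tendsD (tends_cst (- s n)) => e /sl[N h].
    by exists N => m Nm; apply: h; exact: leq_trans (leq_addr _ _).
  elim=> [|m IH]; first by rewrite subrr; exists 0; split; [exact: selfadj0|rewrite cmul0l].
  by rewrite addSn sS addrAC; exact: cposD.
have phi_s n : 0 <= complex.Re (phi (s n)).
  elim: n => [|n IH]; first by rewrite /s big_ord0 pfun0.
  by rewrite sS pfunD ReD addr_ge0//; exact/cge0_Re/pfun_pos_ge0.
have phi_l n : n%:R <= complex.Re (phi l).
  have := cge0_Re (pfun_pos_ge0 (slpos n.+1)); rewrite pfunB ReD ReN subr_ge0.
  apply: le_trans; rewrite sS pfunD ReD /z pfunZ ReM_real.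
  have := phi_s n; have [_ h] := yP n.
  suff : n%:R <= 2^-1 ^+ n * complex.Re (phi (cstar (y n) ** y n)) by lra.
  by rewrite exprVn ler_pdivlMl ?exprn_gt0// mulrC ltW.
have := phi_l (Num.bound (complex.Re (phi l))).
by have := archi_boundP (le_trans (ler0n _ 0) (phi_l 0%N)); lra.
Qed.

Lemma pfun_bounded : exists2 M : R, 0 <= M &
  forall v, cabs (phi v) ^+ 2 <= M * complex.Re (phi (cstar v ** v)).
Proof.
have [M M0 h] := pfun_locally_bounded; exists M => //; apply: pfun_bound => // y.
have [y0|y0] := eqVneq (rnorm y) 0.
  by rewrite y0 (rnorm_eq0 y0) cmul0r pfun0 expr2 !mulr0.
have y1 : 0 < rnorm y by rewrite lt_neqAle eq_sym y0 rnorm_ge0.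
have := h ((rnorm y)^-1%:C *: y); rewrite rnormZr gtr0_norm ?invr_gt0// mulVf//.
move=> /(_ (lexx _)); rewrite cstarZr cmulZl cmulZr !pfunZ !ReM_real mulrA -expr2.
by rewrite exprVn ler_pdivrMl ?exprn_gt0// mulrC.
Qed.

End PositiveFunctionals.

(** * Norming positive functionals *)

Section GelfandNaimark.
Variables (R : realType) (A : cstarType R).

Local Ltac lin := lmod (A : lmodType R[i]).

(** The sublinear functional is the norm of the real part. The cone is generated by the positive
    elements with bound 0 and by d^* d with bound |d|^2; domination of these bounds is the
    monotonicity of the norm on positive elements. *)
Lemma norming_positive_functional (d : A) : exists phi : A -> R[i],
  [/\ positive_functional phi,
      forall y, complex.Re (phi (cstar y ** y)) <= rnorm y ^+ 2 &
      rnorm d ^+ 2 <= complex.Re (phi (cstar d ** d))].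
Proof.
pose p (h : A) := rnorm ((2^-1)%:C *: (h + cstar h)).
have pE h : selfadj h -> p h = rnorm h.
  by move=> sh; rewrite /p sh; congr rnorm; lin; rewrite fmorphV rmorph_nat; field.
pose K := [set z : A * R | exists S (s : R),
  [/\ pos S, 0 <= s, z.1 = S + s%:C *: (cstar d ** d) & z.2 = s * rnorm d ^+ 2]].
have pos0A : pos (0 : A) by exists 0; split; [exact: selfadj0|rewrite cmul0l].
have posZA (s : R) S : 0 <= s -> pos S -> pos (s%:C *: S : A).
  move=> s0 [c [sc ->]]; exists ((Num.sqrt s)%:C *: c); rewrite sqrt_scale//.
  by split=> //; exact: selfadjZ.
have [|||||f [flin fp fK]] := @hahn_banach_cone _ _ p K.
- split=> [x y|t x t0].
    rewrite /p; apply: le_trans (rnormD _ _); rewrite cstarD -scalerDr.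
    by rewrite addrACA.
  rewrite /p cstarZr -scalerDr scalerA mulrC -scalerA rnormZr.
  by rewrite ger0_norm.
- by exists 0, 0; split=> //=; rewrite ?scale0r ?addr0 ?mul0r.
- move=> z w [S [s [pS s0 z1 z2]]] [T [t [pT t0 w1 w2]]].
  exists (S + T), (s + t); split=> /=; [exact: cposD|exact: addr_ge0| |].
    by rewrite z1 w1 rmorphD; lin; ring.
  by rewrite z2 w2 mulrDl.
- move=> t z t0 [S [s [pS s0 z1 z2]]]; exists (t%:C *: S), (t * s).
  split=> /=; [exact: posZA|exact: mulr_ge0| |].
    by rewrite z1 scalerDr scalerA rmorphM.
  by rewrite z2 mulrA.
- move=> z [S [s [pS s0 z1 z2]]].
  have dpos : pos (s%:C *: (cstar d ** d)) by apply: posZA => //; exact: cpos_starM.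
  rewrite pE z1; last by apply: selfadjD; exact: pos_selfadj.
  have -> : z.2 = rnorm (s%:C *: (cstar d ** d)).
    by rewrite z2 rnormZr ger0_norm// rnorm_starM.
  by apply: cpos_le_norm => //; rewrite addrK.
(* The real part of i h is 0, so [p] vanishes at both i h and - i h, and [f] with it. The
   complexification is therefore real on self-adjoint elements. *)
have f_i h : selfadj h -> f ('i%C *: h) = 0.
  move=> sh; have pi0 (k : R[i]) : k^* = - k -> p (k *: h) = 0.
    by move=> kk; rewrite /p cstarZ sh kk scaleNr subrr scaler0 rnorm0.
  have iJ : ('i%C : R[i])^* = - 'i%C by apply: complex_eqP; rewrite /= ?oppr0.
  have := fp ('i%C *: h); have := fp (- 'i%C *: h).
  rewrite !pi0 ?rmorphN/= ?iJ// scaleNr (real_linearN _ flin) oppr_le0 => h1 h2.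
  by apply/le_anti; rewrite h1 h2.
exists (complexify f); split.
- split; first exact: complexify_scalar.
  move=> y; rewrite /complexify f_i ?oppr0; last exact: selfadj_starM.
  rewrite ler0c; apply: (fK (cstar y ** y, 0)); exists (cstar y ** y), 0.
  by split=> //=; [exact: cpos_starM|rewrite scale0r addr0|rewrite mul0r].
- by move=> y /=; rewrite -rnorm_starM -pE//; exact: selfadj_starM.
- apply: (fK (cstar d ** d, rnorm d ^+ 2)); exists 0, 1.
  by split=> //=; rewrite ?scale1r ?add0r ?mul1r.
Qed.

End GelfandNaimark.

(** * Representations of Fell bundles *)

Section Continuity.
Variables (R : realType) (V W : normedModType R[i]).

Lemma rnorm_bounded_continuous (f : V -> W) (M : R) :
  linear f -> (forall x, rnorm (f x) <= M * rnorm x) -> continuous f.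
Proof.
move=> fl fM x; apply/cvgrPdist_le => /= e e0.
have eE : e = (complex.Re e)%:C by apply: cge0_real; exact: ltW.
have e'0 : 0 < complex.Re e by move: e0; rewrite {1}eE ltcR.
have M1 : 0 < `|M| + 1 by rewrite ltr_wpDl.
have d0 : 0 < (complex.Re e / (`|M| + 1))%:C by rewrite ltcR divr_gt0.
have /cvgrPdist_le/(_ _ d0) := @cvg_id _ (nbhs x).
apply: filterS => y /=; rewrite !rnormE lecR ler_pdivlMr// => h.
rewrite eE lecR; apply: le_trans h.
have -> : f x - f y = f (x - y).
  by have := fl (-1) y x; rewrite !scaleN1r (addrC _ x) (addrC _ (f x)) => ->.
apply: le_trans (fM _) _; rewrite mulrC ler_wpM2l ?rnorm_ge0//.
by rewrite (le_trans (ler_norm _))// lerDl.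
Qed.

End Continuity.

Section InnerForm.
Variables (R : realType) (H : hilbertType R).
Implicit Types x y z : H.

Lemma innerP y (k : R[i]) x z : inner (k *: x + z) y = k * inner x y + inner z y.
Proof. by rewrite linearDl/= linearZl_LR. Qed.

Lemma innerJ x y : inner y x = (inner x y)^*.
Proof. by have := hermC inner y x; rewrite mul1r. Qed.

Lemma inner_ge0 x : 0 <= inner x x.
Proof. by rewrite inner_norm exprn_ge0. Qed.

Definition inner_form : psdform H := @Psdform R H inner innerP innerJ inner_ge0.

Lemma psq_inner x : psq inner_form x = rnorm x ^+ 2.
Proof. by apply: complexI; rewrite -psqE rmorphXn/= -rnormE -inner_norm. Qed.

Lemma psn_inner x : psn inner_form x = rnorm x.
Proof. by rewrite /psn psq_inner sqrtr_sqr ger0_norm ?rnorm_ge0. Qed.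

Lemma inner_le x y : cabs (inner x y) <= rnorm x * rnorm y.
Proof. by have := cauchy_schwarz inner_form x y; rewrite !psn_inner. Qed.

End InnerForm.

(** * Fibre identities and contractivity of *-actions *)

Section Actions.
Variables (R : realType) (G : groupType) (A : cstarType R) (B : fellBundle G A).

(** Identities such as b (c x) = (b c) x compare fibres over group elements that are only provably
    equal. Quantifying over a function of both the index and the element keeps casts out of the
    statements. *)
Lemma fiber_eq (T : Type) (F : forall s, fiber B s -> T) s s'
  (b : fiber B s) (b' : fiber B s') :
  s = s' -> \val b = \val b' -> F s b = F s' b'.
Proof. by move=> ss'; subst s' => /val_inj ->. Qed.

Lemma fib_scale s (k : R[i]) (a : A) : B s a -> B s (k *: a).
Proof. by move=> Ba; rewrite -[k *: a]addr0; apply: fib_linear => //; exact: fib0. Qed.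

Lemma fib_add s (a b : A) : B s a -> B s b -> B s (a + b).
Proof. by move=> Ba Bb; rewrite -[a]scale1r; exact: fib_linear. Qed.

Lemma fib_cstar s (a : A) : B s a -> B s^-1%g (cstar a).
Proof. by move=> Ba; rewrite -fib_star; exists a. Qed.

Lemma fib_lim s (u : nat -> A) l : tends u l -> (forall n, B s (u n)) -> B s l.
Proof.
move=> ul uB; rewrite (iffLR (closure_id _) (@fib_closed R G A B s)).
move=> N /nbhs_ballP[e /= e0 eN].
have eE : e = (complex.Re e)%:C by apply: cge0_real; exact: ltW.
have e'0 : 0 < complex.Re e by move: e0; rewrite {1}eE ltcR.
have [n /(_ n (leqnn _)) h] := ul _ (half_gt0 e'0).
exists (u n); split => //; apply: eN.
by rewrite -ball_normE/= rnormE eE ltcR rnormB; lra.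
Qed.

Lemma fiber_fib s (b : fiber B s) : B s (\val b).
Proof. exact/set_mem/valP. Qed.

Variables (V : lmodType R[i]) (q : psdform V).

(* A *-action of the bundle by operators that need not be bounded a priori. *)
Record star_action := StarAction {
  sact :> forall s, fiber B s -> V -> V;
  sact_linear : forall s (b : fiber B s) k x y, sact b (k *: x + y) = k *: sact b x + sact b y;
  sact_linearl : forall s (k : R[i]) (b c : fiber B s) x,
    sact (k *: b + c) x = k *: sact b x + sact c x;
  sact_mul : forall s t (b : fiber B s) (c : fiber B t) x,
    sact b (sact c x) = sact (fmul b c) x;
  sact_adj : forall s (b : fiber B s) x y, q (sact b x) y = q x (sact (fstar b) y) }.

Variable L : star_action.

Lemma sact0l s x : L _ (0 : fiber B s) x = 0.
Proof.
apply: addr_idem; have := sact_linearl L 1 (0 : fiber B s) 0 x.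
by rewrite scaler0 addr0 scale1r.
Qed.

Lemma sactDl s (b c : fiber B s) x : L _ (b + c) x = L _ b x + L _ c x.
Proof. by have := sact_linearl L 1 b c x; rewrite !scale1r. Qed.

Lemma sactZl s k (b : fiber B s) x : L _ (k *: b) x = k *: L _ b x.
Proof. by have := sact_linearl L k b 0 x; rewrite sact0l !addr0. Qed.

(* In the unitization of the unit fiber [1 - b^* b = (1 - x)^2], so that
   [q (v, v) - q (b v, b v)] is the square of the seminorm of [v - x v]. *)
Lemma sact_contract s (b : fiber B s) v : rnorm (\val b) <= 1 ->
  psq q (L _ b v) <= psq q v.
Proof.
move=> b1; set k := cstar (\val b) ** \val b.
have Bk : B 1%g k.
  by rewrite -(mulVg s); apply: fib_mul; [apply: fib_cstar|]; exact: fiber_fib.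
have [x [_ [sx Bx] xx]] : exists x : A,
    [/\ rnorm x <= 1, selfadj x /\ B 1%g x & x + x = k + x ** x].
  apply: (@sqrt_iteration _ _ k (fun x => selfadj x /\ B 1%g x)).
  - by rewrite rnorm_starM exprn_ile1 ?rnorm_ge0.
  - by split; [exact: selfadj0|exact: fib0].
  - by split=> //; exact: selfadj_starM.
  - by move=> y z [sy By] [sz Bz]; split; [exact: selfadjD|exact: fib_add].
  - by move=> t y [sy By]; split; [exact: selfadjZ|exact: fib_scale].
  - move=> y [sy By]; split; first exact: selfadj_sqr.
    by rewrite -(mulg1 1%g); exact: fib_mul.
  - move=> u l ul uP; split; first by apply: tends_selfadj ul _ => n; have [] := uP n.
    by apply: fib_lim ul _ => n; have [] := uP n.
pose X : fiber B 1%g := Sub x (mem_set Bx).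
have Bxx : B 1%g (x ** x) by rewrite -(mulg1 1%g); exact: fib_mul.
pose X2 : fiber B 1%g := Sub (x ** x) (mem_set Bxx).
pose K : fiber B 1%g := Sub k (mem_set Bk).
have XX w : L _ X (L _ X w) = L _ X2 w.
  by rewrite sact_mul; apply: (fiber_eq (fun s b => L s b w)); rewrite ?mulg1.
have Xadj w w' : q (L _ X w) w' = q w (L _ X w').
  rewrite sact_adj; congr (q w _).
  by apply: (fiber_eq (fun s b => L s b w')); rewrite ?invg1 //= sx.
have Kb : q (L _ b v) (L _ b v) = q v (L _ K v).
  rewrite sact_adj sact_mul; congr (q v _).
  by apply: (fiber_eq (fun s b => L s b v)); rewrite ?mulVg.
have XK : L _ X v + L _ X v = L _ K v + L _ X2 v.
  by rewrite -!sactDl; congr (L _ _ _); apply: val_inj.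
suff : psq q (v - L _ X v) = psq q v - psq q (L _ b v).
  by move=> h; rewrite -subr_ge0 -h psq_ge0.
apply: complexI; rewrite rmorphB/= -!psqE Kb.
rewrite pformBl !(pformJ q (v - L _ X v)) -!pformJ.
have pB w y z : q w (y - z) = q w y - q w z.
  by rewrite pformDr -scaleN1r pformZr rmorphN1 mulN1r.
rewrite !pB !Xadj XX.
have -> : q v (L _ K v) = q v (L _ X v) + q v (L _ X v) - q v (L _ X2 v).
  by rewrite -pformDr XK pformDr addrK.
ring.
Qed.

Lemma sact_le s (b : fiber B s) v : psn q (L _ b v) <= rnorm (\val b) * psn q v.
Proof.
have [b0|b0] := eqVneq (rnorm (\val b)) 0.
  have -> : b = 0 by apply: val_inj; exact: rnorm_eq0.
  by rewrite sact0l /psn /psq pform0l sqrtr0 mulr_ge0 ?rnorm_ge0 ?sqrtr_ge0.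
have b1 : 0 < rnorm (\val b) by rewrite lt_neqAle eq_sym b0 rnorm_ge0.
have := @sact_contract s ((rnorm (\val b))^-1%:C *: b) v.
rewrite [rnorm (\val (_ *: _))]rnormZr gtr0_norm ?invr_gt0// mulVf//.
move=> /(_ (lexx _)); rewrite -!sqr_psn sactZl psnZ cabs_real gtr0_norm ?invr_gt0//.
rewrite ler_pXn2r ?nnegrE ?mulr_ge0 ?psn_ge0 ?invr_ge0 ?(ltW b1)//.
by rewrite ler_pdivrMl.
Qed.

End Actions.

Section RepresentationBound.
Variables (R : realType) (G : groupType) (A : cstarType R) (B : fellBundle G A).
Variables (H : hilbertType R) (pi : representation B H).

Definition rep_action : star_action B (inner_form H) :=
  @StarAction R G A B H (inner_form H) pi
    (fun s b => (rep_bounded pi b).1)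
    (fun s k b c x => rep_linear pi x k b c)
    (rep_mul pi) (rep_star pi).

(** A representation is a *-action for the form given by the inner product, so contractivity is
    automatic. It is what makes integrated forms converge on [l1]. *)
Lemma rep_le s (b : fiber B s) x : rnorm (pi s b x) <= rnorm (\val b) * rnorm x.
Proof. by have := sact_le rep_action b x; rewrite !psn_inner. Qed.

End RepresentationBound.

(** * The GNS representation on the antidual *)

Section GNS.
Variables (R : realType) (G : groupType) (A : cstarType R) (B : fellBundle G A).
Variables (V : lmodType R[i]) (q : psdform V) (L : star_action B q).

Lemma gns_subproof s (b : fiber B s) (u : rkhs q) :
  (fun v => rkv u (L s^-1%g (fstar b) v) : R[i]^o) \in rkset q.
Proof.
apply/mem_set; split=> [k x y|]; first by rewrite sact_linear rkvP.
exists (rkn u * rnorm (\val b)); split; first by rewrite mulr_ge0 ?rkn_ge0 ?rnorm_ge0.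
move=> x; apply: le_trans (rknP u _) _; rewrite -mulrA ler_wpM2l ?rkn_ge0//.
by have := sact_le L (fstar b) x; rewrite /= rnorm_star.
Qed.

(** [b] acts on a functional by precomposition with the action of its adjoint; on [rkhat x] this is
    the original action ([gns_hat]). *)
Definition gns s (b : fiber B s) (u : rkhs q) : rkhs q :=
  Sub (fun v => rkv u (L s^-1%g (fstar b) v) : R[i]^o) (gns_subproof b u).

Lemma gnsE s (b : fiber B s) u v : rkv (gns b u) v = rkv u (L s^-1%g (fstar b) v).
Proof. by []. Qed.

Lemma gns_linear s (b : fiber B s) : linear (gns b).
Proof. by move=> k u v; apply: rkv_inj. Qed.

Lemma gns_le s (b : fiber B s) u : rnorm (gns b u) <= rnorm (\val b) * rnorm u.
Proof.
rewrite mulrC !rnorm_rkhs; apply: rkn_le; split; first by rewrite mulr_ge0 ?rkn_ge0 ?rnorm_ge0.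
move=> x; apply: le_trans (rknP u _) _; rewrite -mulrA ler_wpM2l ?rkn_ge0//.
by have := sact_le L (fstar b) x; rewrite /= rnorm_star.
Qed.

Lemma gns_linearl s u : linear (fun b : fiber B s => gns b u).
Proof.
move=> k b c; apply: rkv_inj; apply/funext => v.
rewrite rkvD rkvZ !gnsE.
have -> : fstar (k *: b + c) = k^* *: fstar b + fstar c.
  by apply: val_inj; exact: cstar_antilinear.
by rewrite sact_linearl rkvP conjCK.
Qed.

Lemma gns_mul s t (b : fiber B s) (c : fiber B t) u : gns b (gns c u) = gns (fmul b c) u.
Proof.
apply: rkv_inj; apply/funext => v; rewrite !gnsE sact_mul; congr (rkv u _).
by apply: (fiber_eq (fun s b => L s b v)); rewrite ?invgM //= cstarM.
Qed.

Lemma gns_hat s (b : fiber B s) x : gns b (rkhat q x) = rkhat q (L s b x).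
Proof.
apply: rkv_inj; apply/funext => v; rewrite gnsE !rkhatE pformJ sact_adj -pformJ.
congr (q _ v); apply: (fiber_eq (fun s b => L s b x)); first by rewrite invgK.
exact: cstarK.
Qed.

(** For [w] of the form [rkhat x] both sides are the value of [u] at the action of [fstar b] on [x];
    the error estimate characterising [rkinner] covers every other [w]. *)
Lemma gns_star s (b : fiber B s) u w :
  rkinner (gns b u) w = rkinner u (gns (fstar b) w).
Proof.
apply: (@rkinner_unique _ _ _ _ _ _ (rnorm u * rnorm (\val (fstar b)))).
  by rewrite mulr_ge0 ?rnorm_ge0.
move=> x; rewrite gnsE -rkinner_hat -gns_hat.
rewrite (rkinnerJ (gns _ w)) (rkinnerJ (gns _ (rkhat q x))) -rmorphB cabsJ -rkinnerBl.
apply: le_trans (rkinner_le _ _) _; rewrite mulrC -mulrA ler_wpM2l ?rnorm_ge0//.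
suff -> : gns (fstar b) w - gns (fstar b) (rkhat q x) = gns (fstar b) (w - rkhat q x).
  exact: gns_le.
by apply: rkv_inj.
Qed.

Lemma gns_continuous s u : continuous (fun b : fiber B s => gns b u).
Proof.
move=> b; have FF : Filter (nbhs b) by exact: nbhs_filter.
apply/cvgrPdist_le => /= e e0.
have eE : e = (complex.Re e)%:C by apply: cge0_real; exact: ltW.
have e'0 : 0 < complex.Re e by move: e0; rewrite {1}eE ltcR.
have u1 : 0 < rnorm u + 1 by rewrite ltr_wpDl ?rnorm_ge0.
have d0 : 0 < (complex.Re e / (rnorm u + 1))%:C by rewrite ltcR divr_gt0.
have vc : {for b, continuous (\val : fiber B s -> A)}.
  exact: initial_continuous.
have := vc; move=> /cvgrPdist_le/(_ _ d0).
apply: filterS => c /=; rewrite !rnormE lecR ler_pdivlMr// => h.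
rewrite eE lecR; apply: le_trans h.
have -> : gns b u - gns c u = gns (b - c) u.
  by have := gns_linearl u (-1) c b; rewrite !scaleN1r (addrC _ b) (addrC _ (gns b u)) => ->.
apply: le_trans (gns_le _ _) _.
by rewrite ler_wpM2l ?rnorm_ge0// lerDl.
Qed.

Definition gns_rep : representation B (rkhs q) :=
  @Representation R G A B (rkhs q) gns
    (fun s b => conj (@gns_linear s b)
       (rnorm_bounded_continuous (@gns_linear s b) (gns_le b)))
    (fun s u => @gns_linearl s u) gns_mul gns_star gns_continuous.

(** The cyclic vector [xi] is a functional that need not come from [V], as there may be no unit. The
    hypothesis says that [gns b xi] comes from [x]. *)
Lemma gns_coefficient (xi eta : rkhs q) s (b : fiber B s) x :
  (forall v, rkv xi (L s^-1%g (fstar b) v) = q x v) ->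
  coefficient gns_rep xi eta b = (rkv eta x)^*.
Proof.
move=> xib; rewrite /coefficient -rkinner_hatl; congr (rkinner _ eta).
by apply: rkv_inj; apply/funext => v; exact: xib.
Qed.

End GNS.

(** * Unconditional sums *)

Local Open Scope fset_scope.
Local Open Scope ring_scope.

Section UnconditionalSums.
Variables (R : realType) (I : choiceType).

Section Normed.
Variable V : normedModType R[i].
Implicit Types (x : I -> V) (l : V).

Definition sums_to x l := forall e : R, 0 < e ->
  exists F0 : {fset I}, forall F, F0 `<=` F -> rnorm (\sum_(i <- F) x i - l) <= e.

Lemma sums_to_sum x l : sums_to x l -> summability.sum x = l.
Proof.
move=> xl.
have PF : ProperFilter (@summability.totally I) := summability.totally_filter.
apply: cvg_lim => //; apply/cvgrPdist_le => e e0.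
have eE : e = (complex.Re e)%:C by apply: cge0_real; exact: ltW.
have e'0 : 0 < complex.Re e by move: e0; rewrite {1}eE ltcR.
have [F0 h] := xl _ e'0; exists F0 => // F /= F0F.
rewrite rnormE eE lecR rnormB /summability.partial_sum.
by rewrite -(big_seq_fsetE _ _ xpredT); exact: h.
Qed.

Lemma sums_to_finite x (F : {fset I}) : (forall i, i \notin F -> x i = 0) ->
  sums_to x (\sum_(i <- F) x i).
Proof.
move=> x0 e e0; exists F => F' FF'.
suff -> : \sum_(i <- F') x i = \sum_(i <- F) x i by rewrite subrr rnorm0 ltW.
by rewrite -!fsbigTE// => i iF'; apply: x0; apply: contra iF'; exact: (fsubsetP FF').
Qed.

Lemma rnorm_sum_le (r : seq I) x : rnorm (\sum_(i <- r) x i) <= \sum_(i <- r) rnorm (x i).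
Proof.
elim: r => [|i r IH]; first by rewrite !big_nil rnorm0.
by rewrite !big_cons; apply: le_trans (rnormD _ _) _; rewrite lerD2l.
Qed.

Lemma sums_to_le x l (M : R) : sums_to x l ->
  (forall F : {fset I}, rnorm (\sum_(i <- F) x i) <= M) -> rnorm l <= M.
Proof.
move=> xl xM; apply: ge_small => e /xl[F /(_ F (fsubset_refl _)) h].
have := rnormD (l - \sum_(i <- F) x i) (\sum_(i <- F) x i).
by rewrite subrK rnormB; have := xM F; lra.
Qed.

End Normed.

Lemma sums_to_linear (V W : normedModType R[i]) (f : V -> W) (M : R) (x : I -> V) l :
  linear f -> (forall v, rnorm (f v) <= M * rnorm v) ->
  sums_to x l -> sums_to (fun i => f (x i)) (f l).
Proof.
move=> fl fM xl e e0.
have f0 : f 0 = 0.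
  by apply: addr_idem; have := fl 1 0 0; rewrite !scale1r addr0.
have fD a b : f (a + b) = f a + f b by have := fl 1 a b; rewrite !scale1r.
have fB a b : f (a - b) = f a - f b.
  by have := fl (-1) b a; rewrite !scaleN1r (addrC _ a) (addrC _ (f a)).
have M1 : 0 < `|M| + 1 by rewrite ltr_wpDl.
have [F0 h] := xl (e / (`|M| + 1)) (divr_gt0 e0 M1).
exists F0 => F /h; rewrite ler_pdivlMr// => hF.
have -> : \sum_(i <- F) f (x i) = f (\sum_(i <- F) x i).
  by elim/big_ind2: _ => // a b c d -> ->; rewrite fD.
rewrite -fB; apply: le_trans (fM _) (le_trans _ hF).
rewrite mulrC ler_wpM2l ?rnorm_ge0//.
by rewrite (le_trans (ler_norm _))// lerDl.
Qed.

(** Finite sets are chosen whose sums of norms are within 1/(n+1) of the supremum. Whatever a larger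
    finite set adds has norm at most 1/(n+1); so the partial sums over the chosen sets are Cauchy,
    and their limit is unconditional. *)
Lemma abs_summable (V : completeNormedModType R[i]) (x : I -> V) (M : R) :
  (forall F : {fset I}, \sum_(i <- F) rnorm (x i) <= M) -> exists l, sums_to x l.
Proof.
move=> xM; pose S := [set \sum_(i <- F) rnorm (x i) | F in [set: {fset I}]].
have supS : has_sup S.
  split; first by exists (\sum_(i <- fset0) rnorm (x i)), fset0.
  by exists M => _ [F _ <-].
have Sle (F : {fset I}) : \sum_(i <- F) rnorm (x i) <= sup S.
  by apply: (ub_le_sup supS.2); exists F.
have near n : exists F : {fset I}, sup S - invS R n < \sum_(i <- F) rnorm (x i).
  by have [_ [F _ <-] h] := sup_adherent (invS_gt0 R n) supS; exists F.
have [F_ hF] := choice near.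
have splitF (T : zmodType) (y : I -> T) (F F' : {fset I}) : F `<=` F' ->
    \sum_(i <- F') y i = \sum_(i <- F) y i + \sum_(i <- F' `\` F) y i.
  move=> /fsubsetP FF'; rewrite (big_fsetID _ (mem F)); congr (_ + _).
    apply: eq_fbigl => i; rewrite !inE andbC.
    by case iF: (i \in F) => //=; rewrite FF'.
  by apply: eq_fbigl => i; rewrite !inE andbC.
have tail n (F : {fset I}) : F_ n `<=` F ->
    rnorm (\sum_(i <- F) x i - \sum_(i <- F_ n) x i) <= invS R n.
  move=> nF; rewrite (splitF V x _ _ nF) addrC addKr.
  apply: le_trans (rnorm_sum_le _ _) _.
  have := Sle F; have := hF n; rewrite (splitF R _ _ _ nF); lra.
have [|l hl] := @cauchy_tends R V (fun n => \sum_(i <- F_ n) x i).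
  move=> e e0; have [N h] := small_invS (half_gt0 e0); exists N => n m /h hn /h hm.
  have t1 := tail n (F_ n `|` F_ m) (fsubsetUl _ _).
  have t2 := tail m (F_ n `|` F_ m) (fsubsetUr _ _).
  have := rnorm_triangle (\sum_(i <- F_ n `|` F_ m) x i) (\sum_(i <- F_ n) x i)
    (\sum_(i <- F_ m) x i).
  rewrite (rnormB (\sum_(i <- F_ n) x i) (\sum_(i <- F_ n `|` F_ m) x i)); lra.
exists l => e e0.
have [N1 h1] := hl _ (half_gt0 e0); have [N2 h2] := small_invS (half_gt0 e0).
set n := maxn N1 N2; exists (F_ n) => F /tail.
have := h1 n (leq_maxl _ _); have := h2 n (leq_maxr _ _).
have := rnorm_triangle (\sum_(i <- F_ n) x i) (\sum_(i <- F) x i) l; lra.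
Qed.

End UnconditionalSums.

(** * Finitely supported sections *)

Section Sections.
Variables (R : realType) (G : groupType) (A : cstarType R) (B : fellBundle G A).

Lemma sec_addA : associative (fun f g : section B => (fun s => f s + g s) : section B).
Proof. by move=> f g h; apply: functional_extensionality_dep => s; rewrite addrA. Qed.

Lemma sec_addC : commutative (fun f g : section B => (fun s => f s + g s) : section B).
Proof. by move=> f g; apply: functional_extensionality_dep => s; rewrite addrC. Qed.

Lemma sec_add0 :
  left_id ((fun s => 0) : section B) (fun f g : section B => (fun s => f s + g s) : section B).
Proof. by move=> f; apply: functional_extensionality_dep => s; rewrite add0r. Qed.

Lemma sec_addN : left_inverse ((fun s => 0) : section B)
  (fun f : section B => (fun s => - f s) : section B)
  (fun f g : section B => (fun s => f s + g s) : section B).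
Proof. by move=> f; apply: functional_extensionality_dep => s; rewrite addNr. Qed.

HB.instance Definition _ := gen_eqMixin (section B).
HB.instance Definition _ := gen_choiceMixin (section B).
HB.instance Definition _ := GRing.isZmodule.Build (section B)
  sec_addA sec_addC sec_add0 sec_addN.

Definition sec_scale (k : R[i]) (f : section B) : section B := fun s => k *: f s.

Lemma sec_scaleA k l f : sec_scale k (sec_scale l f) = sec_scale (k * l) f.
Proof. by apply: functional_extensionality_dep => s; rewrite /sec_scale scalerA. Qed.

Lemma sec_scale1 : left_id 1 sec_scale.
Proof. by move=> f; apply: functional_extensionality_dep => s; rewrite /sec_scale scale1r. Qed.

Lemma sec_scaleDr : right_distributive sec_scale +%R.
Proof. by move=> k f g; apply: functional_extensionality_dep => s; exact: scalerDr. Qed.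

Lemma sec_scaleDl f : {morph sec_scale^~ f : k l / k + l}.
Proof. by move=> k l; apply: functional_extensionality_dep => s; exact: scalerDl. Qed.

HB.instance Definition _ := GRing.Zmodule_isLmodule.Build R[i] (section B)
  sec_scaleA sec_scale1 sec_scaleDr sec_scaleDl.

Lemma sec_addE (f g : section B) s : (f + g) s = f s + g s. Proof. by []. Qed.
Lemma sec_scaleE k (f : section B) s : (k *: f) s = k *: f s. Proof. by []. Qed.

Lemma sec_eq (f g : section B) : (forall s, \val (f s) = \val (g s)) -> f = g.
Proof. by move=> fg; apply: functional_extensionality_dep => s; apply: val_inj. Qed.

Lemma cc_submod_closed : subsemimod_closed (fun f => f \in @cc R G A B).
Proof.
split; first split.
- by apply/mem_set; apply: (sub_finite_set _ (finite_set0 G)) => s; rewrite /= eqxx.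
- move=> f g /set_mem ff /set_mem fg; apply/mem_set.
  have fin : finite_set ([set s | f s != 0] `|` [set s | g s != 0]).
    by rewrite finite_setU.
  apply: (sub_finite_set _ fin) => s /=.
  rewrite sec_addE; have [->|f0] := eqVneq (f s) 0; last by left.
  by rewrite add0r => g0; right.
- move=> k f /set_mem ff; apply/mem_set; apply: (sub_finite_set _ ff) => s /=.
  by rewrite sec_scaleE; apply: contra_neq => ->; rewrite scaler0.
Qed.

(** A module type for the finitely supported sections, so that forms, sublinear functionals and the
    Hahn-Banach theorem apply to them. *)
Definition fsec : Type := {f : section B | f \in @cc R G A B}.

HB.instance Definition _ := [isSub of fsec for @sval _ (fun f => f \in @cc R G A B)].
HB.instance Definition _ := [Choice of fsec by <:].
HB.instance Definition _ :=
  GRing.SubChoice_isSubLmodule.Build R[i] (section B) _ fsec cc_submod_closed.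

Definition fsec_of (f : section B) (ff : cc f) : fsec := Sub f (mem_set ff).

Lemma fsec_cc (f : fsec) : cc (\val f).
Proof. exact/set_mem/valP. Qed.

Lemma fsec_eq (f g : fsec) : (forall s, \val (\val f s) = \val (\val g s)) -> f = g.
Proof. by move=> fg; apply/val_inj/sec_eq. Qed.

Lemma fsec_supp (f : fsec) s : s \notin fset_set [set s | \val f s != 0] -> \val f s = 0.
Proof.
move=> fs; apply/eqP; apply: contraNT fs => fs.
by rewrite in_fset_set; [exact/mem_set|exact: fsec_cc].
Qed.

Lemma val_dirac s (b : fiber B s) t :
  \val (dirac_section b t) = if t == s then \val b else 0.
Proof.
rewrite /dirac_section; have [->|ts] := eqVneq t s; first by rewrite dfwithin.
by rewrite dfwithout// eq_sym.
Qed.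

Lemma cc_dirac s (b : fiber B s) : cc (dirac_section b).
Proof.
apply: (sub_finite_set _ (finite_set1 s)) => t /=; apply: contra_neqP => /eqP/negPf ts.
by apply: val_inj; rewrite val_dirac ts.
Qed.

Definition sdirac s (b : fiber B s) : fsec := fsec_of (cc_dirac b).

Lemma sdirac_linear s k (b c : fiber B s) : sdirac (k *: b + c) = k *: sdirac b + sdirac c.
Proof.
apply: fsec_eq => t; rewrite -[RHS]/(k *: \val (dirac_section b t) + \val (dirac_section c t)).
by rewrite !val_dirac; case: eqP => _ //; rewrite scaler0 addr0.
Qed.

(** Finitely supported sections are finite sums of sections concentrated at one point. Additive
    statements on convolution and adjoints thus reduce to the operations of the bundle; the empty
    sum is the zero of the unit fibre. *)
Lemma fsec_ind (P : fsec -> Prop) : (forall f g, P f -> P g -> P (f + g)) ->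
  (forall s (b : fiber B s), P (sdirac b)) -> forall f, P f.
Proof.
move=> PD Pd.
suff main (r : seq G) (f : fsec) : (forall s, s \notin r -> \val f s = 0) -> P f.
  by move=> f; apply: (main (fset_set [set s | \val f s != 0])) => s; exact: fsec_supp.
elim: r f => [|t r IH] f f0.
  have -> : f = sdirac (0 : fiber B 1%g).
    by apply: fsec_eq => s; rewrite f0//= val_dirac; case: eqP.
  exact: Pd.
rewrite -(subrK (sdirac (\val f t)) f); apply: PD; last exact: Pd.
apply: IH => s sr; apply: val_inj.
rewrite -[LHS]/(\val (\val f s) - \val (dirac_section (\val f t) s)) val_dirac.
have [->|st] := eqVneq s t; first exact: subrr.
by rewrite f0 ?subr0// inE negb_or st.
Qed.

Section Total.
Variables (W : lmodType R[i]) (g : forall s, fiber B s -> W).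

Definition linear_family := forall s (k : R[i]) (b c : fiber B s),
  g (k *: b + c) = k *: g b + g c.

Definition total (f : section B) : W := \sum_(s \in [set: G]) g (f s).

Hypothesis g_lin : linear_family.

Lemma linear_family0 s : g (0 : fiber B s) = 0.
Proof.
by apply: addr_idem; have := g_lin 1 (0 : fiber B s) 0; rewrite scaler0 addr0 scale1r.
Qed.

Lemma totalE (F : {fset G}) f : (forall s, s \notin F -> f s = 0) ->
  total f = \sum_(s <- F) g (f s).
Proof. by move=> f0; apply: fsbigTE => s /f0->; exact: linear_family0. Qed.

Lemma total_linear k (f h : fsec) :
  total (\val (k *: f + h)) = k *: total (\val f) + total (\val h).
Proof.
pose S (u : fsec) := fset_set [set s | \val u s != 0].
have S0 (u : fsec) s : s \notin S u -> \val u s = 0.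
  exact: fsec_supp.
pose F := (S f `|` S h)%fset.
have fF s : s \notin F -> \val f s = 0 by rewrite inE negb_or => /andP[/S0].
have hF s : s \notin F -> \val h s = 0 by rewrite inE negb_or => /andP[_ /S0].
rewrite (totalE fF) (totalE hF) (@totalE F); last first.
  move=> s sF; rewrite -[LHS]/(k *: \val f s + \val h s) fF// hF//.
  by rewrite scaler0 addr0.
by rewrite scaler_sumr -big_split; apply: eq_bigr => s _; exact: g_lin.
Qed.

Lemma totalD (f h : fsec) : total (\val (f + h)) = total (\val f) + total (\val h).
Proof. by have := total_linear 1 f h; rewrite !scale1r. Qed.

Lemma total_dirac s (b : fiber B s) : total (dirac_section b) = g b.
Proof.
rewrite (@totalE [fset s]%fset) ?big_seq_fset1.
  by rewrite /dirac_section dfwithin.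
by move=> t; rewrite inE => ts; rewrite /dirac_section dfwithout// eq_sym.
Qed.

End Total.

(** Left convolution by the section concentrated at [s] (see [sconv_dirac]). On [fsec] it is the
    bundle action to which the GNS construction is applied in [representable]. *)
Definition trans s (b : fiber B s) (x : section B) : section B := fun t =>
  Sub (\val b ** \val (x (s^-1 * t)%g)) (convolution_subproof b (x (s^-1 * t)%g)).

Lemma val_trans s (b : fiber B s) x t :
  \val (trans b x t) = \val b ** \val (x (s^-1 * t)%g).
Proof. by []. Qed.

Lemma cc_trans s (b : fiber B s) x : cc x -> cc (trans b x).
Proof.
move=> xf; apply: (sub_finite_set _ (finite_image (fun r => s * r)%g xf)) => t /=.
move=> bx; exists (s^-1 * t)%g; last by rewrite mulVKg.
apply: contra_neq bx => x0; apply: val_inj; rewrite val_trans x0.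
exact: cmul0r.
Qed.

Definition strans s (b : fiber B s) (x : fsec) : fsec := fsec_of (cc_trans b (fsec_cc x)).

Lemma strans_linear s (b : fiber B s) k x y :
  strans b (k *: x + y) = k *: strans b x + strans b y.
Proof.
by apply: fsec_eq => t; rewrite [LHS]cmulDr cmulZr.
Qed.

Lemma strans_linearl s (k : R[i]) (b c : fiber B s) x :
  strans (k *: b + c) x = k *: strans b x + strans c x.
Proof. by apply: fsec_eq => t; rewrite [LHS]cmulDl cmulZl. Qed.

Lemma strans_mul s t (b : fiber B s) (c : fiber B t) x :
  strans b (strans c x) = strans (fmul b c) x.
Proof.
apply: fsec_eq => r; rewrite [LHS]cmulA [RHS]/=; congr (_ ** _).
by rewrite invgM mulgA.
Qed.

Lemma strans_dirac s t (b : fiber B s) (c : fiber B t) :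
  strans b (sdirac c) = sdirac (fmul b c).
Proof.
apply: fsec_eq => r.
rewrite -[LHS]/(\val b ** \val (dirac_section c (s^-1 * r)%g)) !val_dirac.
have -> : (s^-1 * r == t)%g = (r == s * t)%g.
  by apply/eqP/eqP => [<-|->]; rewrite ?mulVKg ?mulKg.
by case: eqP => // _; rewrite cmul0r.
Qed.

Lemma conv_total (f g : section B) s :
  convolution f g s = total (fun t b => trans b g s) f.
Proof. by []. Qed.

Lemma trans_family (g : section B) s : linear_family (fun t (b : fiber B t) => trans b g s).
Proof. by move=> t k b c; apply: val_inj; rewrite [LHS]cmulDl cmulZl. Qed.

Lemma cc_convolution (f g : fsec) : cc (convolution (\val f) (\val g)).
Proof.
elim/fsec_ind: f => [f h ff fh|s b].
  have -> : convolution (\val (f + h)) (\val g) =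
            convolution (\val f) (\val g) + convolution (\val h) (\val g).
    apply: functional_extensionality_dep => s; rewrite conv_total.
    by rewrite totalD//; exact: trans_family.
  apply/set_mem; apply: (cc_submod_closed.1.2); exact/mem_set.
have -> : convolution (\val (sdirac b)) (\val g) = trans b (\val g).
  apply: functional_extensionality_dep => r; rewrite conv_total total_dirac//.
  exact: trans_family.
by apply: cc_trans; exact: fsec_cc.
Qed.

Definition sconv (f g : fsec) : fsec := fsec_of (cc_convolution f g).

Lemma sconvDl f h g : sconv (f + h) g = sconv f g + sconv h g.
Proof.
apply: val_inj; apply: functional_extensionality_dep => s.
by rewrite [LHS]conv_total totalD//; exact: trans_family.
Qed.

Lemma sconv_dirac s (b : fiber B s) g : sconv (sdirac b) g = strans b g.
Proof.
apply: val_inj; apply: functional_extensionality_dep => r.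
by rewrite [LHS]conv_total total_dirac//; exact: trans_family.
Qed.

Lemma cc_star (f : section B) : cc f -> cc (section_star f).
Proof.
move=> ff; apply: (sub_finite_set _ (finite_image (fun r => r^-1)%g ff)) => t /=.
move=> ft; exists (t^-1)%g; last by rewrite invgK.
apply: contra_neq ft => f0; apply: val_inj; rewrite /= f0.
exact: cstar0.
Qed.

Definition sstar (f : fsec) : fsec := fsec_of (cc_star (fsec_cc f)).

Lemma sstar_antilinear k f g : sstar (k *: f + g) = k^* *: sstar f + sstar g.
Proof. by apply: fsec_eq => t; exact: cstar_antilinear. Qed.

Lemma sstarD f g : sstar (f + g) = sstar f + sstar g.
Proof. by have := sstar_antilinear 1 f g; rewrite rmorph1 !scale1r. Qed.

Lemma sstar_dirac s (b : fiber B s) : sstar (sdirac b) = sdirac (fstar b).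
Proof.
apply: fsec_eq => t; rewrite [LHS]/= !val_dirac (can2_eq invgK invgK).
by case: eqP => // _; exact: cstar0.
Qed.

Section Integrated.
Variables (H : hilbertType R) (pi : representation B H).

Lemma rep_family (xi : H) : linear_family (fun s (b : fiber B s) => pi s b xi).
Proof. by move=> s k b c; exact: rep_linear. Qed.

Definition Tpi (f : fsec) (xi : H) : H := total (fun s b => pi s b xi) (\val f).

Lemma TpiP k f g xi : Tpi (k *: f + g) xi = k *: Tpi f xi + Tpi g xi.
Proof. by apply: total_linear; exact: rep_family. Qed.

Lemma TpiD f g xi : Tpi (f + g) xi = Tpi f xi + Tpi g xi.
Proof. by apply: totalD; exact: rep_family. Qed.

Lemma Tpi_dirac s (b : fiber B s) xi : Tpi (sdirac b) xi = pi s b xi.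
Proof. by apply: total_dirac; exact: rep_family. Qed.

Lemma Tpi_linear f : linear (Tpi f).
Proof.
elim/fsec_ind: f => [f g IHf IHg|s b] k xi eta.
  by rewrite !TpiD IHf IHg scalerDr addrACA.
by rewrite !Tpi_dirac; exact: (rep_bounded pi b).1.
Qed.

Lemma Tpi_trans s (b : fiber B s) x xi : Tpi (strans b x) xi = pi s b (Tpi x xi).
Proof.
elim/fsec_ind: x => [x y IHx IHy|t c].
  have -> : strans b (x + y) = strans b x + strans b y.
    by have := strans_linear b 1 x y; rewrite !scale1r.
  rewrite !TpiD IHx IHy.
  by have := (rep_bounded pi b).1 1 (Tpi x xi) (Tpi y xi); rewrite !scale1r.
by rewrite strans_dirac !Tpi_dirac rep_mul.
Qed.

Lemma Tpi_conv f g xi : Tpi (sconv f g) xi = Tpi f (Tpi g xi).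
Proof.
elim/fsec_ind: f => [f h IHf IHh|s b]; first by rewrite sconvDl !TpiD IHf IHh.
by rewrite sconv_dirac Tpi_trans Tpi_dirac.
Qed.

Lemma Tpi_star f xi eta : inner (Tpi f xi) eta = inner xi (Tpi (sstar f) eta).
Proof.
elim/fsec_ind: f => [f g IHf IHg|s b].
  by rewrite sstarD !TpiD linearDl/= linearDr/= IHf IHg.
by rewrite sstar_dirac !Tpi_dirac rep_star.
Qed.

End Integrated.
End Sections.

(** * The universal norm and the Fourier-Stieltjes norm *)

Section OperatorNorm.
Variables (R : realType) (V W : normedModType R[i]).
Implicit Types T : V -> W.

Lemma opnorm_le T (M : R) : 0 <= M -> (forall v, rnorm (T v) <= M * rnorm v) ->
  opnorm T <= M.
Proof.
move=> M0 TM; apply: ge_sup; first by exists (rnorm (T 0)), 0; rewrite //= rnorm0.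
move=> _ [v /= v1 <-]; apply: le_trans (TM v) _.
by rewrite ler_piMr.
Qed.

Lemma opnorm_has_sup T (M : R) : (forall v, rnorm (T v) <= M * rnorm v) -> 0 <= M ->
  has_sup [set rnorm (T v) | v in [set v | rnorm v <= 1]].
Proof.
move=> TM M0; split; first by exists (rnorm (T 0)), 0; rewrite //= rnorm0.
by exists M => _ [v /= v1 <-]; apply: le_trans (TM v) _; rewrite ler_piMr.
Qed.

Lemma opnorm_ge0 T (M : R) : (forall v, rnorm (T v) <= M * rnorm v) -> 0 <= M ->
  0 <= opnorm T.
Proof.
move=> TM M0; apply: le_trans (rnorm_ge0 (T 0)) _.
by apply: (ub_le_sup (opnorm_has_sup TM M0).2); exists 0 => //=; rewrite rnorm0.
Qed.

Lemma opnormP T (M : R) : (forall k v, T (k *: v) = k *: T v) ->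
  (forall v, rnorm (T v) <= M * rnorm v) -> 0 <= M ->
  forall v, rnorm (T v) <= opnorm T * rnorm v.
Proof.
move=> TZ TM M0 v; have [v0|v0] := eqVneq (rnorm v) 0.
  by have := TM v; rewrite v0 !mulr0.
have v1 : 0 < rnorm v by rewrite lt_neqAle eq_sym v0 rnorm_ge0.
rewrite -ler_pdivrMr//; apply: (ub_le_sup (opnorm_has_sup TM M0).2).
exists ((rnorm v)^-1%:C *: v).
  by rewrite /= rnormZr gtr0_norm ?invr_gt0// mulVf.
by rewrite TZ rnormZr gtr0_norm ?invr_gt0// mulrC.
Qed.

End OperatorNorm.

(** * Summable sections and the universal norm *)

Section L1.
Variables (R : realType) (G : groupType) (A : cstarType R) (B : fellBundle G A).
Implicit Types f : section B.

Definition l1bound f (M : R) :=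
  forall F : {fset G}, \sum_(s <- F) rnorm (\val (f s)) <= M.

Lemma l1P f : l1 f <-> exists M, l1bound f M.
Proof.
split=> [fl|[M fM]].
  have e0 : (0 <= \esum_(s in [set: G]) (rnorm (\val (f s)))%:E)%E.
    by apply: esum_ge0 => s _; rewrite lee_fin rnorm_ge0.
  exists (fine (\esum_(s in [set: G]) (rnorm (\val (f s)))%:E)) => F.
  rewrite -lee_fin fineK; last by rewrite ge0_fin_numE.
  rewrite -sumEFin; apply: esum_ge; exists [set` F].
    by split=> //; exact: finite_fset.
  by rewrite -fsbig_seq ?fset_uniq.
apply: (@le_lt_trans _ _ M%:E); last exact: ltry.
apply: ge_ereal_sup => _ [F [Ffin _] <-].
rewrite fsbig_finite//= sumEFin lee_fin; exact: fM.
Qed.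

Lemma l1bound_ge0 f M : l1bound f M -> 0 <= M.
Proof. by move=> /(_ fset0%fset); rewrite big_seq_fset0. Qed.

Lemma cc_l1 f : cc f -> l1 f.
Proof.
move=> ff; apply/l1P; pose S := fset_set [set s | f s != 0].
exists (\sum_(s <- S) rnorm (\val (f s))) => F.
have S0 s : s \notin S -> f s = 0 by exact: (@fsec_supp _ _ _ _ (fsec_of ff)).
have -> : \sum_(s <- F) rnorm (\val (f s)) = \sum_(s <- (F `&` S)%fset) rnorm (\val (f s)).
  rewrite (big_fsetID _ (mem S)) /= [X in _ + X]big1_seq ?addr0; last first.
    by move=> s; rewrite !inE /= => /andP[_ /S0->]; exact: rnorm0.
  by apply: eq_fbigl => s; rewrite !inE.
rewrite [X in _ <= X](big_fsetID _ (mem F)).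
have -> : [fset x | x in S & mem F x]%fset = (F `&` S)%fset.
  by apply/fsetP => s; rewrite !inE andbC.
by rewrite lerDl sumr_ge0// => s _; exact: rnorm_ge0.
Qed.

Section Representation.
Variables (H : hilbertType R) (pi : representation B H).

Lemma integrated_sums f xi : l1 f ->
  sums_to (fun s => pi s (f s) xi) (integrated pi f xi).
Proof.
move=> /l1P[M fM].
have [|l hl] := @abs_summable R G H (fun s => pi s (f s) xi) (M * rnorm xi).
  move=> F; apply: (@le_trans _ _ (\sum_(s <- F) rnorm (\val (f s)) * rnorm xi)).
    by apply: ler_sum => s _; exact: rep_le.
  by rewrite -mulr_suml ler_wpM2r ?rnorm_ge0.
by rewrite /integrated (sums_to_sum hl).
Qed.

Lemma integratedZ f k xi : l1 f -> integrated pi f (k *: xi) = k *: integrated pi f xi.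
Proof.
move=> fl; apply: sums_to_sum.
have -> : (fun s => pi s (f s) (k *: xi)) = (fun s => k *: pi s (f s) xi).
  apply/funext => s; have [h _] := rep_bounded pi (f s).
  have h0 : pi s (f s) 0 = 0.
    by apply: addr_idem; have := h 1 0 0; rewrite !scale1r addr0.
  by have := h k xi 0; rewrite h0 !addr0.
apply: (@sums_to_linear R G H H (fun v => k *: v) (cabs k)).
- by move=> l v w; rewrite scalerDr !scalerA mulrC.
- by move=> v; rewrite rnormZ.
- exact: integrated_sums.
Qed.

Lemma integrated_l1_le f M xi : l1bound f M -> rnorm (integrated pi f xi) <= M * rnorm xi.
Proof.
move=> fM; apply: (sums_to_le (integrated_sums xi _)); first by apply/l1P; exists M.
move=> F; apply: le_trans (rnorm_sum_le _ _) _.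
apply: (@le_trans _ _ (\sum_(s <- F) rnorm (\val (f s)) * rnorm xi)).
  by apply: ler_sum => s _; exact: rep_le.
by rewrite -mulr_suml ler_wpM2r ?rnorm_ge0.
Qed.

Lemma integrated_cc (f : fsec B) xi : integrated pi (\val f) xi = Tpi pi f xi.
Proof.
apply: sums_to_sum.
have S0 := @fsec_supp _ _ _ _ f.
rewrite /Tpi (totalE (rep_family pi xi) S0); apply: sums_to_finite => s /S0 ->.
exact: (linear_family0 (rep_family pi xi)).
Qed.

End Representation.

Lemma star_norm_ub f : l1 f -> has_ubound [set r | exists (H : hilbertType R)
  (pi : representation B H), r = opnorm (integrated pi f)].
Proof.
move=> /l1P[M fM]; exists M => _ [H' [pi' ->]].
apply: opnorm_le; first exact: l1bound_ge0 fM.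
by move=> v; exact: integrated_l1_le.
Qed.

Lemma star_normP f (H : hilbertType R) (pi : representation B H) xi : l1 f ->
  rnorm (integrated pi f xi) <= star_norm f * rnorm xi.
Proof.
move=> fl; have /l1P[M fM] := fl.
apply: (@le_trans _ _ (opnorm (integrated pi f) * rnorm xi)).
  apply: (@opnormP _ _ _ _ M); last exact: l1bound_ge0 fM.
    by move=> k v; exact: integratedZ.
  by move=> v; exact: integrated_l1_le.
rewrite ler_wpM2r ?rnorm_ge0//; apply: (ub_le_sup (star_norm_ub fl)).
by exists H, pi.
Qed.

Lemma star_norm_le f (M : R) : 0 <= M ->
  (forall (H : hilbertType R) (pi : representation B H) xi,
     rnorm (integrated pi f xi) <= M * rnorm xi) -> star_norm f <= M.
Proof.
move=> M0 fM; rewrite /star_norm; set S := [set r | _].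
have [S0|S0] := pselect (S !=set0).
  by apply: ge_sup => // _ [H [pi ->]]; exact: opnorm_le.
(* The supremum of the empty set is 0 by convention, so no representation has to be exhibited. *)
by rewrite sup_out// => -[].
Qed.

Lemma star_norm_ge0 f : l1 f -> 0 <= star_norm f.
Proof.
move=> fl; rewrite /star_norm; set S := [set r | _].
have [[r Sr]|S0] := pselect (S !=set0); last by rewrite sup_out// => -[].
have /l1P[M fM] := fl.
apply: (@le_trans _ _ r); last exact: (ub_le_sup (star_norm_ub fl)).
case: Sr => H [pi ->]; apply: (@opnorm_ge0 _ _ _ _ M); last exact: l1bound_ge0 fM.
by move=> v; exact: integrated_l1_le.
Qed.

Definition snorm (f : fsec B) : R := star_norm (\val f).

Lemma snormP (f : fsec B) (H : hilbertType R) (pi : representation B H) xi :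
  rnorm (Tpi pi f xi) <= snorm f * rnorm xi.
Proof. by rewrite -integrated_cc; apply/star_normP/cc_l1/fsec_cc. Qed.

Lemma snorm_ge0 (f : fsec B) : 0 <= snorm f.
Proof. exact/star_norm_ge0/cc_l1/fsec_cc. Qed.

Lemma snorm_le (f : fsec B) (M : R) : 0 <= M ->
  (forall (H : hilbertType R) (pi : representation B H) xi,
     rnorm (Tpi pi f xi) <= M * rnorm xi) -> snorm f <= M.
Proof.
by move=> M0 fM; apply: star_norm_le => // H pi xi; rewrite integrated_cc.
Qed.

End L1.

(** * Coefficients as functionals on sections *)

Section Coefficients.
Variables (R : realType) (G : groupType) (A : cstarType R) (B : fellBundle G A).

Definition pairing (u : functional_family B) (f : section B) : R[i] :=
  summability.sum (fun s => u s (f s) : R[i]^o).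

Section Representation.
Variables (H : hilbertType R) (pi : representation B H) (xi eta : H).

Lemma inner_linear : linear (fun v : H => inner v eta : R[i]^o).
Proof. by move=> k v w; exact: innerP. Qed.

Lemma pairing_coefficient f : l1 f ->
  pairing (coefficient pi xi eta) f = inner (integrated pi f xi) eta.
Proof.
move=> fl; apply: (@sums_to_sum R G R[i]^o).
apply: (@sums_to_linear R G H R[i]^o (fun v => inner v eta) (rnorm eta)
  (fun s => pi s (f s) xi)).
- exact: inner_linear.
- by move=> v; rewrite mulrC; exact: inner_le.
- exact: integrated_sums.
Qed.

Lemma pairing_coefficient_le f : l1 f ->
  cabs (pairing (coefficient pi xi eta) f) <= rnorm xi * rnorm eta * star_norm f.
Proof.
move=> fl; rewrite pairing_coefficient//; apply: le_trans (inner_le _ _) _.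
by rewrite mulrAC ler_wpM2r ?rnorm_ge0// mulrC star_normP.
Qed.

Lemma coefficient_family :
  linear_family (W := R[i]^o) (coefficient pi xi eta : forall s, fiber B s -> R[i]^o).
Proof. by move=> s k b c; rewrite /coefficient rep_linear innerP. Qed.

End Representation.

Lemma FS_space_family (u : functional_family B) : FS_space u ->
  linear_family (W := R[i]^o) (u : forall s, fiber B s -> R[i]^o).
Proof. by move=> [H [pi [xi [eta ->]]]]; exact: coefficient_family. Qed.

Lemma pairing_total (u : functional_family B) (f : fsec B) :
  linear_family (W := R[i]^o) (u : forall s, fiber B s -> R[i]^o) ->
  pairing u (\val f) = total (W := R[i]^o) u (\val f).
Proof.
move=> ul; apply: (@sums_to_sum R G R[i]^o); have S0 := @fsec_supp _ _ _ _ f.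
rewrite (totalE ul S0); apply: sums_to_finite => s /S0 ->.
exact: (linear_family0 ul).
Qed.

Lemma FS_norm_has_sup (u : functional_family B) : FS_space u -> has_sup
  [set rnorm (summability.sum (fun s => u s (f s) : R[i]^o)) |
     f in [set f | l1 f /\ star_norm f <= 1]].
Proof.
move=> [H [pi [xi [eta ->]]]]; split.
  exists (cabs (pairing (coefficient pi xi eta) (\val (0 : fsec B)))), (\val (0 : fsec B)) => //.
  split; first exact/cc_l1/fsec_cc.
  apply: snorm_le => // K rho v.
  have -> : Tpi rho 0 v = 0.
    by have := TpiD rho 0 0 v; rewrite addr0 => /addr_idem.
  by rewrite rnorm0 mul1r rnorm_ge0.
exists (rnorm xi * rnorm eta) => _ [f [fl f1] <-].
apply: le_trans (pairing_coefficient_le _ _ _ fl) _.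
by rewrite ler_piMr// mulr_ge0 ?rnorm_ge0.
Qed.

Lemma FS_norm_le_coefficient (H : hilbertType R) (pi : representation B H) xi eta :
  FS_norm (coefficient pi xi eta) <= rnorm xi * rnorm eta.
Proof.
have FS : FS_space (coefficient pi xi eta) by exists H, pi, xi, eta.
apply: ge_sup (FS_norm_has_sup FS).1 _ => _ [f [fl f1] <-].
apply: le_trans (pairing_coefficient_le _ _ _ fl) _.
by rewrite ler_piMr// mulr_ge0 ?rnorm_ge0.
Qed.

Lemma snormZ_le k (f : fsec B) : snorm (k *: f) <= cabs k * snorm f.
Proof.
apply: snorm_le => [|H pi xi]; first by rewrite mulr_ge0 ?cabs_ge0 ?snorm_ge0.
have -> : Tpi pi (k *: f) xi = k *: Tpi pi f xi.
  have T0 : Tpi pi 0 xi = 0 by have := TpiD pi 0 0 xi; rewrite addr0 => /addr_idem.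
  by have := TpiP pi k f 0 xi; rewrite T0 !addr0.
by rewrite rnormZ -mulrA ler_wpM2l ?cabs_ge0// snormP.
Qed.

Lemma FS_norm_ge0 (u : functional_family B) : FS_space u -> 0 <= FS_norm u.
Proof.
move=> /FS_norm_has_sup uS; have [r ur] := uS.1.
apply: (@le_trans _ _ r); last exact: (ub_le_sup uS.2).
by case: ur => f _ <-; exact: rnorm_ge0.
Qed.

Lemma FS_normP (u : functional_family B) (f : fsec B) : FS_space u ->
  cabs (total (W := R[i]^o) u (\val f)) <= FS_norm u * snorm f.
Proof.
move=> uFS; have ul := FS_space_family uFS.
(* A section of norm zero cannot be normalised; the bound |xi| |eta| [snorm f] settles this case. *)
have [f0|f0] := eqVneq (snorm f) 0.
  case: uFS ul => H [pi [xi [eta ->]]] ul; rewrite -pairing_total//.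
  apply: le_trans (pairing_coefficient_le _ _ _ (cc_l1 (fsec_cc f))) _.
  by rewrite -[star_norm _]/(snorm f) f0 !mulr0.
have f1 : 0 < snorm f by rewrite lt_neqAle eq_sym f0 snorm_ge0.
rewrite -ler_pdivrMr//; apply: (ub_le_sup (FS_norm_has_sup uFS).2).
exists (\val ((snorm f)^-1%:C *: f)).
  split; first exact/cc_l1/fsec_cc.
  apply: le_trans (snormZ_le _ _) _.
  by rewrite cabs_real gtr0_norm ?invr_gt0// mulVf.
rewrite -[rnorm _]/(cabs (pairing u _)) pairing_total//.
have -> : total (W := R[i]^o) u (\val ((snorm f)^-1%:C *: f)) =
          (snorm f)^-1%:C * total (W := R[i]^o) u (\val f).
  have := total_linear ul (snorm f)^-1%:C f 0.
  have -> : total (W := R[i]^o) u (\val (0 : fsec B)) = 0.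
    by have := totalD ul 0 0; rewrite addr0 => /addr_idem.
  by rewrite !addr0.
by rewrite cabsM cabs_real gtr0_norm ?invr_gt0// mulrC.
Qed.

End Coefficients.

(** * Representability of bounded families *)

Lemma rkhs_intro (R : realType) (V : lmodType R[i]) (q : psdform V) (g : V -> R[i]) (M : R) :
  (forall k x y, g (k *: x + y) = k^* * g x + g y) -> rkbound q g M ->
  exists xi : rkhs q, rkv xi = g /\ rnorm xi <= M.
Proof.
move=> gP gM.
have gset : (g : V -> R[i]^o) \in rkset q by apply/mem_set; split=> //; exists M.
exists (Sub (g : V -> R[i]^o) gset : rkhs q).
by split; [|rewrite rnorm_rkhs; exact: rkn_le].
Qed.

Section Representability.
Variables (R : realType) (G : groupType) (A : cstarType R) (B : fellBundle G A).

Section Diagonal.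
Variables (H : hilbertType R) (pi : representation B H).
Implicit Types (h x y : fsec B) (xi eta : H).

Definition tdiag h xi : R[i] := inner (Tpi pi h xi) xi.

Lemma tdiagP k h h' xi : tdiag (k *: h + h') xi = k * tdiag h xi + tdiag h' xi.
Proof. by rewrite /tdiag TpiP innerP. Qed.

Lemma tdiag0 xi : tdiag 0 xi = 0.
Proof. by apply: addr_idem; have := tdiagP 1 0 0 xi; rewrite scaler0 addr0 mul1r. Qed.

Lemma tdiagZ k h xi : tdiag (k *: h) xi = k * tdiag h xi.
Proof. by rewrite -[k *: h]addr0 tdiagP tdiag0 addr0. Qed.

Lemma tdiagD h h' xi : tdiag (h + h') xi = tdiag h xi + tdiag h' xi.
Proof. by rewrite -{1}[h]scale1r tdiagP mul1r. Qed.

Lemma tdiagN h xi : tdiag (- h) xi = - tdiag h xi.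
Proof. by rewrite -scaleN1r tdiagZ mulN1r. Qed.

Lemma Tpi_starr f xi eta : inner (Tpi pi (sstar f) xi) eta = inner xi (Tpi pi f eta).
Proof. by rewrite innerJ -Tpi_star -innerJ. Qed.

Lemma tdiag_star h xi : tdiag (sstar h) xi = (tdiag h xi)^*.
Proof. by rewrite /tdiag Tpi_starr -innerJ. Qed.

Lemma tdiag_gram y x xi :
  tdiag (sconv (sstar y) x) xi = inner (Tpi pi x xi) (Tpi pi y xi).
Proof. by rewrite /tdiag Tpi_conv Tpi_starr. Qed.

Lemma tdiag_le h xi : complex.Re (tdiag h xi) <= snorm h * rnorm xi ^+ 2.
Proof.
apply: le_trans (Re_le _) _; apply: le_trans (inner_le _ _) _.
by rewrite expr2 mulrA ler_wpM2r ?rnorm_ge0// snormP.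
Qed.

Lemma Tpi0 xi : Tpi pi 0 xi = 0.
Proof. by have := TpiD pi 0 0 xi; rewrite addr0 => /addr_idem. Qed.

Lemma TpiZ k h xi : Tpi pi (k *: h) xi = k *: Tpi pi h xi.
Proof. by rewrite -[k *: h]addr0 TpiP Tpi0 addr0. Qed.

End Diagonal.

(* The largest spectral value of the real part of [h], or 0 when it is negative,
   over all representations. *)
Definition pvalset (h : fsec B) : set R := [set M | 0 <= M /\
  forall (H : hilbertType R) (pi : representation B H) xi,
    complex.Re (tdiag pi h xi) <= M * rnorm xi ^+ 2].

Definition pval (h : fsec B) : R := inf (pvalset h).

Lemma pval_has_inf h : has_inf (pvalset h).
Proof.
split; last by exists 0 => M [].
by exists (snorm h); split=> [|H pi xi]; [exact: snorm_ge0|exact: tdiag_le].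
Qed.

Lemma pval_ge0 h : 0 <= pval h.
Proof. by apply: lb_le_inf (pval_has_inf h).1 _ => M []. Qed.

Lemma pval_le h M : pvalset h M -> pval h <= M.
Proof. by move=> hM; apply: ge_inf => //; exact: (pval_has_inf h).2. Qed.

Lemma pvalP h (H : hilbertType R) (pi : representation B H) xi :
  complex.Re (tdiag pi h xi) <= pval h * rnorm xi ^+ 2.
Proof.
have [x0|x0] := eqVneq (rnorm xi ^+ 2) 0.
  by have := tdiag_le pi h xi; rewrite x0 !mulr0.
have x1 : 0 < rnorm xi ^+ 2 by rewrite lt_neqAle eq_sym x0 sqr_ge0.
rewrite -ler_pdivrMr//; apply: lb_le_inf (pval_has_inf h).1 _ => M [_ hM].
by rewrite ler_pdivrMr.
Qed.

Lemma pval_sublinear : sublinear pval.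
Proof.
split=> [x y|t x t_ge0].
  apply: pval_le; split=> [|H pi xi]; first by rewrite addr_ge0 ?pval_ge0.
  by rewrite tdiagD ReD mulrDl lerD// pvalP.
have le (s : R) y : 0 <= s -> pval (s%:C *: y) <= s * pval y.
  move=> s0; apply: pval_le; split=> [|H pi xi]; first by rewrite mulr_ge0 ?pval_ge0.
  by rewrite tdiagZ ReM_real -mulrA ler_wpM2l// pvalP.
apply/le_anti; rewrite le//=.
have [->|tn0] := eqVneq t 0; first by rewrite mul0r pval_ge0.
have {tn0} t0 : 0 < t by rewrite lt_neqAle eq_sym tn0.
rewrite -ler_pdivlMl//.
have {1}-> : x = t^-1%:C *: (t%:C *: x).
  by rewrite scalerA -rmorphM mulVf ?lt0r_neq0// rmorph1 scale1r.
by apply: le; rewrite invr_ge0 ltW.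
Qed.

Variables (u : functional_family B) (M : R).
Hypothesis u_lin : linear_family (W := R[i]^o) (u : forall s, fiber B s -> R[i]^o).
Hypothesis M0 : 0 <= M.

Definition pair_with (f : fsec B) : R[i] := total (W := R[i]^o) u (\val f).

Local Notation uf := pair_with.

Hypothesis uM : forall f, cabs (uf f) <= M * snorm f.

Lemma pair_withP k f g : uf (k *: f + g) = k * uf f + uf g.
Proof. exact: (total_linear u_lin). Qed.

Lemma pair_with0 : uf 0 = 0.
Proof. by apply: addr_idem; have := pair_withP 1 0 0; rewrite scaler0 addr0 mul1r. Qed.

Lemma pair_withZ k f : uf (k *: f) = k * uf f.
Proof. by rewrite -[k *: f]addr0 pair_withP pair_with0 addr0. Qed.

Lemma pair_withD f g : uf (f + g) = uf f + uf g.
Proof. by rewrite -{1}[f]scale1r pair_withP mul1r. Qed.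

(* The condition says that [M^2 T(x)^* T(x) <= s (T(z.1) + m)] in every
   representation. It is stable under sums by the Cauchy-Schwarz inequality, and
   it gives lower bounds for a functional dominated by [pval]. *)
Definition bcone : set (fsec B * R) := [set z | exists s m x,
  [/\ 0 <= s, 0 <= m, z.2 = s - m, uf x = s%:C &
      forall (H : hilbertType R) (pi : representation B H) xi,
        let a := complex.Re (tdiag pi z.1 xi) + m * rnorm xi ^+ 2 in
        0 <= a /\ (M * rnorm (Tpi pi x xi)) ^+ 2 <= s * a]].

(** The cross term 2 x y is at most twice the square root of (a c)(b d), hence at most a d + b c by
    the inequality of means. *)
Lemma sqr_sum_le (a b c d x y : R) : 0 <= a -> 0 <= b -> 0 <= c -> 0 <= d ->
  0 <= x -> 0 <= y -> x ^+ 2 <= a * c -> y ^+ 2 <= b * d ->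
  (x + y) ^+ 2 <= (a + b) * (c + d).
Proof.
move=> a0 b0 c0 d0 x0 y0 xac ybd.
have : 2 * (x * y) <= a * d + b * c.
  rewrite -(@ler_pXn2r _ 2) ?nnegrE ?addr_ge0 ?mulr_ge0//.
  have : (x * y) ^+ 2 <= (a * c) * (b * d) by rewrite exprMn ler_pM ?sqr_ge0.
  by have := sqr_ge0 (a * d - b * c); nra.
nra.
Qed.

Lemma bcone0 : bcone (0, 0).
Proof.
exists 0, 0, 0; split=> //; rewrite ?subr0 ?pair_with0// => H pi xi /=.
by rewrite tdiag0 Tpi0 rnorm0 /= !mul0r mulr0 addr0 expr0n.
Qed.

Lemma bconeD z w : bcone z -> bcone w -> bcone (z.1 + w.1, z.2 + w.2).
Proof.
move=> [s [m [x [s0 m0 zE ux h]]]] [s' [m' [x' [s0' m0' wE ux' h']]]].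
exists (s + s'), (m + m'), (x + x'); split; rewrite ?addr_ge0//=.
- by rewrite zE wE; ring.
- by rewrite pair_withD ux ux' rmorphD.
- move=> H pi xi; have [a0 ha] := h H pi xi; have [a0' ha'] := h' H pi xi.
  rewrite tdiagD ReD mulrDl addrACA; split; first exact: addr_ge0.
  have := sqr_sum_le s0 s0' a0 a0' (mulr_ge0 M0 (rnorm_ge0 _)) (mulr_ge0 M0 (rnorm_ge0 _))
    ha ha'.
  apply: le_trans; rewrite -mulrDr TpiD.
  rewrite ler_pXn2r ?nnegrE ?mulr_ge0 ?addr_ge0 ?rnorm_ge0//.
  by rewrite ler_wpM2l// rnormD.
Qed.

Lemma bconeZ (t : R) z : 0 <= t -> bcone z -> bcone (t%:C *: z.1, t * z.2).
Proof.
move=> t0 [s [m [x [s0 m0 zE ux h]]]].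
exists (t * s), (t * m), (t%:C *: x); split; rewrite ?mulr_ge0//=.
- by rewrite zE mulrBr.
- by rewrite pair_withZ ux rmorphM.
- move=> H pi xi; have [a0 ha] := h H pi xi.
  rewrite tdiagZ ReM_real -mulrA -mulrDr; split; first exact: mulr_ge0.
  rewrite TpiZ rnormZr (ger0_norm t0) mulrCA exprMn.
  by rewrite (mulrACA t s) -expr2 ler_wpM2l// sqr_ge0.
Qed.

(** With p = [pval z.1], the operator inequality gives M |x|_* <= sqrt (s (p + m)), while s = u(x)
    <= M |x|_* by hypothesis on [u]. Hence s^2 <= s (p + m), that is, s - m <= p. This is the only
    place where the bound on [u] enters. *)
Lemma bcone_le z : bcone z -> z.2 <= pval z.1.
Proof.
move=> [s [m [x [s0 m0 zE ux h]]]]; rewrite zE lerBlDr.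
have pm0 : 0 <= pval z.1 + m by rewrite addr_ge0 ?pval_ge0.
have s_le : s <= M * snorm x.
  by have := uM x; rewrite ux cabs_real ger0_norm.
have [|Mp] := eqVneq M 0; first by move=> M00; move: s_le; rewrite M00 mul0r; lra.
have M1 : 0 < M by rewrite lt_neqAle eq_sym Mp.
have snx : snorm x <= M^-1 * Num.sqrt (s * (pval z.1 + m)).
  apply: snorm_le => [|H pi xi]; first by rewrite mulr_ge0 ?sqrtr_ge0// invr_ge0.
  rewrite -mulrA ler_pdivlMl//.
  rewrite -(@ler_pXn2r _ 2) ?nnegrE ?mulr_ge0 ?rnorm_ge0 ?sqrtr_ge0//.
  rewrite (exprMn _ (Num.sqrt _)) sqr_sqrtr ?mulr_ge0// -mulrA.
  apply: le_trans (h H pi xi).2 _; rewrite ler_wpM2l// mulrDl lerD2r.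
  exact: pvalP.
have : s ^+ 2 <= s * (pval z.1 + m).
  rewrite -[X in _ <= X](sqr_sqrtr (mulr_ge0 s0 pm0)) ler_pXn2r ?nnegrE ?sqrtr_ge0//.
  by apply: le_trans s_le _; rewrite -ler_pdivlMl.
have [->//|sn0] := eqVneq s 0.
by rewrite expr2 ler_pM2l// lt_neqAle eq_sym sn0.
Qed.

(** The witness is [a] multiplied by the conjugate of u(a), on which [u] takes the real value s =
    |u(a)|^2; both sides of the operator inequality are then equal. The resulting lower bound is
    what makes [u] a vector of the GNS space. *)
Lemma bcone_square (a : fsec B) :
  bcone ((M ^+ 2)%:C *: sconv (sstar a) a, cabs (uf a) ^+ 2).
Proof.
exists (cabs (uf a) ^+ 2), 0, ((uf a)^* *: a); split=> //=.
- exact: sqr_ge0.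
- by rewrite subr0.
- by rewrite pair_withZ mulrC -sqr_cabsC.
- move=> H pi xi; rewrite tdiagZ ReM_real tdiag_gram mul0r addr0 -/(psq (inner_form H) _).
  rewrite psq_inner; split; first by rewrite mulr_ge0 ?sqr_ge0.
  by rewrite TpiZ rnormZ cabsJ !exprMn mulrCA.
Qed.

Lemma bcone_gram (a : fsec B) : bcone (sconv (sstar a) a, 0).
Proof.
exists 0, 0, 0; split=> //=; rewrite ?subr0 ?pair_with0// => H pi xi.
rewrite tdiag_gram mul0r addr0 -/(psq (inner_form H) _) psq_inner Tpi0 rnorm0 mulr0 mul0r.
by rewrite expr0n sqr_ge0.
Qed.

(** In every representation the section plus |l|^2 is the square of T(v) + l, hence positive; so it
    is bounded below by - |l|^2. *)
Lemma bcone_complete_square (v : fsec B) (l : R[i]) :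
  bcone (sconv (sstar v) v + l^* *: v + l *: sstar v, - (cabs l ^+ 2)).
Proof.
exists 0, (cabs l ^+ 2), 0; split=> //=; rewrite ?sqr_ge0 ?sub0r ?pair_with0// => H pi xi.
rewrite Tpi0 rnorm0 mulr0 mul0r expr0n; split=> //.
rewrite !tdiagD !tdiagZ tdiag_star tdiag_gram !ReD.
have -> : complex.Re (l * (tdiag pi v xi)^*) = complex.Re (l^* * tdiag pi v xi).
  by rewrite -ReJ rmorphM/= conjCK.
have := psq_ge0 (inner_form H) (Tpi pi v xi + 1%:C *: (l *: xi)).
rewrite psqDZ pformZr psqZ !psq_inner -[inner_form H _ _]/(tdiag pi v xi).
rewrite -[complex.Re (inner _ _)]/(psq (inner_form H) (Tpi pi v xi)) psq_inner.
by rewrite mulr1 expr1n mul1r; lra.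
Qed.

Theorem representable : exists (H : hilbertType R) (pi : representation B H) (xi eta : H),
  u = coefficient pi xi eta /\ rnorm xi * rnorm eta <= M.
Proof.
have [f [flin fp fK]] :=
  hahn_banach_cone pval_sublinear bcone0 bconeD bconeZ bcone_le.
(* [pval] sees a section only through the real parts of its diagonal values, so [f] vanishes where
   these do, and [F] depends only on the images of a section in representations. Algebraic
   identities under [F] are therefore checked there ([F_ext]). *)
have f_ext h : (forall (H : hilbertType R) (pi : representation B H) xi,
    complex.Re (tdiag pi h xi) = 0) -> f h = 0.
  have f_le g : (forall (H : hilbertType R) (pi : representation B H) xi,
      complex.Re (tdiag pi g xi) = 0) -> f g <= 0.
    move=> g0; apply: le_trans (fp g) _; apply: pval_le; split=> // H pi xi.
    by rewrite g0 mul0r.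
  move=> h0; apply/le_anti; rewrite f_le//= -oppr_le0 -(real_linearN _ flin) f_le//.
  by move=> H pi xi; rewrite tdiagN ReN h0 oppr0.
pose F := complexify f; have FP : scalar F := complexify_scalar flin.
have F0 : F 0 = 0 by apply: addr_idem; have := FP 1 0 0; rewrite scaler0 addr0 mul1r.
have FZ k h : F (k *: h) = k * F h by have := FP k h 0; rewrite F0 !addr0.
have FD h h' : F (h + h') = F h + F h' by have := FP 1 h h'; rewrite scale1r mul1r.
have F_ext h h' : (forall (H : hilbertType R) (pi : representation B H) xi,
    tdiag pi h xi = tdiag pi h' xi) -> F h = F h'.
  move=> hh'; apply/eqP; rewrite -subr_eq0 -mulN1r -FZ scaleN1r -FD; apply/eqP.
  have d0 (H : hilbertType R) (pi : representation B H) xi : tdiag pi (h - h') xi = 0.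
    by rewrite tdiagD tdiagN hh' subrr.
  apply: complex_eqP => /=; first by apply: f_ext => H pi xi; rewrite d0.
  by rewrite f_ext ?oppr0// => H pi xi; rewrite tdiagZ d0 mulr0.
have FJ h : F (sstar h) = (F h)^*.
  apply: complex_eqP => /=.
    apply/eqP; rewrite -subr_eq0 -(real_linearN _ flin) -flin.1; apply/eqP.
    apply: f_ext => H pi xi; rewrite tdiagD tdiagN tdiag_star ReD ReN ReJ; exact: subrr.
  apply/eqP; rewrite eqr_opp -subr_eq0 opprK -flin.1; apply/eqP.
  apply: f_ext => H pi xi; rewrite tdiagD !tdiagZ tdiag_star.
  by case: (tdiag pi h xi) => x y /=; ring.
pose q0 x y := F (sconv (sstar y) x).
have qP y k x x' : q0 (k *: x + x') y = k * q0 x y + q0 x' y.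
  rewrite /q0 -FP; apply: F_ext => H pi xi.
  by rewrite tdiagP !tdiag_gram TpiP innerP.
have qJ x y : q0 y x = (q0 x y)^*.
  rewrite /q0 -FJ; apply: F_ext => H pi xi.
  by rewrite tdiag_star !tdiag_gram -innerJ.
have q_ge0 x : 0 <= q0 x x.
  have Im0 : complex.Im (q0 x x) = 0.
    by have := qJ x x; case: (q0 x x) => a b [] /= ; lra.
  have -> : q0 x x = (f (sconv (sstar x) x))%:C by exact: complex_eqP.
  by rewrite ler0c; exact: (fK _ (bcone_gram x)).
pose q := @Psdform R _ q0 qP qJ q_ge0.
have qRe x : psq q x = f (sconv (sstar x) x) by [].
have qadj s (b : fiber B s) x y : q (strans b x) y = q x (strans (fstar b) y).
  apply: F_ext => H pi xi; rewrite !tdiag_gram !Tpi_trans; exact: rep_star.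
pose L := @StarAction R G A B _ q (@strans R G A B) (@strans_linear R G A B)
  (@strans_linearl R G A B) (@strans_mul R G A B) qadj.
(* The lower bound at the completed square reads 0 <= F(v^* v) + 2 t |F(v)| + t^2 for all real [t];
   its discriminant gives |F(v)|^2 <= F(v^* v). *)
have xi_bound : rkbound q (fun v => (F v)^*) 1.
  split=> // v; rewrite mul1r cabsJ.
  rewrite -(@ler_pXn2r _ 2) ?nnegrE ?cabs_ge0 ?psn_ge0// sqr_psn -[psq q v]mulr1.
  have [w [w1 wv]] := cabs_phase (F v).
  apply: quadratic_disc => // t.
  have := fK _ (bcone_complete_square v ((t%:C * w)^*)).
  rewrite /= !flin.1 conjCK cabsJ cabsM w1 mulr1 cabs_real real_normK ?num_real//.
  have fRe h : f h = complex.Re (F h) by [].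
  have F1 : f ((t%:C * w) *: v) = t * cabs (F v).
    by rewrite fRe FZ -mulrA wv ReM_real.
  have F2 : f ((t%:C * w)^* *: sstar v) = t * cabs (F v).
    by rewrite fRe FZ FJ -rmorphM/= ReJ -mulrA wv ReM_real.
  by rewrite F1 F2 qRe; lra.
have eta_bound : rkbound q (fun v => (uf v)^*) M.
  split=> // v; rewrite cabsJ.
  rewrite -(@ler_pXn2r _ 2) ?nnegrE ?cabs_ge0 ?mulr_ge0 ?psn_ge0//.
  rewrite exprMn sqr_psn qRe -flin.2; exact: (fK _ (bcone_square v)).
have [|xi [xiE xi1]] := rkhs_intro _ xi_bound.
  by move=> k x y; rewrite FP rmorphD rmorphM.
have [|eta [etaE etaM]] := rkhs_intro _ eta_bound.
  by move=> k x y; rewrite pair_withP rmorphD rmorphM.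
exists (rkhs q), (gns_rep L), xi, eta; split.
  apply: functional_extensionality_dep => s; apply/funext => b.
  (* Applied to [xi], the operator of [b] gives the class of [sdirac b], whose inner product with
     [eta] is the value of [u] at [b]. *)
  rewrite (@gns_coefficient _ _ _ _ _ _ _ xi eta s b (sdirac b)).
    by rewrite etaE conjCK /uf total_dirac.
  move=> v; rewrite xiE -FJ.
  apply: F_ext => H pi z.
  by rewrite tdiag_star tdiag_gram /tdiag Tpi_trans Tpi_dirac -innerJ rep_star.
apply: le_trans (ler_pM (rnorm_ge0 _) (rnorm_ge0 _) xi1 etaM) _.
by rewrite mul1r.
Qed.

End Representability.

(** * The cross sectional algebra and its dual *)

Lemma continuous_linear_bound (R : realType) (V W : normedModType R[i]) (f : V -> W) :
  linear f -> continuous f ->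
  exists2 M : R, 0 <= M & forall v, rnorm (f v) <= M * rnorm v.
Proof.
move=> fl fc.
have f0 : f 0 = 0 by apply: addr_idem; have := fl 1 0 0; rewrite !scale1r addr0.
have fZ k v : f (k *: v) = k *: f v by have := fl k v 0; rewrite f0 !addr0.
have /cvgrPdist_le/(_ 1 ltr01)/nbhs_ballP[e /= e0 eB] := fc 0.
have eE : e = (complex.Re e)%:C by apply: cge0_real; exact: ltW.
have d0 : 0 < complex.Re e by move: e0; rewrite {1}eE ltcR.
move: (complex.Re e) eE d0 => d eE d0.
exists (2 / d) => [|v]; first by rewrite divr_ge0 ?(ltW d0).
have [v0|v0] := eqVneq (rnorm v) 0; first by rewrite (rnorm_eq0 v0) f0 !rnorm0 mulr0.
have v1 : 0 < rnorm v by rewrite lt_neqAle eq_sym v0 rnorm_ge0.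
have t0 : 0 < d / 2 / rnorm v by rewrite !divr_gt0.
have := eB ((d / 2 / rnorm v)%:C *: v).
rewrite -ball_normE/= sub0r rnormE eE ltcR rnormN rnormZr (gtr0_norm t0) mulfVK//.
rewrite f0 sub0r fZ rnormE lecR rnormN rnormZr (gtr0_norm t0).
have dd : d / 2 < d by lra.
move=> /(_ dd); rewrite mulrAC ler_pdivrMr// mul1r => h.
have -> : 2 / d * rnorm v = rnorm v / (d / 2) by field; exact: lt0r_neq0.
by rewrite ler_pdivlMr ?divr_gt0// mulrC.
Qed.

(** * The Fourier-Stieltjes space as the space of bounded families *)

Section FourierStieltjes.
Variables (R : realType) (G : groupType) (A : cstarType R) (B : fellBundle G A).
Implicit Types u v : functional_family B.

Local Notation lin u := (linear_family (W := R[i]^o) (u : forall s, fiber B s -> R[i]^o)).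

(** [FS_norm] is a supremum over [l1], whereas the hypothesis tests finitely supported sections
    only. The gap is closed by representing [u] with vectors whose norms have product at most
    [M]. *)
Lemma FS_norm_le u (M : R) : FS_space u -> 0 <= M ->
  (forall f, cabs (pair_with u f) <= M * snorm f) -> FS_norm u <= M.
Proof.
move=> uFS M0 uM.
have [H [pi [xi [eta [-> le]]]]] := representable (FS_space_family uFS) M0 uM.
exact: le_trans (FS_norm_le_coefficient _ _ _) le.
Qed.

Lemma bounded_FS_space u (M : R) : lin u -> 0 <= M ->
  (forall f, cabs (pair_with u f) <= M * snorm f) -> FS_space u.
Proof.
move=> ul M0 uM; have [H [pi [xi [eta [-> le]]]]] := representable ul M0 uM.
by exists H, pi, xi, eta.
Qed.

Lemma FS_attained u : FS_space u -> exists (H : hilbertType R) (pi : representation B H)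
  (xi eta : H), u = coefficient pi xi eta /\ FS_norm u = rnorm xi * rnorm eta.
Proof.
move=> uFS.
have [H [pi [xi [eta [uE le]]]]] :=
  representable (FS_space_family uFS) (FS_norm_ge0 uFS) (fun f => FS_normP f uFS).
exists H, pi, xi, eta; split=> //; apply/le_anti; rewrite le andbT uE.
exact: FS_norm_le_coefficient.
Qed.

Lemma FS_norm_inf u : FS_space u ->
  FS_norm u = inf [set r | exists (H : hilbertType R) (pi : representation B H)
    (xi eta : H), u = coefficient pi xi eta /\ r = rnorm xi * rnorm eta].
Proof.
move=> /FS_attained[H [pi [xi [eta [uE uN]]]]]; apply/le_anti/andP; split.
  apply: lb_le_inf; first by exists (FS_norm u), H, pi, xi, eta.
  by move=> _ [H' [pi' [xi' [eta' [-> ->]]]]]; exact: FS_norm_le_coefficient.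
apply: ge_inf; last by exists H, pi, xi, eta.
by exists 0 => _ [H' [pi' [xi' [eta' [_ ->]]]]]; rewrite mulr_ge0 ?rnorm_ge0.
Qed.

Lemma pair_with_comb k u v f : lin u -> lin v ->
  pair_with (fun s b => k * u s b + v s b) f = k * pair_with u f + pair_with v f.
Proof.
move=> ul vl; have S0 := @fsec_supp _ _ _ _ f.
have wl : lin (fun s b => k * u s b + v s b).
  move=> s l b c; rewrite ul vl -![_ *: _]/(_ * _); ring.
rewrite /pair_with (totalE ul S0) (totalE vl S0) (totalE wl S0).
by rewrite mulr_sumr -big_split.
Qed.

(** Membership amounts to boundedness for the universal norm, which is stable under linear
    combinations; this takes the place of direct sums of representations. *)
Lemma FS_space_comb k u v : FS_space u -> FS_space v ->
  FS_space (fun s (b : fiber B s) => k * u s b + v s b).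
Proof.
move=> uFS vFS; have ul := FS_space_family uFS; have vl := FS_space_family vFS.
apply: (@bounded_FS_space _ (cabs k * FS_norm u + FS_norm v)).
- move=> s l b c; rewrite ul vl -![_ *: _]/(_ * _); ring.
- by rewrite addr_ge0 ?mulr_ge0 ?cabs_ge0 ?FS_norm_ge0.
- move=> f; rewrite pair_with_comb//; apply: le_trans (cabsD _ _) _.
  rewrite mulrDl lerD//; last exact: FS_normP.
  by rewrite cabsM -mulrA ler_wpM2l ?cabs_ge0//; exact: FS_normP.
Qed.

Lemma FS_polarization u : FS_space u ->
  exists (n : nat) (c : 'I_n -> R[i]) (v : 'I_n -> functional_family B),
    (forall i, positive_definite (v i)) /\
    u = (fun s b => \sum_(i < n) c i * v i s b).
Proof.
move=> [H [pi [xi [eta ->]]]].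
(* Polarization over the fourth roots of unity: the sums of w and of w^2 vanish, and only the term
   in w times its conjugate survives, four times. *)
pose w (i : 'I_4) : R[i] := nth 0 [:: 1; 'i%C; -1; - 'i%C] i.
exists 4, (fun i => (4^-1)%:C * w i),
  (fun i => coefficient pi (xi + w i *: eta) (xi + w i *: eta)); split.
  by move=> i; exists H, pi, (xi + w i *: eta).
apply: functional_extensionality_dep => s; apply/funext => b.
have lE (z : R[i]) : coefficient pi (xi + z *: eta) (xi + z *: eta) b =
    coefficient pi xi xi b + z^* * coefficient pi xi eta b +
    (z * coefficient pi eta xi b + z * z^* * coefficient pi eta eta b).
  rewrite /coefficient.
  have -> : pi s b (xi + z *: eta) = z *: pi s b eta + pi s b xi.
    by rewrite addrC (rep_bounded pi b).1.
  rewrite innerP.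
  have iE (x : H) : inner x (xi + z *: eta) = inner x xi + z^* * inner x eta.
    by rewrite linearDr/= linearZr_LR.
  rewrite !iE; ring.
under eq_bigr do rewrite lE.
rewrite !big_ord_recr big_ord0 /= /w /=.
have iJ : ('i%C : R[i])^* = - 'i%C by apply: complex_eqP; rewrite /= ?oppr0.
have ii : 'i%C * 'i%C = -1 :> R[i] by rewrite -expr2 sqr_i.
have h4 : (4^-1)%:C * 4 = 1 :> R[i].
  by rewrite fmorphV rmorph_nat mulVf// pnatr_eq0.
rewrite !rmorphN/= rmorph1 iJ.
move: (coefficient pi xi xi b) (coefficient pi xi eta b) (coefficient pi eta xi b)
  (coefficient pi eta eta b) => p q r t.
(* [ring] does not know the square of the imaginary unit; this form isolates the products in which
   it is to be replaced by -1. *)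
transitivity ((4^-1)%:C * ((2 - 2 * ('i%C * 'i%C)) * q + (2 + 2 * ('i%C * 'i%C)) * r)).
  by rewrite ii -[LHS]mul1r -[X in X * q = _]h4; move: (4^-1)%:C => h; ring.
move: (4^-1)%:C ('i%C : R[i]) => h i; ring.
Qed.

End FourierStieltjes.

(** * The C*-seminorm of a representation *)

Section RepresentationNorm.
Variables (R : realType) (G : groupType) (A : cstarType R) (B : fellBundle G A).
Variables (H : hilbertType R) (pi : representation B H).
Implicit Types f g : fsec B.

Definition tnorm f : R := opnorm (Tpi pi f).

Lemma tnormP f xi : rnorm (Tpi pi f xi) <= tnorm f * rnorm xi.
Proof.
apply: (@opnormP _ _ _ _ (snorm f)); last exact: snorm_ge0.
  move=> k v; have T0 : Tpi pi f 0 = 0.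
    by apply: addr_idem; have := Tpi_linear pi f 1 0 0; rewrite !scale1r addr0.
  by have := Tpi_linear pi f k v 0; rewrite T0 !addr0.
by move=> v; exact: snormP.
Qed.

Lemma tnorm_ge0 f : 0 <= tnorm f.
Proof. by apply: opnorm_ge0 (snorm_ge0 f) => v; exact: snormP. Qed.

Lemma tnorm_le f (M : R) : 0 <= M ->
  (forall xi, rnorm (Tpi pi f xi) <= M * rnorm xi) -> tnorm f <= M.
Proof. exact: opnorm_le. Qed.

Lemma tnormD f g : tnorm (f + g) <= tnorm f + tnorm g.
Proof.
apply: tnorm_le => [|xi]; first by rewrite addr_ge0 ?tnorm_ge0.
rewrite TpiD mulrDl; apply: le_trans (rnormD _ _) _.
by rewrite lerD// tnormP.
Qed.

Lemma tnormZ_le k f : tnorm (k *: f) <= cabs k * tnorm f.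
Proof.
apply: tnorm_le => [|xi]; first by rewrite mulr_ge0 ?cabs_ge0 ?tnorm_ge0.
by rewrite TpiZ rnormZ -mulrA ler_wpM2l ?cabs_ge0// tnormP.
Qed.

Lemma tnormZ k f : tnorm (k *: f) = cabs k * tnorm f.
Proof.
apply/le_anti; rewrite tnormZ_le/=.
have [->|k0] := eqVneq k 0; first by rewrite cabs0 mul0r tnorm_ge0.
rewrite -{1}[f]scale1r -(mulVf k0) -scalerA.
apply: le_trans (ler_wpM2l (cabs_ge0 k) (tnormZ_le _ _)) _.
by rewrite mulrA -cabsM divff// cabs1 mul1r.
Qed.

Lemma tnormM f g : tnorm (sconv f g) <= tnorm f * tnorm g.
Proof.
apply: tnorm_le => [|xi]; first by rewrite mulr_ge0 ?tnorm_ge0.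
rewrite Tpi_conv; apply: le_trans (tnormP _ _) _.
by rewrite -mulrA ler_wpM2l ?tnorm_ge0// tnormP.
Qed.

Lemma rnorm_sqrE (xi : H) : rnorm xi ^+ 2 = complex.Re (inner xi xi).
Proof. by rewrite -psq_inner. Qed.

Lemma tnorm_star_le f : tnorm (sstar f) <= tnorm f.
Proof.
apply: tnorm_le => [|xi]; first exact: tnorm_ge0.
have [x0|x0] := eqVneq (rnorm (Tpi pi (sstar f) xi)) 0.
  by rewrite x0 mulr_ge0 ?tnorm_ge0 ?rnorm_ge0.
have x1 : 0 < rnorm (Tpi pi (sstar f) xi) by rewrite lt_neqAle eq_sym x0 rnorm_ge0.
rewrite -(ler_pM2l x1) -expr2 rnorm_sqrE Tpi_starr.
apply: le_trans (Re_le _) _; apply: le_trans (inner_le _ _) _.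
have := tnormP f (Tpi pi (sstar f) xi); have := rnorm_ge0 xi; nra.
Qed.

Lemma tnorm_cstar f : tnorm (sconv (sstar f) f) = tnorm f ^+ 2.
Proof.
apply/le_anti/andP; split.
  apply: le_trans (tnormM _ _) _.
  by rewrite expr2 ler_wpM2r ?tnorm_ge0// tnorm_star_le.
have s0 := tnorm_ge0 (sconv (sstar f) f).
rewrite -[X in _ <= X](sqr_sqrtr s0) ler_pXn2r ?nnegrE ?tnorm_ge0 ?sqrtr_ge0//.
apply: tnorm_le => [|xi]; first exact: sqrtr_ge0.
rewrite -(@ler_pXn2r _ 2) ?nnegrE ?mulr_ge0 ?rnorm_ge0 ?sqrtr_ge0//.
rewrite exprMn (sqr_sqrtr s0) rnorm_sqrE -tdiag_gram.
apply: le_trans (Re_le _) _; apply: le_trans (inner_le _ _) _.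
by rewrite expr2 mulrA ler_wpM2r ?rnorm_ge0// tnormP.
Qed.

Lemma opnorm_integrated f : opnorm (integrated pi (\val f)) = tnorm f.
Proof. by congr opnorm; apply/funext => xi; exact: integrated_cc. Qed.

Lemma integrated_seminorm : cstar_seminorm (fun f : section B => opnorm (integrated pi f)).
Proof.
split.
- by move=> f ff; have := tnorm_ge0 (fsec_of ff); rewrite -opnorm_integrated.
- move=> f g ff fg; have := tnormD (fsec_of ff) (fsec_of fg).
  by rewrite -!opnorm_integrated.
- move=> k f ff; have := tnormZ k (fsec_of ff).
  by rewrite -!opnorm_integrated.
- move=> f g ff fg; have := tnormM (fsec_of ff) (fsec_of fg).
  by rewrite -!opnorm_integrated.
- move=> f ff; have := tnorm_cstar (fsec_of ff).
  by rewrite -!opnorm_integrated.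
Qed.

End RepresentationNorm.

(** * The cross sectional algebra: positive functionals, norm and dual *)

Section CrossSectionalAlgebra.
Variables (R : realType) (G : groupType) (A : cstarType R) (B : fellBundle G A).
Variables (D : cstarType R) (iota : section B -> D).
Hypothesis D_cs : is_cross_sectional_algebra iota.

Local Notation j f := (iota (\val (f : fsec B))).

Lemma iotaP k (f g : fsec B) : j (k *: f + g) = k *: j f + j g.
Proof. by have [h _ _ _ _] := D_cs; exact: (h k _ _ (fsec_cc f) (fsec_cc g)). Qed.

Lemma iotaD (f g : fsec B) : j (f + g) = j f + j g.
Proof. by rewrite -{1}[f]scale1r iotaP scale1r. Qed.

Lemma iotaB (f g : fsec B) : j (f - g) = j f - j g.
Proof. by rewrite addrC -scaleN1r iotaP scaleN1r addrC. Qed.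

Lemma iotaM (f g : fsec B) : j (sconv f g) = cmul (j f) (j g).
Proof. by have [_ h _ _ _] := D_cs; exact: (h _ _ (fsec_cc f) (fsec_cc g)). Qed.

Lemma iota_star (f : fsec B) : j (sstar f) = cstar (j f).
Proof. by have [_ _ h _ _] := D_cs; exact: (h _ (fsec_cc f)). Qed.

Lemma iota_dense (d : D) (e : R) : 0 < e -> exists f : fsec B, rnorm (d - j f) <= e.
Proof.
move=> e0; have [_ _ _ h _] := D_cs.
have /(_ (ball d e%:C)) : closure (iota @` @cc R G A B) d by rewrite h.
case; first by apply: nbhsx_ballx; rewrite ltcR.
move=> _ [[f ff <-] fe]; exists (fsec_of ff).
by move: fe; rewrite -ball_normE/= rnormE ltcR => /ltW.
Qed.

Lemma snorm_le_iota (f : fsec B) : snorm f <= rnorm (j f).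
Proof.
have [_ _ _ _ h] := D_cs.
apply: snorm_le => [|H pi xi]; first exact: rnorm_ge0.
apply: le_trans (tnormP _ _ _) _; rewrite ler_wpM2r ?rnorm_ge0//.
rewrite -lee_fin (h _ (fsec_cc f)); apply: ereal_sup_ubound.
exists (fun g => opnorm (integrated pi g)); first exact: integrated_seminorm.
by rewrite opnorm_integrated.
Qed.

Section PositiveFunctional.
Variable phi : D -> R[i].
Hypothesis phi_pos : positive_functional phi.

Definition pos_act s (b : fiber B s) (x : D) : D := cmul (j (sdirac b)) x.

Lemma pos_act_linearl s (k : R[i]) (b c : fiber B s) x :
  pos_act (k *: b + c) x = k *: pos_act b x + pos_act c x.
Proof. by rewrite /pos_act sdirac_linear iotaP cmulDl cmulZl. Qed.

Lemma pos_act_mul s t (b : fiber B s) (c : fiber B t) x :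
  pos_act b (pos_act c x) = pos_act (fmul b c) x.
Proof. by rewrite /pos_act cmulA -iotaM sconv_dirac strans_dirac. Qed.

Lemma pos_act_adj s (b : fiber B s) x y :
  gns_form phi_pos (pos_act b x) y = gns_form phi_pos x (pos_act (fstar b) y).
Proof.
rewrite -[LHS]/(phi _) -[RHS]/(phi _); congr phi.
by rewrite /pos_act -sstar_dirac iota_star cstarM cstarK cmulA.
Qed.

Definition pos_action : star_action B (gns_form phi_pos) :=
  @StarAction R G A B D (gns_form phi_pos) pos_act
    (fun s b => cmul_linearr (j (sdirac b))) pos_act_linearl pos_act_mul pos_act_adj.

Lemma pos_cyclic (M : R) : 0 <= M ->
  (forall v, cabs (phi v) ^+ 2 <= M ^+ 2 * complex.Re (phi (cmul (cstar v) v))) ->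
  exists xi : rkhs (gns_form phi_pos), rkv xi = (fun v => (phi v)^*) /\ rnorm xi <= M.
Proof.
move=> M0 phiM; apply: rkhs_intro => [k x y|].
  by rewrite phi_pos.1 rmorphD rmorphM.
split=> // v; rewrite cabsJ -(@ler_pXn2r _ 2) ?nnegrE ?cabs_ge0 ?mulr_ge0 ?psn_ge0//.
by rewrite exprMn sqr_psn; exact: phiM.
Qed.

Lemma pos_Tpi (xi : rkhs (gns_form phi_pos)) f v :
  rkv (Tpi (gns_rep pos_action) f xi) v = rkv xi (cmul (cstar (j f)) v).
Proof.
elim/fsec_ind: f => [f g IHf IHg|s b].
  by rewrite TpiD rkvD IHf IHg iotaD cstarD cmulDl rkvDr.
by rewrite Tpi_dirac gnsE -iota_star sstar_dirac.
Qed.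

(** The vector representing [phi] is the functional taking [v] to the conjugate of [phi v], in place
    of a limit along an approximate unit. It belongs to the GNS space by [pfun_bounded], since [phi]
    is not assumed continuous. *)
Lemma positive_functional_coefficient :
  positive_definite (fun s (b : fiber B s) => phi (iota (dirac_section b))).
Proof.
have [M M0 phiM] := pfun_bounded phi_pos.
have [|v|xi [xiE _]] := @pos_cyclic (Num.sqrt M); first exact: sqrtr_ge0.
  by rewrite sqr_sqrtr.
exists (rkhs (gns_form phi_pos)), (gns_rep pos_action), xi.
apply: functional_extensionality_dep => s; apply/funext => b.
rewrite (@gns_coefficient _ _ _ _ _ _ pos_action xi xi s b (j (sdirac b))).
  by rewrite xiE conjCK.
move=> v; rewrite xiE -[RHS]/(phi _) -(pfunJ phi_pos) cstarM.
by rewrite -sstar_dirac iota_star cstarK.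
Qed.

End PositiveFunctional.

Lemma iota_norm (f : fsec B) : rnorm (j f) = snorm f.
Proof.
apply/le_anti; rewrite snorm_le_iota andbT.
have [phi [phi_pos phi1 phi_j]] := norming_positive_functional (j f).
have [||xi [xiE xi1]] := @pos_cyclic phi phi_pos 1; first exact: ler01.
  by move=> v; rewrite expr1n; apply: (pfun_bound phi_pos) => // y; rewrite mul1r.
(* The operator of [f] sends [xi] to the class of [j f] itself, whose norm the choice of [phi] makes
   at least that of [j f] in [D]. *)
have jf : Tpi (gns_rep (pos_action phi_pos)) f xi = rkhat (gns_form phi_pos) (j f).
  apply: rkv_inj; apply/funext => v; rewrite pos_Tpi xiE rkhatE.
  by rewrite -(pfunJ phi_pos) cstarM cstarK.
apply: (@le_trans _ _ (snorm f * rnorm xi)); last by rewrite ler_piMr ?snorm_ge0.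
apply: le_trans (snormP f (gns_rep (pos_action phi_pos)) xi); rewrite jf rnorm_rkhs rkn_hat.
by rewrite -(@ler_pXn2r _ 2) ?nnegrE ?psn_ge0 ?rnorm_ge0// sqr_psn.
Qed.

Lemma dual_ext (psi psi' : D -> R[i]^o) : continuous_dual psi -> continuous_dual psi' ->
  (forall f, psi (j f) = psi' (j f)) -> psi = psi'.
Proof.
move=> [pl pc] [pl' pc'] e; apply/funext => d.
have [M M0 h] := continuous_linear_bound pl pc.
have [M' M0' h'] := continuous_linear_bound pl' pc'.
have lB (g : D -> R[i]^o) x y : linear g -> g x - g y = g (x - y).
  by move=> gl; have := gl (-1) y x; rewrite !scaleN1r (addrC _ x) (addrC _ (g x)) => ->.
apply: (lipschitz_extension_unique (g := fun f : fsec B => psi (j f)) iota_dense M0 M0') => f.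
  by rewrite lB//; exact: h.
by rewrite e lB//; exact: h'.
Qed.

Lemma dual_family (psi : D -> R[i]^o) : linear psi ->
  linear_family (W := R[i]^o) (fun s (b : fiber B s) => psi (j (sdirac b))).
Proof. by move=> pl s k b c; rewrite sdirac_linear iotaP pl. Qed.

Lemma dual_pair (psi : D -> R[i]^o) f : linear psi ->
  pair_with (fun s (b : fiber B s) => psi (j (sdirac b))) f = psi (j f).
Proof.
move=> pl; have ul := dual_family pl.
elim/fsec_ind: f => [f g IHf IHg|s b]; last exact: total_dirac.
by rewrite (pair_withD ul) IHf IHg iotaD; have := pl 1 (j f) (j g); rewrite !scale1r => ->.
Qed.

Lemma FS_extension u : FS_space u -> exists psi : D -> R[i]^o,
  [/\ continuous_dual psi, forall f, psi (j f) = pair_with u f &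
      forall d, cabs (psi d) <= FS_norm u * rnorm d].
Proof.
move=> uFS; have ul := FS_space_family uFS; have N0 := FS_norm_ge0 uFS.
have uB f g : pair_with u (f - g) = pair_with u f - pair_with u g.
  by rewrite addrC -scaleN1r (pair_withP ul) mulN1r addrC.
have ext := lipschitz_extension iota_dense (g := pair_with u) N0.
have [|psi psiP] := choice (ext _).
  by move=> f g; rewrite -uB -iotaB iota_norm; exact: FS_normP.
have psi_j f : psi (j f) = pair_with u f.
  apply/eqP; rewrite -subr_eq0; apply/eqP/cabs_eq0/le_anti; rewrite cabs_ge0 andbT.
  by have := psiP (j f) f; rewrite subrr rnorm0 mulr0.
have psi_le d : cabs (psi d) <= FS_norm u * rnorm d.
  have := psiP d 0; rewrite (pair_with0 ul) subr0.
  have -> : j 0 = 0 by have := iotaD 0 0; rewrite addr0 => /addr_idem.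
  by rewrite subr0.
have psi_lin : linear (psi : D -> R[i]^o).
  move=> k d d'.
  apply/eqP; rewrite -subr_eq0; apply/eqP/cabs_eq0/le_anti; rewrite cabs_ge0 andbT.
  have k0 := cabs_ge0 k; have [N NE] : exists N, N = FS_norm u by eexists.
  rewrite -NE in N0 psiP.
  apply: ge_small => e e0; rewrite add0r.
  (* With approximations within [t], the error terms add up to at most 2 N (|k| + 1) t; [N + 1]
     keeps the divisor positive when N = 0. *)
  have c0 : 0 < 2 * ((N + 1) * (cabs k + 1)) by rewrite !mulr_gt0// ltr_wpDl.
  have [f] := iota_dense d (divr_gt0 e0 c0); have [g] := iota_dense d' (divr_gt0 e0 c0).
  have [t tE] : exists t, t = e / (2 * ((N + 1) * (cabs k + 1))) by eexists.
  rewrite -tE => hg hf.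
  have et : e = t * (2 * ((N + 1) * (cabs k + 1))) by rewrite tE mulfVK// lt0r_neq0.
  have -> : psi (k *: d + d') - (k *: psi d + psi d') =
      psi (k *: d + d') - pair_with u (k *: f + g) +
      (k * (pair_with u f - psi d) + (pair_with u g - psi d')).
    by rewrite (pair_withP ul) -[k *: psi d]/(k * psi d); ring.
  have h1 := psiP (k *: d + d') (k *: f + g).
  have h2 : rnorm (k *: d + d' - j (k *: f + g)) <= cabs k * t + t.
    rewrite iotaP opprD addrACA -scalerBr; apply: le_trans (rnormD _ _) _.
    by rewrite rnormZ lerD// ler_wpM2l.
  apply: le_trans (cabsD _ _) _; apply: le_trans (lerD h1 (cabsD _ _)) _.
  rewrite cabsM (cabsB (pair_with u f)) (cabsB (pair_with u g)).
  have h3 := psiP d f; have h4 := psiP d' g.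
  have h5 : cabs k * cabs (psi d - pair_with u f) <= cabs k * (N * t).
    by rewrite ler_wpM2l//; apply: le_trans h3 _; rewrite ler_wpM2l.
  have h6 : cabs (psi d' - pair_with u g) <= N * t.
    by apply: le_trans h4 _; rewrite ler_wpM2l.
  have h7 := ler_wpM2l N0 h2.
  have t0 : 0 <= t * (cabs k + 1).
    by rewrite mulr_ge0 ?addr_ge0//; apply: le_trans hg; exact: rnorm_ge0.
  apply: le_trans (lerD h7 (lerD h5 h6)) _; rewrite et; lra.
exists psi; split=> //; split=> //.
exact: (rnorm_bounded_continuous psi_lin psi_le).
Qed.

Lemma dual_isomorphism : exists Phi : functional_family B -> D -> R[i]^o,
  [/\ forall (k : R[i]) u v, FS_space u -> FS_space v ->
         Phi (fun s b => k * u s b + v s b) = (fun d => k * Phi u d + Phi v d),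
      set_bij (@FS_space R G A B) (@continuous_dual R D) Phi &
      forall u, FS_space u -> opnorm (Phi u) = FS_norm u].
Proof.
have [Phi PhiP] : exists Phi : functional_family B -> D -> R[i]^o, forall u, FS_space u ->
    [/\ continuous_dual (Phi u), forall f, Phi u (j f) = pair_with u f &
      forall d, cabs (Phi u d) <= FS_norm u * rnorm d].
  (* [Phi] is defined on all families; its values outside [FS_space] carry no information. *)
  suff /choice[Phi PhiP] : forall u, exists psi : D -> R[i]^o, FS_space u ->
      [/\ continuous_dual psi, forall f, psi (j f) = pair_with u f &
        forall d, cabs (psi d) <= FS_norm u * rnorm d] by exists Phi.
  move=> u; have [/FS_extension[psi ?]|nu] := pselect (FS_space u); first by exists psi.
  by exists (fun=> 0) => /nu.
have comb k (psi psi' : D -> R[i]^o) : continuous_dual psi -> continuous_dual psi' ->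
    continuous_dual (fun d => k * psi d + psi' d : R[i]^o).
  move=> [pl pc] [pl' pc']; have [M M0 h] := continuous_linear_bound pl pc.
  have [M' M0' h'] := continuous_linear_bound pl' pc'.
  have lk : linear (fun d => k * psi d + psi' d : R[i]^o).
    move=> l x y; rewrite pl pl' -![_ *: _]/(_ * _); ring.
  have le d : rnorm (k * psi d + psi' d : R[i]^o) <= (cabs k * M + M') * rnorm d.
    rewrite mulrDl -mulrA; apply: le_trans (cabsD _ _) (lerD _ (h' d)).
    by rewrite cabsM ler_wpM2l ?cabs_ge0//; exact: h.
  by split; [exact: lk|exact: (rnorm_bounded_continuous lk le)].
exists Phi; split.
- move=> k u v uFS vFS; have [Pu uE _] := PhiP _ uFS; have [Pv vE _] := PhiP _ vFS.
  have [Pw wE _] := PhiP _ (FS_space_comb k uFS vFS).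
  apply: (dual_ext Pw (comb k _ _ Pu Pv)) => f.
  by rewrite wE uE vE (pair_with_comb _ _ (FS_space_family uFS) (FS_space_family vFS)).
- split.
  + by move=> u /PhiP[].
  + move=> u v /set_mem uFS /set_mem vFS e.
    have [Pu uE _] := PhiP _ uFS; have [Pv vE _] := PhiP _ vFS.
    apply: functional_extensionality_dep => s; apply/funext => b.
    have := uE (sdirac b); rewrite e vE.
    by rewrite /pair_with !total_dirac//; exact: FS_space_family.
  + move=> psi [pl pc].
    have [M M0 h] := continuous_linear_bound pl pc.
    (* The preimage of [psi] is its restriction to the fibres; it is bounded for the universal norm
       because [iota] is isometric for it. *)
    pose u : functional_family B := fun s (b : fiber B s) => psi (j (sdirac b)).
    have uFS : FS_space u.
      apply: (bounded_FS_space (dual_family pl) M0) => f.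
      by rewrite dual_pair// -iota_norm; exact: h.
    have [Pu uE _] := PhiP _ uFS; exists u => //.
    exact: (dual_ext Pu (conj pl pc) (fun f => etrans (uE f) (dual_pair f pl))).
- move=> u uFS; have [[pl pc] uE uM] := PhiP _ uFS; have N0 := FS_norm_ge0 uFS.
  apply/le_anti/andP; split; first exact: opnorm_le.
  apply: FS_norm_le => // [|f]; first exact: (@opnorm_ge0 _ _ _ (Phi u) (FS_norm u) uM N0).
  have psi0 : Phi u 0 = 0 by apply: addr_idem; have := pl 1 0 0; rewrite !scale1r addr0.
  have psiZ k d : Phi u (k *: d) = k *: Phi u d by have := pl k d 0; rewrite psi0 !addr0.
  rewrite -uE -iota_norm; exact: (@opnormP _ _ _ (Phi u) (FS_norm u) psiZ uM N0 (j f)).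
Qed.

End CrossSectionalAlgebra.

Theorem proposition3p4 (R : realType) (G : groupType) (A : cstarType R)
    (B : fellBundle G A) (satB : saturated B) :
  [/\
    forall (D : cstarType R) (iota : section B -> D),
      is_cross_sectional_algebra iota ->
      forall phi : D -> R[i], positive_functional phi ->
        positive_definite (fun s (b : fiber B s) => phi (iota (dirac_section b))),
    forall u, FS_space u ->
      exists (n : nat) (c : 'I_n -> R[i]) (v : 'I_n -> functional_family B),
        (forall i, positive_definite (v i)) /\
        u = (fun s b => \sum_(i < n) c i * v i s b),
    (forall (k : R[i]) u v, FS_space u -> FS_space v ->
       FS_space (fun s (b : fiber B s) => k * u s b + v s b)) /\
    forall (D : cstarType R) (iota : section B -> D),
      is_cross_sectional_algebra iota ->
      exists Phi : functional_family B -> D -> R[i]^o,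
        [/\ forall (k : R[i]) u v, FS_space u -> FS_space v ->
               Phi (fun s b => k * u s b + v s b) =
               (fun d => k * Phi u d + Phi v d),
            set_bij (@FS_space R G A B) (@continuous_dual R D) Phi &
            forall u, FS_space u -> opnorm (Phi u) = FS_norm u],
    forall phi, FS_space phi ->
      exists (H : hilbertType R) (pi : representation B H) (xi eta : H),
        phi = coefficient pi xi eta /\ FS_norm phi = rnorm xi * rnorm eta &
    forall phi, FS_space phi ->
      FS_norm phi =
      inf [set r | exists (H : hilbertType R) (pi : representation B H)
                     (xi eta : H),
                     phi = coefficient pi xi eta /\ r = rnorm xi * rnorm eta]].
Proof.
split.
- by move=> D iota D_cs phi phi_pos; exact: (positive_functional_coefficient D_cs phi_pos).
- exact: FS_polarization.
- split; first by move=> k u v; exact: FS_space_comb.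
  by move=> D iota D_cs; exact: (dual_isomorphism D_cs).
- exact: FS_attained.
- exact: FS_norm_inf.
Qed.
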